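(* Let $L$ be slowly varying at the origin and let $\alpha\in\mathbb{R}$. Suppose that $f_{0}\in\mathcal{D}^{*\prime}(0,\infty)$ has quasiasymptotic behavior $$f_{0}(\varepsilon x)\sim c\,\varepsilon^{\alpha}L(\varepsilon)\,x^{\alpha}\quad\text{in }\mathcal{D}^{*\prime}(0,\infty)\text{ as }\varepsilon\to0^{+}.$$ Then $f_{0}$ admits extensions to $\mathbb{R}$ (as elements of $\mathcal{D}^{*\prime}$). Let $f\in\mathcal{D}^{*\prime}$ be any such extension with support in $[0,\infty)$. Then: (I) If $\alpha\notin\mathbb{Z}_{-}$, then there is $g\in\mathcal{D}^{*\prime}$ with $\operatorname{supp}g\subseteq\{0\}$ such that $$f(\varepsilon x)-g(\varepsilon x)\sim c\,\varepsilon^{\alpha}L(\varepsilon)\,x_{+}^{\alpha}\quad\text{in }\mathcal{D}^{*\prime}\text{ as }\varepsilon\to0^{+}.$$ (II) If $\alpha=-k\in\mathbb{Z}_{-}$, then there are a function $b$ satisfying, for each $a>0$, $$b(ax)=b(x)+c\,\frac{(-1)^{k-1}}{(k-1)!}L(x)\log a+o(L(x)),\qquad x\to0^{+},$$ and an ultradistribution $g\in\mathcal{D}^{*\prime}$ with $\operatorname{supp}g\subseteq\{0\}$ such that $$f(\varepsilon x)=c\,\frac{L(\varepsilon)}{\varepsilon^{k}}\operatorname{Pf}\!\left(\frac{H(x)}{x^{k}}\right)+\frac{b(\varepsilon)}{\varepsilon^{k}}\delta^{(k-1)}(x)+g(\varepsilon x)+o\!\left(\frac{L(\varepsilon)}{\varepsilon^{k}}\right)\quad\text{in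 }\mathcal{D}^{*\prime}\text{ as }\varepsilon\to0^{+}.$$
   Context: $\mathbb{N}=\{0,1,2,\dots\}$, $\mathbb{Z}_{-}=\{-1,-2,\dots\}$. Weight sequence: $(M_p)_{p\in\mathbb{N}}$ is a fixed sequence of positive numbers satisfying Komatsu's conditions (M.1) $M_p^2\le M_{p-1}M_{p+1}$ for $p\ge1$; (M.2) there are $A,H>0$ with $M_p\le AH^p\min_{0\le q\le p}M_qM_{p-q}$ for all $p$; (M.3) there is $A>0$ with $\sum_{q=p+1}^\infty M_{q-1}/M_q\le A\,pM_p/M_{p+1}$ for $p\ge1$. Spaces: the symbol $*$ denotes either $(M_p)$ (Beurling case) or $\{M_p\}$ (Roumieu case). For $\Omega\subseteq\mathbb{R}$ open, $\mathcal{E}^{(M_p)}(\Omega)$ (resp. $\mathcal{E}^{\{M_p\}}(\Omega)$) is the space of $\varphi\in C^\infty(\Omega)$ such that for every compact $K\subset\Omega$ and every $h>0$ (resp. some $h>0$) $\sup_{x\in K,p\in\mathbb{N}}|\varphi^{(p)}(x)|/(h^pM_p)<\infty$; $\mathcal{D}^*(\Omega)$ is the subspace of compactly supported elements, with its usual locally convex topology (inductive limit over compact $K$ of the spaces $\mathcal D^*_K$ of elements supported in $K$, where $\mathcal D^*_K$ is the projective limit as $h\to0^+$, resp. inductive limit as $h\to\infty$, of the Banach spaces with norms $\sup_{x\in K,p}|\varphi^{(p)}(x)|/(h^pM_p)$). $\mathcal{D}^{*\prime}(\Omega)$ is its dual (ultradistributions on $\Omega$), and $\mathcal{D}^*=\mathcal{D}^*(\mathbb{R})$,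 $\mathcal{D}^{*\prime}=\mathcal{D}^{*\prime}(\mathbb{R})$. An extension of $f_0\in\mathcal{D}^{*\prime}(0,\infty)$ to $\mathbb{R}$ is an $f\in\mathcal{D}^{*\prime}$ whose restriction to $(0,\infty)$ is $f_0$. Slow variation: a function $L$ on $(0,\infty)$ is slowly varying at the origin if $\widetilde L(x)=L(1/x)$ is slowly varying at infinity, i.e. $\widetilde L$ is measurable, positive for large arguments and $\widetilde L(ax)\sim\widetilde L(x)$ as $x\to\infty$ for every $a>0$. Quasiasymptotics: $f(\varepsilon x)$ is defined by $\langle f(\varepsilon x),\phi(x)\rangle=\varepsilon^{-1}\langle f(x),\phi(x/\varepsilon)\rangle$. For $\Omega=\mathbb{R}$ or $\Omega=(0,\infty)$, $f(\varepsilon x)\sim\varepsilon^\alpha L(\varepsilon)g(x)$ in $\mathcal{D}^{*\prime}(\Omega)$ as $\varepsilon\to0^+$ means $\lim_{\varepsilon\to0^+}\langle f(\varepsilon x)/(\varepsilon^\alpha L(\varepsilon)),\phi(x)\rangle=\langle g,\phi\rangle$ for all $\phi\in\mathcal{D}^*(\Omega)$; $g=0$ is allowed, in particular $c$ is an arbitrary constant, possibly $0$. Asymptotic expansions with remainder $o(\cdot)$ in $\mathcal{D}^{*\prime}$ are understood after pairing with each fixed test function $\phi\in\mathcal{D}^*$. Distributions: $\delta$ is the Dirac delta, $H$ the Heaviside function. For $\alpha>-1$, $x_+^\alpha=x^\alpha H(x)$; for other $\alpha\notin\mathbb{Z}_-$, $x_+^\alpha=\frac{\Gamma(\alpha+1)}{\Gamma(\alpha+k+1)}\frac{d^k}{dx^k}x_+^{\alpha+k}$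 for any $k\in\mathbb{N}$ with $\alpha+k>-1$. $\operatorname{Pf}(H(x)/x^k)$, $k\ge1$, is the Hadamard finite part regularization: $$\left\langle\operatorname{Pf}\frac{H(x)}{x^k},\phi\right\rangle=\int_0^1\frac{\phi(x)-\sum_{j=0}^{k-1}\phi^{(j)}(0)x^j/j!}{x^k}dx+\int_1^\infty\frac{\phi(x)}{x^k}dx-\sum_{j=0}^{k-2}\frac{\phi^{(j)}(0)}{j!\,(k-1-j)}.$$ *)

(* Defs.v *)
From HB Require Import structures.
From mathcomp Require Import all_boot all_order all_algebra.
From mathcomp Require Import all_classical all_reals all_analysis.
From mathcomp Require Import complex.

Set Implicit Arguments.
Unset Strict Implicit.
Unset Printing Implicit Defensive.

Import Order.TTheory GRing.Theory Num.Theory numFieldNormedType.Exports.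

Local Open Scope classical_set_scope.
Local Open Scope ring_scope.
Local Open Scope complex_scope.

(* Beurling is * = (M_p), Roumieu is * = {M_p}. *)
Variant ultraclass := Beurling | Roumieu.

(* Conditions (M.1), (M.2), (M.3) of Komatsu. *)
Definition weight_sequence (R : realType) (M : nat -> R) : Prop :=
  [/\ forall p, 0 < M p,
      forall p, (1 <= p)%N -> M p ^+ 2 <= M p.-1 * M p.+1,
      exists A H : R, [/\ 0 < A, 0 < H & forall p q, (q <= p)%N ->
        M p <= A * H ^+ p * (M q * M (p - q)%N)] &
      exists2 A : R, 0 < A & forall p, (1 <= p)%N ->
        (\sum_(p.+1 <= q <oo) (M q.-1 / M q)%:E
           <= (A * p%:R * M p / M p.+1)%:E)%E].

Section UltradifferentiableFunctions.
Context {R : realType}.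
Implicit Types (phi psi : R -> R[i]) (K U : set R) (h : R).

(* R[i] is not a normed module over R in the library, so derivatives in the
   real variable are taken on the real and imaginary parts. *)
Definition cderivn (n : nat) phi : R -> R[i] := fun x =>
  derive1n n (fun y => complex.Re (phi y)) x +i*
  derive1n n (fun y => complex.Im (phi y)) x.

Definition smooth_on U phi : Prop := forall (n : nat) (x : R), U x ->
  derivable (derive1n n (fun y => complex.Re (phi y))) x 1 /\
  derivable (derive1n n (fun y => complex.Im (phi y))) x 1.

(* sup_{x in K, p} |phi^(p)(x)| / (h^p M_p); the point 0 is added so that the
   value is 0, and not -oo, when K is empty. *)
Definition ultranorm (M : nat -> R) K h phi : \bar R :=
  ereal_sup ([set 0%E] `|`
    [set (ComplexField.Normc.normc (cderivn px.1 phi px.2)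
            / (h ^+ px.1 * M px.1))%:E | px in [set: nat] `*` K]).

(* The space E^*(U). *)
Definition ultradifferentiable (s : ultraclass) (M : nat -> R) U phi : Prop :=
  smooth_on U phi /\
  forall K, compact K -> K `<=` U ->
    match s with
    | Beurling => forall h, 0 < h -> (ultranorm M K h phi < +oo)%E
    | Roumieu => exists2 h, 0 < h & (ultranorm M K h phi < +oo)%E
    end.

Definition fsupp phi : set R := closure [set x | phi x != 0].

(* The space D^*(U); its elements are regarded as functions on the whole line,
   vanishing outside U. *)
Definition testfun (s : ultraclass) (M : nat -> R) U : set (R -> R[i]) :=
  [set phi | [/\ ultradifferentiable s M U phi,
                 compact (fsupp phi) & fsupp phi `<=` U]].

(* The space D^*_K. *)
Definition testfun_in (s : ultraclass) (M : nat -> R) U K : set (R -> R[i]) :=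
  [set phi | testfun s M U phi /\ fsupp phi `<=` K].

(* The continuous seminorms of D^*(U). A seminorm is continuous for a locally
   convex inductive limit iff its restriction to every step is continuous; for
   the projective limit of the norms ultranorm M K h, which increase as h
   decreases, iff it is dominated by a multiple of one of them. *)
Definition continuous_seminorm (s : ultraclass) (M : nat -> R) U
    (q : (R -> R[i]) -> R) : Prop :=
  [/\ forall phi psi, testfun s M U phi -> testfun s M U psi ->
        q (fun x => phi x + psi x) <= q phi + q psi,
      forall (a : R[i]) phi, testfun s M U phi ->
        q (fun x => a * phi x) = ComplexField.Normc.normc a * q phi &
      forall K, compact K -> K `<=` U ->
        let dominated h := exists2 C : R, 0 < C &
          forall phi, testfun_in s M U K phi ->
            ((q phi)%:E <= C%:E * ultranorm M K h phi)%E in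
        match s with
        | Beurling => exists2 h, 0 < h & dominated h
        | Roumieu => forall h, 0 < h -> dominated h
        end].

End UltradifferentiableFunctions.

(* Elements of the duals D^*'(U) are encoded as maps on all functions; only
   their values on D^*(U) are constrained or used. *)
Definition functional (R : realType) : Type := (R -> R[i]) -> R[i].

Section Ultradistributions.
Context {R : realType}.
Implicit Types (f g T : functional R) (phi psi : R -> R[i]) (U D : set R).

Definition ultradistribution (s : ultraclass) (M : nat -> R) U f : Prop :=
  (forall (a : R[i]) phi psi, testfun s M U phi -> testfun s M U psi ->
     f (fun x => a * phi x + psi x) = a * f phi + f psi) /\
  (forall phi0, testfun s M U phi0 -> forall e : R, 0 < e ->
     exists2 q, continuous_seminorm s M U q &
       forall phi, testfun s M U phi -> q (fun x => phi x - phi0 x) < 1 ->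
         ComplexField.Normc.normc (f phi - f phi0) < e).

Definition extends (s : ultraclass) (M : nat -> R) U f0 f : Prop :=
  forall phi, testfun s M U phi -> f phi = f0 phi.

(* The complement of the union of the open sets on which f vanishes. *)
Definition usupport (s : ultraclass) (M : nat -> R) f : set R :=
  ~` [set x | exists U, [/\ open U, U x &
                forall phi, testfun s M U phi -> f phi = 0]].

(* f(eps x) *)
Definition dilate (eps : R) f : functional R := fun phi =>
  (eps^-1)%:C * f (fun x => phi (x / eps)).

Definition uderivn (n : nat) T : functional R := fun phi =>
  (-1) ^+ n * T (cderivn n phi).

(* f(eps x) ~ rho(eps) g(x) in D^*'(U) as eps -> 0^+ *)
Definition quasiasymptotic (s : ultraclass) (M : nat -> R) U
    f (rho : R -> R) g : Prop :=
  forall phi, testfun s M U phi ->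
    (dilate eps f phi / (rho eps)%:C : R[i]^o) @[eps --> (0 : R)^'+]
      --> (g phi : R[i]^o).

Definition cintegral D (u : R -> R[i]) : R[i] :=
  (\int[lebesgue_measure]_(x in D) complex.Re (u x)) +i*
  (\int[lebesgue_measure]_(x in D) complex.Im (u x)).

(* The function x^alpha on (0, oo), acting by integration; on D^*(0, oo) this
   is defined for every alpha, on D^*(R) only for alpha > -1. *)
Definition xpow (alpha : R) : functional R := fun phi =>
  cintegral `]0, +oo[ (fun x => (x `^ alpha)%:C * phi x).

(* x_+^alpha for alpha not in {-1, -2, ...}. Here k is the least natural number
   such that alpha + k > -1, and the factor Gamma(alpha+1) / Gamma(alpha+k+1)
   is written as 1 / ((alpha+1) ... (alpha+k)). *)
Definition xplus (alpha : R) : functional R :=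
  let k := Num.truncn (- alpha) in
  fun phi => ((\prod_(1 <= j < k.+1) (alpha + j%:R))^-1)%:C
             * uderivn k (xpow (alpha + k%:R)) phi.

Definition delta0 : functional R := fun phi => phi 0.

(* Pf(H(x)/x^k), k >= 1 *)
Definition Pf (k : nat) : functional R := fun phi =>
  cintegral `]0, 1[
    (fun x => (phi x - \sum_(0 <= j < k) cderivn j phi 0 * (x ^+ j / j`!%:R)%:C)
              / (x ^+ k)%:C)
  + cintegral `]1, +oo[ (fun x => phi x / (x ^+ k)%:C)
  - \sum_(0 <= j < k.-1) cderivn j phi 0 / (j`!%:R * (k.-1 - j)%:R)%:C.

End Ultradistributions.

Section SlowVariation.
Context {R : realType}.
Implicit Types L : R -> R.

(* Measurability for the Lebesgue (Caratheodory) sigma-algebra, which is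
   larger than the Borel one. *)
Definition lebesgue_measurable_fun (D : set R) (u : R -> R) : Prop :=
  measurable_fun
    (D : set (caratheodory_type ((wlength (idfun : R -> R))^*)%mu)) u.

Definition slowly_varying_at_infinity L : Prop :=
  [/\ lebesgue_measurable_fun `]0, +oo[ L,
      \forall x \near +oo, 0 < L x &
      forall a : R, 0 < a -> (L (a * x) / L x) @[x --> +oo] --> (1 : R)].

Definition slowly_varying_at_origin L : Prop :=
  slowly_varying_at_infinity (fun x => L x^-1).

End SlowVariation.

(* Main.v *)
(* Real and imaginary parts reduce everything to a real functional [f] on test
   functions of the half line. Let [theta] be an ultradifferentiable cutoff, 0 on
   (-oo, 1] and 1 on [2, oo), and let [m] satisfy [alpha + m + 1 > 0]. With
   [r_m u] the Taylor remainder of order [m] of [u] at 0,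
     F u = f (theta u) + lim_J f ((theta (2^J x) - theta x) r_m u)
   is an extension: the dyadic pieces at scale [2^-J] are of relative size
   [2^-J^(alpha + m + 1)], up to slow variation, uniformly in [u] by the
   uniform boundedness principle applied to the dilates of [f]. Dilating [F],
     F(e x) u = f(e x) (theta u) + lim_J f(e x) ((theta (2^J x) - theta x) r_m u)
                - sum_(i < m) u^(i)(0) / i! * e^(-i-1) * moment_i e,
   where [moment_i e] is [f] applied to [(theta (x / e) - theta x) x^i]. The first
   two terms have a quasiasymptotic limit given by absolutely convergent
   integrals. The increments [moment_i (2 e) - moment_i e] are asymptotically
   known; if [alpha + i + 1 < 0] a Stolz argument gives [moment_i] itself, and
   if [alpha + i + 1 = 0] the moment is, up to normalization, the function [b].
   Any other extension supported in the half line differs from [F] by an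
   ultradistribution supported at 0. *)

(* The obstacle is uniformity. The hypothesis gives only a limit for each test function, whereas the
   dyadic pieces of [u], brought back to scale one, are infinitely many different functions; summing
   them needs one norm and one constant. For fixed support interval [[a, b]] and class parameter
   [h0] the tests form a complete metrizable space, and a gliding hump there supplies both.
   Multiplication by a cutoff raises the class parameter, so the cutoff is built with bounds for
   every [h], in the Roumieu case too; (M.3) provides one. The order [m] is the least with
   [alpha + m + 1 > 0]. A larger one would bring in moments that converge to constants, to be
   absorbed in [g]; with the least order, [g = f - F] is enough. The Stolz argument reaches every
   small [e] from a dyadic window, on which [L] must be bounded above and away from 0; this is where
   measurability of [L] enters. The constants that depend on [theta] cancel between the main limit
   and the moments, which leaves the finite part, cut sharply at 1. *)
Require Import Defs.
From HB Require Import structures.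
From mathcomp Require Import all_boot all_order all_algebra.
From mathcomp Require Import all_classical all_reals all_analysis.
From mathcomp Require Import complex measurable_realfun ring lra.

Set Implicit Arguments.
Unset Strict Implicit.
Unset Printing Implicit Defensive.

Import Order.TTheory GRing.Theory Num.Theory numFieldNormedType.Exports.

Local Open Scope classical_set_scope.
Local Open Scope ring_scope.

(** * Sequences of derivatives *)

Section Jets.
Context {R : realType}.
Implicit Types (u v : R -> R) (U V : nat -> R -> R).

(** Exhibiting all derivatives at once gives smoothness and closed formulas for every [derive1n] by
    a single check, without an induction that carries derivability side conditions. *)
Definition jet U := forall n (x : R), is_derive x (1 : R) (U n) (U n.+1 x).
Definition smooth u := forall n (x : R), derivable (derive1n n u) x 1.

Lemma smooth_jet u : smooth u -> jet (fun n => derive1n n u).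
Proof.
by move=> su n x; apply: DeriveDef; [exact: su | rewrite derive1nS derive1E].
Qed.

Lemma jet_derive1n U : jet U -> forall n, derive1n n (U 0%N) = U n.
Proof.
move=> jU; elim=> // n IH; rewrite derive1nS IH; apply/funext => x.
by rewrite derive1E; exact: (@derive_val _ _ _ _ _ _ _ (jU n x)).
Qed.

Lemma derive1n_zero n : derive1n n (fun=> 0 : R) = fun=> 0.
Proof. by apply: (jet_derive1n (U := fun _ _ => 0)) => m x; exact: is_derive_cst. Qed.

Lemma jet_smooth U : jet U -> smooth (U 0%N).
Proof.
move=> jU n x; rewrite jet_derive1n//.
exact: (@ex_derive _ _ _ _ _ _ _ (jU n x)).
Qed.

Lemma jet_lin c U V : jet U -> jet V -> jet (fun n x => c * U n x + V n x).
Proof.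
move=> jU jV n x.
have dU := jU n x; have dV := jV n x.
have : is_derive x (1 : R) (c *: U n + V n) (c *: U n.+1 x + V n.+1 x) by apply: is_deriveD.
by [].
Qed.

Lemma jet_scale t U : jet U -> jet (fun n x => t ^+ n * U n (t * x)).
Proof.
move=> jU n x.
have dU := jU n (t * x).
have dt : is_derive x (1 : R) (fun y => t * y) t.
  have := @is_deriveZ _ _ _ id t x 1 _ (is_derive_id x 1).
  by rewrite /GRing.scale/= mulr1.
have dc : is_derive x (1 : R) (U n \o (fun y => t * y)) (U n.+1 (t * x) * t).
  exact: is_derive1_comp.
have := @is_deriveZ _ _ _ _ (t ^+ n) x 1 _ dc.
by rewrite /GRing.scale/= (mulrC _ t) mulrA -exprSr.
Qed.

Definition jmul U V n x := \sum_(i < n.+1) 'C(n, i)%:R * (U i x * V (n - i)%N x).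

(** Pascal's rule: once the extreme terms are split off on both sides, the two shifted sums merge
    through [binS]. *)
Lemma jet_mul U V : jet U -> jet V -> jet (jmul U V).
Proof.
move=> jU jV n x.
pose h (i : 'I_n.+1) : R -> R := 'C(n, i)%:R *: (U i * V (n - i)%N).
pose dh (i : 'I_n.+1) : R :=
  'C(n, i)%:R *: (U i x *: V (n - i).+1%N x + V (n - i)%N x *: U i.+1 x).
have dhE i : is_derive x (1 : R) (h i) (dh i).
  have dU := jU i x; have dV := jV (n - i)%N x.
  by apply: is_deriveZ; apply: is_deriveM.
have := @is_derive_sum _ _ _ n.+1 h x 1 dh dhE.
have -> : \sum_(i < n.+1) h i = jmul U V n.
  by apply/funext => y; rewrite fct_sumE /jmul; apply: eq_bigr.
suff -> : \sum_(i < n.+1) dh i = jmul U V n.+1 x by [].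
pose a i j := U i x * V j x.
have e1 : \sum_(i < n.+1) dh i = \sum_(i < n.+1) 'C(n, i)%:R * a i (n.+1 - i)%N
     + \sum_(i < n.+1) 'C(n, i)%:R * a i.+1 (n - i)%N.
  rewrite -big_split; apply: eq_bigr => i _.
  by rewrite /dh /GRing.scale/= /a (subSn (ltn_ord i : (i <= n)%N)); ring.
rewrite e1 /jmul big_ord_recl [RHS]big_ord_recl/= !bin0 subn0 -addrA; congr (_ + _).
rewrite [X in _ + X]big_ord_recr [RHS]big_ord_recr/= !binn addrA; congr (_ + _).
  rewrite -big_split; apply: eq_bigr => i _.
  by rewrite /bump/= add1n binS natrD /a subSS; ring.
Qed.

Lemma jet_monomial k : jet (fun n x => (k ^_ n)%:R * x ^+ (k - n)).
Proof.
move=> n x.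
have dx := @is_deriveX _ _ (id : R -> R) (k - n)%N x 1 1 (is_derive_id x 1).
have := @is_deriveZ _ _ _ _ (k ^_ n)%:R x 1 _ dx.
have e : (id : R -> R) ^+ (k - n) = fun y => y ^+ (k - n).
  by rewrite exprfctE.
rewrite e; have e2 : (k ^_ n)%:R *: (((k - n)%:R * id x ^+ (k - n).-1) *: 1) =
  (k ^_ n.+1)%:R * x ^+ (k - n.+1) :> R.
  by rewrite /GRing.scale/= mulr1 mulrA -natrM ffactnSr subnS.
by rewrite -e2.
Qed.

(** Increments of either sign occur below, so the intermediate point is located by its distance to
    [x] rather than by an oriented interval. *)
Lemma MVT_sym u (du : R -> R) x y : (forall z : R, is_derive z (1 : R) u (du z)) ->
  exists2 z, `|z - x| <= `|y - x| & u y - u x = du z * (y - x).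
Proof.
move=> dv.
have cu a b : {within `[a, b], continuous u}.
  apply: continuous_subspaceT => z; apply: differentiable_continuous.
  by apply/derivable1_diffP; exact: (@ex_derive _ _ _ _ _ _ _ (dv z)).
have [xy|yx] := leP x y.
  have [z] := MVT_segment xy (fun z _ => dv z) (cu x y).
  rewrite in_itv/= => /andP[xz zy] e; exists z => //.
  by rewrite !ger0_norm ?subr_ge0// lerB.
have [z] := MVT_segment (ltW yx) (fun z _ => dv z) (cu y x).
rewrite in_itv/= => /andP[xz zy] e; exists z => //.
  by rewrite !ler0_norm ?subr_le0 ?(ltW yx)// lerN2 lerB.
by rewrite -(opprB (u x)) e -mulrN opprB.
Qed.

(* Unlike the definition of the derivative, this criterion passes to pointwise limits. *)
Lemma quadratic_is_derive u (x l C : R) :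
  (forall h, `|u (x + h) - u x - h * l| <= C * h ^+ 2) -> is_derive x (1 : R) u l.
Proof.
move=> H.
have C0 : 0 <= C by have := H 1; rewrite expr1n mulr1; apply: le_trans.
have cv : (fun h => h^-1 *: ((u \o shift x) (h *: 1) - u x)) @ 0^' --> l.
  apply/cvgrPdist_lt => e e0.
  near=> h.
  have h0 : h != 0 by near: h; exact: nbhs_dnbhs_neq.
  rewrite /= /GRing.scale/= mulr1.
  have -> : l - h^-1 * (u (h + x) - u x) = - (h^-1 * (u (x + h) - u x - h * l)).
    by rewrite (addrC h) [in RHS]mulrBr mulKf// opprB.
  rewrite normrN normrM normfV ltr_pdivrMl ?normr_gt0//.
  apply: le_lt_trans (H h) _.
  rewrite -(ger0_norm (sqr_ge0 h)) normrX expr2 mulrA (mulrC `|h|) ltr_pM2r ?normr_gt0//.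
  have hd : `|h| < e / (C + 1).
    near: h; apply: (@dnbhs0_lt R R); rewrite divr_gt0//; lra.
  have C1 : 0 < C + 1 by lra.
  rewrite ltr_pdivlMr// in hd; apply: le_lt_trans hd.
  by rewrite mulrC ler_wpM2l//; lra.
apply: DeriveDef; first by apply/cvg_ex; exists l.
exact/cvg_lim.
Unshelve. all: by end_near.
Qed.

(** Two applications of the mean value theorem; the factor 1/2 of Taylor's formula is given up,
    since [quadratic_is_derive] accepts any constant. *)
Lemma jet_quadratic U C n : jet U -> (forall x, `|U n.+2 x| <= C) ->
  forall x h, `|U n (x + h) - U n x - h * U n.+1 x| <= C * h ^+ 2.
Proof.
move=> jU bU x h.
have [z] := MVT_sym x (x + h) (jU n).
rewrite addrAC subrr add0r => zh ->.
have [w _ e] := MVT_sym x z (jU n.+1).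
rewrite (mulrC h) -mulrBl e.
rewrite -(ger0_norm (sqr_ge0 h)) normrX expr2 mulrA normrM ler_pM// normrM ler_pM//.
Qed.

End Jets.

(** * Bounds on all derivatives *)

Section Classes.
Context {R : realType} (s : ultraclass) (M : nat -> R).
Context (M_gt0 : forall p, 0 < M p).
Context (M_logconvex : forall p, (1 <= p)%N -> M p ^+ 2 <= M p.-1 * M p.+1).
Implicit Types (u v : R -> R) (U V : nat -> R -> R) (K : set R).

(** The intervals [[v k - c k, v k + c k]] are nested, so the supremum of their left ends lies in
    all of them; [c] need not tend to 0. *)
Lemma telescope_limit (v c : nat -> R) :
  (forall k, `|v k.+1 - v k| <= c k - c k.+1) -> (forall k, 0 <= c k) ->
  exists l, forall k, `|l - v k| <= c k.
Proof.
move=> vc c0.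
have lo k n : v k - c k <= v (k + n)%N - c (k + n)%N.
  elim: n => [|n IH]; first by rewrite addn0.
  apply: le_trans IH _; rewrite addnS; have := vc (k + n)%N; rewrite ler_norml; lra.
have hi k n : v (k + n)%N + c (k + n)%N <= v k + c k.
  elim: n => [|n IH]; first by rewrite addn0.
  apply: le_trans _ IH; rewrite addnS; have := vc (k + n)%N; rewrite ler_norml; lra.
have lohi j k : v j - c j <= v k + c k.
  apply: le_trans (lo j k) _; apply: le_trans (hi k j); rewrite addnC.
  have := c0 (k + j)%N; lra.
pose A := range (fun k => v k - c k).
have A0 : A !=set0 by exists (v 0%N - c 0%N); exists 0%N.
have ub k : ubound A (v k + c k) by move=> _ [j _ <-].
exists (sup A) => k; rewrite ler_distl; apply/andP; split.
  by apply: ub_le_sup; [exists (v 0%N + c 0%N) | exists k].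
by apply: ge_sup.
Qed.

Lemma halving_limit (v c : nat -> R) :
  (forall k, `|v k.+1 - v k| <= c k) -> (forall k, 0 <= c k) ->
  (forall k, 2 * c k.+1 <= c k) ->
  exists l, forall k, `|l - v k| <= 2 * c k.
Proof.
move=> vc c0 cc; apply: telescope_limit => k; last by rewrite mulr_ge0.
by apply: le_trans (vc k) _; have := cc k; lra.
Qed.

Lemma is_derive_near0 u (x : R) : (\forall y \near x, u y = 0) ->
  is_derive x (1 : R) u 0.
Proof.
move=> u0; have ux := nbhs_singleton u0.
have cv : (fun h => h^-1 *: ((u \o shift x) (h *: 1) - u x)) @ 0^' --> (0 : R).
  apply/cvgrPdist_lt => e e0.
  have : \forall h \near (0 : R), u (h + x) = 0.
    have : (fun h : R => h + x) @ (0 : R) --> x.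
      by rewrite -[X in _ --> X]add0r; apply: cvgD; [exact: cvg_id | exact: cvg_cst].
    by move=> /(_ _ u0).
  move=> /nbhs_dnbhs.
  apply: filterS => h /= uh.
  by rewrite /GRing.scale/= mulr1 uh ux subrr mulr0 subrr normr0.
apply: DeriveDef; first by apply/cvg_ex; exists 0.
exact/cvg_lim.
Qed.

(** Vanishing passes from each order to the next because [K] is open; this also yields derivability
    at the points off a support. *)
Lemma derive1n_open0 u K : open K -> (forall x, K x -> u x = 0) ->
  forall p x, K x -> is_derive x (1 : R) (derive1n p u) 0 /\ derive1n p u x = 0.
Proof.
move=> oK u0.
have main p : (forall x, K x -> derive1n p u x = 0) ->
    forall x, K x -> is_derive x (1 : R) (derive1n p u) 0.
  move=> p0 x Kx; apply: is_derive_near0.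
  by apply: filterS (open_nbhs_nbhs (conj oK Kx)) => y Ky; exact: p0.
have zero p : forall x, K x -> derive1n p u x = 0.
  elim: p => // p IH x Kx; rewrite derive1nS derive1E.
  exact: (@derive_val _ _ _ _ _ _ _ (main _ IH x Kx)).
by move=> p x Kx; split; [exact: main (zero p) x Kx | exact: zero p x Kx].
Qed.

Lemma open_out (a b : R) : open [set x | ~~ (a <= x <= b)].
Proof.
rewrite (_ : [set x | _] = ~` `[a, b]); last first.
  by apply/seteqP; split => x /=; rewrite in_itv/= => /negP.
by rewrite openC; exact: itv_closed.
Qed.

Lemma derive1n_out u (a b : R) : (forall x, ~~ (a <= x <= b) -> u x = 0) ->
  forall p x, ~~ (a <= x <= b) -> derive1n p u x = 0.
Proof.
by move=> u0 p x xab; have [] := @derive1n_open0 u _ (@open_out a b) u0 p x xab.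
Qed.

Section Algebra.
Context (u v : R -> R) (su : smooth u) (sv : smooth v).
Let ju := smooth_jet su.
Let jv := smooth_jet sv.

Lemma smooth_lin (c : R) : smooth (fun x => c * u x + v x).
Proof. exact: jet_smooth (jet_lin c ju jv). Qed.

Lemma derive1n_lin (c : R) p :
  derive1n p (fun x => c * u x + v x) = fun x => c * derive1n p u x + derive1n p v x.
Proof. exact: jet_derive1n (jet_lin c ju jv) p. Qed.

Lemma smooth_scale (t : R) : smooth (fun x => u (t * x)).
Proof.
have := jet_smooth (jet_scale t ju); congr smooth.
by apply/funext => x; rewrite expr0 mul1r.
Qed.

Lemma derive1n_scale (t : R) p :
  derive1n p (fun x => u (t * x)) = fun x => t ^+ p * derive1n p u (t * x).
Proof.
rewrite -[RHS](jet_derive1n (jet_scale t ju)); congr derive1n.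
by apply/funext => x; rewrite expr0 mul1r.
Qed.

Lemma smooth_mul : smooth (fun x => u x * v x).
Proof.
have := jet_smooth (jet_mul ju jv); congr smooth.
by apply/funext => x; rewrite /jmul big_ord1 bin0 mul1r.
Qed.

Lemma derive1n_mul p x : derive1n p (fun x => u x * v x) x =
  \sum_(i < p.+1) 'C(p, i)%:R * (derive1n i u x * derive1n (p - i) v x).
Proof.
have := jet_derive1n (jet_mul ju jv) p; rewrite -/(jmul _ _ p x) => <-.
congr (derive1n p _ x).
by apply/funext => y; rewrite /jmul big_ord1 bin0 mul1r.
Qed.
End Algebra.

(** (M.1) says that the ratios [M k.+1 / M k] increase. This is [step], in multiplied form; it moves
    the indices one at a time from one factor to the other. *)
Lemma logconvex_mul i j : M i * M j <= M 0%N * M (i + j)%N.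
Proof.
have step k n : M k.+1 * M (k + n)%N <= M k * M (k + n).+1%N.
  elim: n => [|n IH]; first by rewrite addn0 mulrC.
  have M2 := @M_logconvex (k + n).+1 isT.
  rewrite /= in M2; rewrite !addnS.
  (* Multiplying by [M (k + n)] and [M (k + n).+1] makes room for (M.1) at index [(k + n).+1]. *)
  rewrite -(ler_pM2r (M_gt0 (k + n))) -(ler_pM2r (M_gt0 (k + n).+1)).
  apply: (@le_trans _ _ (M k.+1 * M (k + n)%N * M (k + n).+1 ^+ 2)).
    by rewrite expr2; rewrite le_eqVlt; apply/orP; left; apply/eqP; ring.
  apply: (@le_trans _ _ (M k * M (k + n).+1 * (M (k + n)%N * M (k + n).+2))).
    by apply: ler_pM => //; rewrite ?mulr_ge0 ?sqr_ge0// ltW.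
  by rewrite le_eqVlt; apply/orP; left; apply/eqP; ring.
elim: i => [|i IH]; first by rewrite add0n.
rewrite addSn -(ler_pM2r (M_gt0 i)).
apply: (@le_trans _ _ (M i.+1 * (M 0%N * M (i + j)%N))).
  by rewrite -mulrA (mulrC (M j)) ler_pM2l.
by rewrite mulrCA -mulrA (mulrC _ (M i)) ler_pM2l.
Qed.

Definition bnd (h N : R) K u :=
  forall p x, K x -> `|derive1n p u x| <= N * (h ^+ p * M p).

Lemma bnd_ge0 h N K u x : K x -> bnd h N K u -> 0 <= N.
Proof.
move=> Kx /(_ 0%N x Kx); rewrite expr0 mul1r => b.
by rewrite -(pmulr_lge0 _ (M_gt0 0)); apply: le_trans b.
Qed.

Lemma bnd_mono h h' N N' K K' u : 0 < h -> h <= h' -> N <= N' -> 0 <= N' ->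
  K' `<=` K -> bnd h N K u -> bnd h' N' K' u.
Proof.
move=> h0 hh NN N0 KK b p x /KK Kx; apply: le_trans (b p x Kx) _.
have A : 0 <= h ^+ p * M p by rewrite mulr_ge0 ?exprn_ge0 ?ltW.
apply: (@le_trans _ _ (N' * (h ^+ p * M p))); first by rewrite ler_wpM2r.
by rewrite ler_wpM2l// ler_pM2r// lerXn2r// nnegrE ltW// (lt_le_trans h0).
Qed.

Lemma bnd_min h h' N u : 0 < Num.min h h' -> bnd (Num.min h h') N setT u ->
  bnd h N setT u /\ bnd h' N setT u.
Proof.
move=> m0 bu; have N0 := bnd_ge0 (I : setT (0 : R)) bu.
by split; apply: (bnd_mono m0 _ (lexx N) N0 (@subset_refl _ setT) bu); rewrite ge_min lexx ?orbT.
Qed.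

Lemma bnd0 h N K : 0 < h -> 0 <= N -> bnd h N K (fun=> 0).
Proof.
by move=> h0 N0 p x _; rewrite derive1n_zero normr0 !mulr_ge0 ?exprn_ge0 ?(ltW h0) ?(ltW (M_gt0 p)).
Qed.

Lemma bnd_lin h N N' (c : R) K u v : smooth u -> smooth v ->
  bnd h N K u -> bnd h N' K v -> bnd h (`|c| * N + N') K (fun x => c * u x + v x).
Proof.
move=> su sv bu bv p x Kx; rewrite derive1n_lin// mulrDl.
apply: le_trans (ler_normD _ _) _; rewrite lerD ?bv// normrM -mulrA.
by rewrite ler_wpM2l// bu.
Qed.

Lemma bnd_scale h N (t : R) u : smooth u -> 0 < t ->
  bnd h N setT u -> bnd (t * h) N setT (fun x => u (t * x)).
Proof.
move=> su t0 bu p x _; have t1 := ltW t0; rewrite derive1n_scale// normrM ger0_norm ?exprn_ge0//.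
have -> : N * ((t * h) ^+ p * M p) = t ^+ p * (N * (h ^+ p * M p)) by rewrite exprMn; ring.
by rewrite ler_pM2l ?exprn_gt0//; exact: bu.
Qed.

(** In the Leibniz sum [M (p - i) * M i <= M 0 * M p], and the binomial theorem adds the powers up
    to [(h1 + h2) ^+ p]; hence parameters add under products. *)
Lemma bnd_mul h1 N1 h2 N2 K u v : 0 < h1 -> 0 < h2 -> smooth u -> smooth v ->
  bnd h1 N1 K u -> bnd h2 N2 K v ->
  bnd (h1 + h2) (M 0%N * (N1 * N2)) K (fun x => u x * v x).
Proof.
move=> h10 h20 su sv bu bv p x Kx; rewrite derive1n_mul//.
have N10 := bnd_ge0 Kx bu; have N20 := bnd_ge0 Kx bv.
apply: le_trans (ler_norm_sum _ _ _) _.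
rewrite exprDn mulr_suml mulr_sumr (reindex_inj rev_ord_inj)/=.
apply: ler_sum => i _; have ip : (i <= p)%N by rewrite -ltnS.
rewrite subSS (subKn ip).
rewrite normrM normr_nat bin_sub// -[(_ * _) *+ _]mulr_natl.
set C := 'C(p, i)%:R; have C0 : 0 <= C by rewrite ler0n.
apply: (@le_trans _ _ (C * ((N1 * (h1 ^+ (p - i) * M (p - i)%N)) * (N2 * (h2 ^+ i * M i))))).
  by rewrite ler_wpM2l// normrM ler_pM// ?bu// bv.
have e : N1 * (h1 ^+ (p - i) * M (p - i)%N) * (N2 * (h2 ^+ i * M i)) =
  (N1 * N2) * (h1 ^+ (p - i) * h2 ^+ i) * (M (p - i)%N * M i) by ring.
have lc := logconvex_mul (p - i) i; rewrite subnK// in lc.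
rewrite e -[X in _ <= X]/(_ * (_ * (h1 ^+ (p - i) * h2 ^+ i) * M p)).
have -> : M 0%N * (N1 * N2) * (C * (h1 ^+ (p - i) * h2 ^+ i) * M p) =
  C * (N1 * N2 * (h1 ^+ (p - i) * h2 ^+ i) * (M 0%N * M p)) by ring.
by rewrite ler_wpM2l// ler_wpM2l// !mulr_ge0// exprn_ge0// ltW.
Qed.

(* The parameters [h] at which a function of class [h0] is bounded: every [h] in
   the Beurling case (where [h0] plays no role), only [h0] in the Roumieu case.
   This treats both cases at once: the steps of the inductive limit are indexed
   by [h0], and the seminorms on each step by [hset h0]. *)
Definition hset (h0 : R) : set R :=
  match s with Beurling => [set h | 0 < h] | Roumieu => [set h0] end.

Lemma hset_gt0 h0 h : 0 < h0 -> hset h0 h -> 0 < h.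
Proof. by rewrite /hset; case: s => //= h00 ->. Qed.

Lemma hset_neq0 h0 : 0 < h0 -> exists h, hset h0 h.
Proof. by rewrite /hset; case: s => h00; [exists 1 => /= | exists h0]. Qed.

Lemma hset_scale h0 t h : 0 < t -> hset h0 h -> hset (t * h0) (t * h).
Proof. by rewrite /hset; case: s => /= t0 h00; [rewrite mulr_gt0 | rewrite h00]. Qed.

(** Since parameters add under products, a bound sought at [h] is shared between the two factors: by
    halves in the Beurling case, in the only possible way in the Roumieu case. *)
Lemma hset_split h1 h2 h : 0 < h1 -> 0 < h2 -> hset (h1 + h2) h ->
  exists k1 k2, [/\ hset h1 k1, hset h2 k2 & k1 + k2 = h].
Proof.
rewrite /hset; case: s => /= h10 h20 hh.
  by exists (h / 2), (h / 2); split; [rewrite divr_gt0 | rewrite divr_gt0 | lra].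
by exists h1, h2; split.
Qed.

Lemma hset_min h0 h h' : hset h0 h -> hset h0 h' -> hset h0 (Num.min h h').
Proof.
rewrite /hset; case: s => /= [h1 h2|-> ->]; first by rewrite lt_min h1.
by rewrite minxx.
Qed.

(** Countably many seminorms suffice on each step, which makes the sequential gliding hump
    construction possible. *)
Lemma hset_cofinal h0 : 0 < h0 -> exists e : nat -> R,
  (forall k, hset h0 (e k)) /\ forall h, hset h0 h -> exists k, e k <= h.
Proof.
rewrite /hset; case: s => /= h00; last by exists (fun=> h0); split => // h ->; exists 0%N.
exists (fun k => k.+1%:R^-1); split => [k|h hh]; first by rewrite invr_gt0.
have := ltr_add_invr hh; move=> [k]; rewrite add0r => /ltW; by exists k.
Qed.

(** One step of the inductive limit: a Banach space in the Roumieu case, a Frechet space in the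
    Beurling case. The support condition is pointwise and forces [u = 0] when [b < a]. *)
Definition rt (h0 a b : R) u := [/\ smooth u,
  forall x, ~~ (a <= x <= b) -> u x = 0 &
  forall h, hset h0 h -> exists N, bnd h N setT u].

Lemma rt_mono (h0 h0' a a' b b' : R) u : 0 < h0 -> h0 <= h0' -> a' <= a -> b <= b' ->
  rt h0 a b u -> rt h0' a' b' u.
Proof.
move=> h00 hh aa bb [su u0 bu]; split => //.
  move=> x xab; apply: u0; apply: contra xab => /andP[ax xb].
  by rewrite (le_trans aa ax) (le_trans xb bb).
move: bu; rewrite /hset; case: s => // bu h /= ->.
have [N bN] := bu _ erefl; exists N; have N0 := @bnd_ge0 _ _ setT u 0 I bN.
exact: bnd_mono bN.
Qed.

Lemma rt_lin h0 a b c u v : rt h0 a b u -> rt h0 a b v ->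
  rt h0 a b (fun x => c * u x + v x).
Proof.
move=> [su u0 bu] [sv v0 bv]; split; first exact: smooth_lin.
  by move=> x xab; rewrite u0// v0// mulr0 addr0.
move=> h hh; have [N bN] := bu h hh; have [N' bN'] := bv h hh.
by exists (`|c| * N + N'); exact: bnd_lin.
Qed.

Lemma rt_scale h0 a b t u : 0 < t -> rt h0 a b u ->
  rt (t * h0) (a / t) (b / t) (fun x => u (t * x)).
Proof.
move=> t0 [su u0 bu]; split; first exact: smooth_scale.
  by move=> x; rewrite ler_pdivrMr// ler_pdivlMr// (mulrC x); exact: u0.
move=> h hh; have ti : 0 < t^-1 by rewrite invr_gt0.
have := hset_scale ti hh; rewrite mulKf ?gt_eqF// => /bu[N bN].
by exists N; have := bnd_scale su t0 bN; rewrite mulVKf ?gt_eqF.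
Qed.

Lemma smooth_cst (c : R) : smooth (fun=> c).
Proof.
have j : jet (fun n (_ : R) => if n is 0%N then c else 0).
  by move=> [|n] x; exact: is_derive_cst.
exact: (jet_smooth j).
Qed.

Lemma rt0 h0 a b : rt h0 a b (fun=> 0).
Proof.
split; [exact: smooth_cst|by []|] => h hh; exists 0 => p x _.
by rewrite derive1n_zero normr0 mul0r.
Qed.

Lemma bnd_local h N a b u : a <= b ->
  (forall x, ~~ (a <= x <= b) -> u x = 0) ->
  bnd h N [set x | a <= x <= b] u -> 0 < h -> bnd h N setT u.
Proof.
move=> ab u0 bu h0 p x _.
have [xab|xab] := boolP (a <= x <= b); first exact: bu.
have N0 : 0 <= N by apply: (@bnd_ge0 h N _ u a _ bu); rewrite /= lexx ab.
by rewrite (@derive1n_out u a b)// normr0 !mulr_ge0// ?exprn_ge0// ltW.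
Qed.

(* The second factor needs bounds only on the support of the first one. *)
Lemma bnd_mul_local h1 N1 h2 N2 a b u v : a <= b -> 0 < h1 -> 0 < h2 ->
  smooth u -> smooth v -> (forall x, ~~ (a <= x <= b) -> u x = 0) ->
  bnd h1 N1 setT u -> bnd h2 N2 [set x | a <= x <= b] v ->
  bnd (h1 + h2) (M 0%N * (N1 * N2)) setT (fun x => u x * v x).
Proof.
move=> ab h10 h20 su sv u0 bu bv; apply: (@bnd_local _ _ a b) => //.
- by move=> x xab; rewrite u0// mul0r.
- by apply: bnd_mul => // p x _; exact: bu.
- exact: addr_gt0.
Qed.

End Classes.

(** * Uniform boundedness *)

Section UniformBoundedness.
Context {R : realType} (s : ultraclass) (M : nat -> R).
Context (M_gt0 : forall p, 0 < M p).
Implicit Types (u v : R -> R).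

Lemma half_small (E e : R) : 0 < e -> exists k, E * 2^-1 ^+ k <= e.
Proof.
move=> e0; have := archi_boundP (normr_ge0 (E / e)); set k := Num.bound _ => Ek.
exists k; rewrite exprVn -ler_pdivlMr ?invr_gt0 ?exprn_gt0//.
rewrite invrK mulrC -ler_pdivrMr//; apply: le_trans (ler_norm _) _.
apply: le_trans (ltW Ek) _.
by rewrite -natrX ler_nat ltnW// ltn_expl.
Qed.

Lemma ler_half_small (x y E : R) : (forall k, x <= y + E * 2^-1 ^+ k) -> x <= y.
Proof.
move=> H; apply/ler_addgt0Pr => e e0; have [k Ek] := half_small E e0.
by apply: le_trans (H k) _; rewrite lerD2l.
Qed.

Lemma halving_pow (c : nat -> R) : (forall k, 2 * c k.+1 <= c k) ->
  forall k, c k <= c 0%N * 2^-1 ^+ k.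
Proof.
move=> cc; elim=> [|k IH]; first by rewrite expr0 mulr1.
by rewrite exprSr mulrA ler_pdivlMr// mulrC; apply: le_trans (cc k) IH.
Qed.

Let bound_near_limit (X0 Xk Y c0 ck B : R) : `|X0| <= B -> `|Y - X0| <= 2 * c0 ->
  `|Y - Xk| <= 2 * ck -> ck <= c0 -> `|Xk| <= B + 4 * c0.
Proof. by rewrite !ler_norml; lra. Qed.

Let taylor_limit (X Xt X' Y Yt Y' t B c1 c1' c2 c2' q : R) :
  `|Xt - X - t * X'| <= B -> `|Yt - Xt| <= 2 * c1 -> `|Y - X| <= 2 * c1 ->
  `|Y' - X'| <= 2 * c2 -> c1 <= c1' * q -> c2 <= c2' * q ->
  `|Yt - Y - t * Y'| <= B + (4 * c1' + `|t| * (2 * c2')) * q.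
Proof.
move=> H1 H2 H3 H4 H5 H6.
have H7 : `|t * (Y' - X')| <= `|t| * (2 * (c2' * q)).
  by rewrite normrM ler_wpM2l//; apply: le_trans H4 _; rewrite ler_pM2l.
have -> : Yt - Y - t * Y' = (Xt - X - t * X') + (Yt - Xt) - (Y - X) - t * (Y' - X') by ring.
have -> : B + (4 * c1' + `|t| * (2 * c2')) * q =
  B + 2 * (c1' * q) + 2 * (c1' * q) + `|t| * (2 * (c2' * q)) by ring.
apply: le_trans (ler_normB _ _) _; apply: lerD => //.
apply: le_trans (ler_normB _ _) _; apply: lerD; last first.
  by apply: le_trans H3 _; rewrite ler_pM2l.
apply: le_trans (ler_normD _ _) _; apply: lerD => //.
by apply: le_trans H2 _; rewrite ler_pM2l.
Qed.

(** All derivatives converge pointwise. The quadratic Taylor estimate holds along the sequence with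
    one constant and survives the limit, so the limits of the derivatives are the derivatives of the
    limit. *)
Lemma rt_complete (h0 a b : R) (x : nat -> R -> R) (h eta : nat -> R) :
  0 < h0 -> (forall k, rt s M h0 a b (x k)) -> (forall k, hset s h0 (h k)) ->
  (forall k, h k.+1 <= h k) -> (forall g, hset s h0 g -> exists k, h k <= g) ->
  (forall k, 0 <= eta k) -> (forall k, 2 * eta k.+1 <= eta k) ->
  (forall k, bnd M (h k) (eta k) setT (fun z => -1 * x k z + x k.+1 z)) ->
  exists y, rt s M h0 a b y /\
    forall k, bnd M (h k) (2 * eta k) setT (fun z => -1 * x k z + y z).
Proof.
move=> h00 rx hh hdec hcof eta0 etadec bx.
have hk0 k : 0 < h k by exact: hset_gt0 (hh k).
have jx k : jet (fun p => derive1n p (x k)) by apply: smooth_jet; case: (rx k).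
have dx k p z : derive1n p (fun z => -1 * x k z + x k.+1 z) z =
    - derive1n p (x k) z + derive1n p (x k.+1) z.
  by case: (rx k) => ? _ _; case: (rx k.+1) => ? _ _; rewrite derive1n_lin// mulN1r.
pose c p k := eta k * (h k ^+ p * M p).
have c0 p k : 0 <= c p k by rewrite !mulr_ge0// ?exprn_ge0// ltW.
have cdec p k : 2 * c p k.+1 <= c p k.
  rewrite /c mulrA; apply: ler_pM; rewrite ?mulr_ge0// ?exprn_ge0//; try exact: ltW.
  by rewrite ler_pM2r// lerXn2r// ?nnegrE ltW.
have ccdec p := halving_pow (cdec p).
have lim p z : exists l, forall k, `|l - derive1n p (x k) z| <= 2 * c p k.
  apply: halving_limit => // k.
  by have := bx k p z I; rewrite dx addrC.
have [Y HY] : exists Y : nat * R -> R, forall pz k,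
    `|Y pz - derive1n pz.1 (x k) pz.2| <= 2 * c pz.1 k.
  have /boolp.choice[Y HY] : forall pz : nat * R, exists l, forall k,
      `|l - derive1n pz.1 (x k) pz.2| <= 2 * c pz.1 k by move=> [p z]; exact: lim.
  by exists Y.
pose U p z := Y (p, z).
have HU p z k : `|U p z - derive1n p (x k) z| <= 2 * c p k by exact: (HY (p, z)).
have [N bN] : exists N, bnd M (h 0%N) N setT (x 0%N) by case: (rx 0%N) => _ _; apply.
have jU : jet U.
  move=> p z.
  (* Bounds the derivative of order [p.+2] of every [x k]: each of them, like that of [x 0], is
     close to the limit. *)
  pose C := N * (h 0%N ^+ p.+2 * M p.+2) + 4 * c p.+2 0%N.
  apply: (@quadratic_is_derive _ _ _ _ C) => t.
  apply: (@ler_half_small _ _ (4 * c p 0%N + `|t| * (2 * c p.+1 0%N))) => k.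
  have bk w : `|derive1n p.+2 (x k) w| <= C.
    have ck : c p.+2 k <= c p.+2 0%N.
      apply: le_trans (ccdec _ _) _; rewrite ler_piMr//.
      by rewrite exprn_ile1// ?invr_ge0// invf_le1// ler1n.
    exact: (bound_near_limit (bN p.+2 w I) (HU p.+2 w 0%N) (HU p.+2 w k) ck).
  exact: (taylor_limit (jet_quadratic (jx k) bk z t) (HU p (z + t) k) (HU p z k)
    (HU p.+1 z k) (ccdec p k) (ccdec p.+1 k)).
have dU : forall p, derive1n p (U 0%N) = U p by exact: jet_derive1n.
have by_ k : bnd M (h k) (2 * eta k) setT (fun z => -1 * x k z + U 0%N z).
  move=> p z _; rewrite derive1n_lin; [|by case: (rx k)|exact: jet_smooth].
  by rewrite dU mulN1r addrC -mulrA.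
exists (U 0%N); split => //; split; first exact: jet_smooth.
  move=> z zab; apply/eqP; rewrite -normr_le0.
  apply: (@ler_half_small _ _ (2 * c 0%N 0%N)) => k; rewrite add0r.
  have := HU 0%N z k; case: (rx k) => _ /(_ z zab) xz _.
  rewrite derive1n0 xz subr0 => /le_trans; apply.
  by rewrite -mulrA ler_pM2l.
move=> g hg; have [k hkg] := hcof g hg.
have [_ _ /(_ _ hg)[N' bN']] := rx k.
exists (`|1| * N' + 2 * eta k).
have e2 : 0 <= 2 * eta k by rewrite mulr_ge0.
have bd := bnd_mono M_gt0 (hk0 k) hkg (lexx _) e2 (@subset_refl _ setT) (by_ k).
have sx : smooth (x k) by case: (rx k).
have sd : smooth (fun z => -1 * x k z + U 0%N z) by apply: smooth_lin => //; exact: jet_smooth.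
have := bnd_lin 1 sx sd bN' bd; congr (bnd _ _ _ _ _).
by apply/funext => z; rewrite mul1r mulN1r addNKr.
Qed.

(* Gliding hump: if the bound fails, a series of humps [x k.+1 - x k], each harmless
   for the functionals chosen earlier, converges to a [y] with [T e y] unbounded. *)
Lemma uniform_boundedness (T : R -> (R -> R) -> R) (h0 a b : R) : 0 < h0 ->
  (forall e c u v, 0 < e -> rt s M h0 a b u -> rt s M h0 a b v ->
     T e (fun x => c * u x + v x) = c * T e u + T e v) ->
  (forall e, 0 < e -> exists h C, [/\ hset s h0 h, 0 <= C & forall u N,
     rt s M h0 a b u -> bnd M h N setT u -> `|T e u| <= C * N]) ->
  (forall u, rt s M h0 a b u -> exists C d, 0 < d /\
     forall e, 0 < e < d -> `|T e u| <= C) ->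
  exists h C d, [/\ hset s h0 h, 0 <= C, 0 < d & forall e u N, 0 < e < d ->
     rt s M h0 a b u -> bnd M h N setT u -> `|T e u| <= C * N].
Proof.
move=> h00 Tlin Tdom Tbd; apply: contrapT => contra.
have rt0 := rt0 s M h0 a b.
have [ec [hec ecof]] := hset_cofinal s h00.
pose valid (st : R * R * (R -> R)) :=
  [/\ hset s h0 st.1.1, 0 < st.1.2 & rt s M h0 a b st.2].
(* One stage of the construction: from the current sum [x], with [h] and [eta] limiting what may
   still be added, it finds [e], the next sum [x'] and tighter limits [h'], [eta']. *)
pose good (kst : nat * (R * R * (R -> R))) (o : R * (R * R * (R -> R))) :=
  let: (k, (h, eta, x)) := kst in let: (e, (h', eta', x')) := o in
  valid (h, eta, x) ->
  [/\ valid (h', eta', x'), 0 < e < k.+1%:R^-1, h' <= h /\ h' <= ec k, 2 * eta' <= eta &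
   [/\ bnd M h eta setT (fun z => -1 * x z + x' z), k.+1%:R <= `|T e x'| &
      forall u, rt s M h0 a b u -> bnd M h' (2 * eta') setT u -> `|T e u| <= 1]].
have /boolp.choice[F HF] : forall kst, exists o, good kst o.
  move=> [k [[h eta] x]].
  have [[/= hh eta0 rx]|nv] := pselect (valid (h, eta, x)); last by exists (0, (0, 0, fun=> 0)).
  have h_gt0 := hset_gt0 h00 hh.
  have [e [u [N [e0 ru bu Tu]]]] : exists e u N, [/\ 0 < e < k.+1%:R^-1,
     rt s M h0 a b u, bnd M h N setT u & k.+1%:R / eta * N < `|T e u|].
    apply: contrapT => H; apply: contra.
    exists h, (k.+1%:R / eta), k.+1%:R^-1; split => //.
    - by rewrite divr_ge0// ltW.
    - move=> e u N e0 ru bu; rewrite leNgt; apply/negP => lt; apply: H.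
      by exists e, u, N.
  have e_gt0 : 0 < e by case/andP: e0.
  have [h1 [C [hh1 C0 TC]]] := Tdom e e_gt0.
  have N0 : 0 <= N by exact: (@bnd_ge0 _ _ M_gt0 _ _ setT u 0 I bu).
  have Npos : 0 < N.
    rewrite lt_neqAle N0 andbT eq_sym; apply/negP => /eqP N00.
    have : bnd M h1 0 setT u.
      by move=> p z zt; have := bu p z zt; rewrite N00 !mul0r.
    move=> /(TC _ _ ru); rewrite mulr0 leNgt => /negP; apply.
    by move: Tu; rewrite N00 mulr0.
  pose v z := (eta / N) * u z + 0.
  have rv : rt s M h0 a b v by apply: rt_lin.
  have sm w : rt s M h0 a b w -> smooth w by case.
  have b0 : bnd M h 0 setT (fun=> 0) by exact: bnd0.
  have bv : bnd M h eta setT v.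
    have := bnd_lin (eta / N) (sm _ ru) (sm _ rt0) bu b0.
    by rewrite ger0_norm ?divr_ge0 ?(ltW eta0)// divfK ?gt_eqF// addr0.
  have T0 : T e (fun=> 0) = 0.
    have := Tlin e 1 _ _ e_gt0 rt0 rt0.
    rewrite (_ : (fun x => _) = (fun=> 0)); last by apply/funext => z; rewrite mulr0 addr0.
    by rewrite mul1r => /eqP; rewrite -subr_eq0 opprD addNKr oppr_eq0 => /eqP.
  have Tv : k.+1%:R <= `|T e v|.
    rewrite /v Tlin// T0 addr0 normrM ger0_norm ?divr_ge0 ?(ltW eta0)//.
    rewrite -ler_pdivrMl ?divr_gt0// invf_div mulrC; apply: ltW.
    by apply: le_lt_trans Tu; rewrite mulrA mulrAC.
  (* If the sum and the difference of [T e x] and [T e v] were both smaller than [k.+1] in absolute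
     value, so would be [T e v]. *)
  pose sg : R := if k.+1%:R <= `|T e v + T e x| then 1 else -1.
  pose x' z := sg * v z + x z.
  have rx' : rt s M h0 a b x' by apply: rt_lin.
  have Tx' : k.+1%:R <= `|T e x'|.
    rewrite /x' Tlin// /sg; case: (leP k.+1%:R `|T e v + T e x|) => [|H] /=; first by rewrite mul1r.
    rewrite leNgt; apply/negP => H'; move: Tv; rewrite leNgt => /negP; apply.
    rewrite mulN1r in H'; move: H H'; rewrite !ltr_norml; lra.
  pose h' := Num.min h (Num.min h1 (ec k)).
  have hh' : hset s h0 h' by apply: hset_min => //; apply: hset_min.
  have h'0 := hset_gt0 h00 hh'.
  (* All later humps together have bound [2 * eta'] at [h']; the second term of the minimum keeps
     [T e] of them at most 1. *)
  pose eta' := Num.min (eta / 2) ((2 * (C + 1))^-1).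
  have C1 : 0 < C + 1 by lra.
  have eta'0 : 0 < eta' by rewrite lt_min divr_gt0//= invr_gt0 mulr_gt0.
  exists (e, (h', eta', x')) => _; split => //.
  - by rewrite /h' !ge_min !lexx !orbT.
  - by rewrite mulrC -ler_pdivlMr// ge_min lexx.
  split => //.
    have -> : (fun z => -1 * x z + x' z) = (fun z => sg * v z + 0).
      by apply/funext => z; rewrite /x'; ring.
    have := bnd_lin sg (sm _ rv) (sm _ rt0) bv b0.
    rewrite addr0; have -> : `|sg| = 1 by rewrite /sg; case: ifP; rewrite ?normrN normr1.
    by rewrite mul1r.
  move=> w rw bw.
  have bw1 : bnd M h1 (2 * eta') setT w.
    apply: bnd_mono bw => //; last by rewrite mulr_ge0// ltW.
    by rewrite /h' !ge_min lexx orbT.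
  apply: le_trans (TC _ _ rw bw1) _.
  have : eta' * (2 * (C + 1)) <= 1.
    by rewrite -ler_pdivlMr ?mulr_gt0// div1r ge_min lexx orbT.
  have : 0 <= 2 * eta' by rewrite mulr_ge0// ltW.
  lra.
pose S0 := (ec 0%N, 1, (fun=> 0)) : R * R * (R -> R).
pose St := fix St k := if k is k'.+1 then (F (k', St k')).2 else S0.
have vS k : valid (St k).
  elim: k => [|k IH]; first by split => //=.
  have := HF (k, St k); rewrite /=; case: (St k) IH => -[h eta] x v.
  by rewrite /good; case: (F _) => e [[h' eta'] x'] /(_ v)[].
pose h k := (St k).1.1; pose eta k := (St k).1.2; pose x k := (St k).2.
pose e k := (F (k, St k)).1.
have step k : [/\ 0 < e k < k.+1%:R^-1, h k.+1 <= h k /\ h k.+1 <= ec k, 2 * eta k.+1 <= eta k &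
   [/\ bnd M (h k) (eta k) setT (fun z => -1 * x k z + x k.+1 z), k.+1%:R <= `|T (e k) (x k.+1)| &
      forall u, rt s M h0 a b u -> bnd M (h k.+1) (2 * eta k.+1) setT u -> `|T (e k) u| <= 1]].
  have := HF (k, St k); have := vS k; rewrite /h /eta /x /e /=.
  case: (St k) => -[hk etak] xk v.
  by rewrite /good; case: (F _) => e' [[h' eta'] x'] /(_ v)[].
have rx k : rt s M h0 a b (x k) by case: (vS k).
have [y [ry yx]] : exists y, rt s M h0 a b y /\
    forall k, bnd M (h k) (2 * eta k) setT (fun z => -1 * x k z + y z).
  apply: rt_complete => //.
  - by move=> k; case: (vS k).
  - by move=> k; case: (step k) => _ [].
  - move=> g /ecof[k kg]; exists k.+1; case: (step k) => _ [_ H] _ _.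
    exact: le_trans kg.
  - by move=> k; case: (vS k) => _ /ltW.
  - by move=> k; case: (step k).
  - by move=> k; case: (step k) => _ _ _ [].
have [C [d [d0 Cd]]] := Tbd y ry.
have [k [kC kd]] : exists k, C < k%:R /\ k.+1%:R^-1 < d.
  have dd := ltr_add_invr d0; case: dd => k1; rewrite add0r => k1d.
  have := archi_boundP (normr_ge0 C); set k2 := Num.bound _ => k2C.
  exists (k1 + k2)%N; split.
    apply: le_lt_trans (ler_norm _) _; apply: lt_le_trans k2C _.
    by rewrite ler_nat leq_addl.
  apply: le_lt_trans k1d; rewrite lef_pV2 ?posrE// ler_nat ltnS leq_addr//.
have [/andP[e0 ek] _ _ [_ Tk Tsm]] := step k.
have rd : rt s M h0 a b (fun z => -1 * x k.+1 z + y z) by apply: rt_lin.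
have := Tsm _ rd (yx k.+1); rewrite Tlin//.
have := Cd (e k); rewrite e0 (lt_trans ek kd) => /(_ isT) Ty.
move: Tk kC; rewrite -natr1 mulN1r => Tk kC H.
have : `|T (e k) (x k.+1)| <= `|T (e k) y| + 1.
  have -> : T (e k) (x k.+1) = T (e k) y - (- T (e k) (x k.+1) + T (e k) y) by ring.
  by apply: le_trans (ler_normB _ _) _; rewrite lerD2l.
lra.
Qed.

End UniformBoundedness.

(** * Non-quasianalytic cutoff functions *)

Section Cutoff.
Context {R : realType}.
Implicit Types (u v : R -> R).

(** The constant 2 is the slope of the piecewise linear function whose iterated means give the
    cutoff; taking means does not increase it. *)
Definition lipschitz2 u := forall x y : R, `|u x - u y| <= 2 * `|x - y|.

Lemma lipschitz2_continuous u : lipschitz2 u -> continuous u.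
Proof.
move=> lu x; apply/cvgrPdist_lt => e e0; near=> y.
apply: le_lt_trans (lu x y) _; rewrite -ltr_pdivlMl// mulrC.
by near: y; apply/nbhs_ballP; exists (e / 2); [rewrite /= divr_gt0|].
Unshelve. all: by end_near. Qed.

(** Integration starts at 0; as [u] vanishes before 1, this gives a primitive on the whole line,
    constant on the left. *)
Lemma primitive_exists u : continuous u -> (forall x, x < 1 -> u x = 0) ->
  exists U : R -> R, forall x : R, is_derive x (1 : R) U (u x).
Proof.
move=> cu u0; pose U x := (\int[lebesgue_measure]_(t in `[0, x]) u t)%R.
exists U => x; have [x0|x1] := ltP 0 x.
  have xx1 : x < x + 1 by rewrite ltrDl.
  have iu : lebesgue_measure.-integrable `[0, x + 1] (EFin \o u).
    apply: continuous_compact_integrable; first exact: segment_compact.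
    exact: continuous_subspaceT.
  have [dU Ux] := continuous_FTC1_closed xx1 iu x0 (cu x).
  by apply: DeriveDef; [exact: dU | rewrite -derive1E; exact: Ux].
rewrite u0; last by apply: le_lt_trans x1 _.
apply: is_derive_near0; near=> y.
have y1 : y < 1 by near: y; apply: lt_nbhsl; exact: le_lt_trans x1 _.
rewrite /U /Rintegral; under eq_integral.
  move=> t; rewrite inE/= in_itv/= => /andP[_ ty].
  rewrite u0; first over.
  exact: le_lt_trans y1.
by rewrite integral0.
Unshelve. all: by end_near. Qed.

(** The classical comparison showing that a convergent series still converges when its terms are
    divided by the square roots of its tails. Up to a positive factor, the two sides differ by a
    square. *)
Let tail_root_bound (r Rj Rj1 k : R) : 0 < k -> 0 <= Rj1 -> 0 < r -> Rj - Rj1 = r ->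
  k * r / Num.sqrt Rj <= 2 * k * Num.sqrt Rj - 2 * k * Num.sqrt Rj1.
Proof.
move=> k0 R1 r0 e; have Rj0 : 0 < Rj by lra.
have q0 : 0 < Num.sqrt Rj by rewrite sqrtr_gt0.
have q10 : 0 <= Num.sqrt Rj1 by exact: sqrtr_ge0.
have q1 : Num.sqrt Rj1 <= Num.sqrt Rj by rewrite ler_sqrt; lra.
have e1 : r = Num.sqrt Rj ^+ 2 - Num.sqrt Rj1 ^+ 2 by rewrite !sqr_sqrtr//; lra.
rewrite ler_pdivrMr// e1; move: (Num.sqrt Rj) (Num.sqrt Rj1) q0 q10 q1 => x y x0 y0 xy.
rewrite -subr_ge0; have -> : (2 * k * x - 2 * k * y) * x - k * (x ^+ 2 - y ^+ 2) =
  k * (x - y) ^+ 2 by ring.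
by rewrite mulr_ge0 ?sqr_ge0// ltW.
Qed.

(** Only the factors of index below [k] can exceed [h]; the constant is the product of their excess
    ratios. *)
Lemma prod_geometric_bound (c : nat -> R) (h : R) k : 0 < h -> (forall j, 0 <= c j) ->
  (forall j, (k <= j)%N -> c j <= h) -> exists2 N, 0 <= N & forall p, \prod_(j < p) c j <= N * h ^+ p.
Proof.
move=> h0 c0 ch; pose P p := \prod_(j < p) Num.max 1 (c j / h).
have P1 p : 1 <= P p.
  rewrite /P; elim: p => [|p IH]; first by rewrite big_ord0.
  by rewrite big_ord_recr/= mulr_ege1// le_max lexx.
have Pk p : P p <= P k.
  have [kp|pk] := leqP k p.
    rewrite -(subnKC kp); elim: (p - k)%N => [|n IH]; first by rewrite addn0.
    apply: le_trans _ IH; rewrite addnS {1}/P big_ord_recr/= -/(P _).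
    rewrite -[X in _ <= X]mulr1 ler_wpM2l ?(le_trans ler01)//.
    by rewrite ge_max lexx/= ler_pdivrMr// mul1r ch// leq_addr.
  rewrite -(subnKC (ltnW pk)); elim: (k - p)%N => [|n IH]; first by rewrite addn0.
  apply: le_trans IH _; rewrite addnS {2}/P big_ord_recr/= -/(P _).
  rewrite -[X in X <= _]mulr1; apply: ler_wpM2l; first exact: le_trans (P1 _).
  by rewrite le_max lexx.
exists (P k); first by rewrite (le_trans ler01).
move=> p; apply: (@le_trans _ _ (P p * h ^+ p)); last first.
  by rewrite ler_wpM2r ?exprn_ge0// ltW.
rewrite -[X in h ^+ X]card_ord -prodr_const -big_split/=; apply: ler_prod => j _.
by rewrite c0/= -ler_pdivrMr// le_max lexx orbT.
Qed.

(* With [r j = M j / M j.+1], which is summable by (M.3), the widths [a j] are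
   proportional to [r j / sqrt (\sum_(i >= j) r i)]: they are still summable, and
   [a j / r j] tends to infinity, which absorbs the factors [h ^+ p] for all [h]. *)
Lemma averaging_widths (M : nat -> R) : weight_sequence M ->
  exists a A : nat -> R, [/\ forall j, 0 < a j, forall j, 0 <= A j,
    forall j, a j <= A j - A j.+1, A 0%N <= 2^-1 &
    (forall e, 0 < e -> exists k, A k <= e) /\
    forall h, 0 < h -> exists2 N, 0 <= N &
      forall p, 2 ^+ p <= N * (h ^+ p * M p) * \prod_(j < p) a j].
Proof.
move=> [M0 _ _ [B B0 HB]].
pose r j := M j / M j.+1.
have r0 j : 0 < r j by rewrite divr_gt0.
pose S n := \sum_(0 <= i < n) r i.
(* (M.3) at [p = 1] bounds the sum of the [r j] with [j >= 1]; the term [r 0] is added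
   separately. *)
have Sbd n : S n <= r 0%N + B * 1 * M 1%N / M 2.
  apply: (@le_trans _ _ (S n.+1)); first by rewrite /S big_nat_recr//= lerDl ltW.
  rewrite /S big_nat_recl//= lerD2l.
  have := HB 1%N isT; rewrite -lee_fin; apply: le_trans.
  rewrite -sumEFin.
  have := @nneseries_lim_ge R (fun q => (M q.-1 / M q)%:E) xpredT 2 n.+2.
  rewrite !big_add1/= => H; apply: H.
  by move=> q _ _; rewrite lee_fin divr_ge0// ltW.
have S_S n : S n.+1 = S n + r n by rewrite /S big_nat_recr.
pose T := sup (range S).
have hS : has_sup (range S).
  by split; [exists (S 0%N); exists 0%N | exists (r 0%N + B * 1 * M 1%N / M 2) => _ [n _ <-]].
have ST n : S n <= T by apply: (ub_le_sup (proj2 hS)); exists n.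
pose Rt j := T - S j.
have Rt0 j : 0 < Rt j by have := ST j.+1; rewrite S_S /Rt; have := r0 j; lra.
have RtS j : Rt j - Rt j.+1 = r j by rewrite /Rt S_S; lra.
have Rtdec i j : (i <= j)%N -> Rt j <= Rt i.
  elim: j => [|j IH]; first by rewrite leqn0 => /eqP ->.
  rewrite leq_eqVlt => /orP[/eqP -> //|]; rewrite ltnS => /IH; apply: le_trans.
  by have := RtS j; have := r0 j; lra.
have Rtlim e : 0 < e -> exists k, Rt k <= e.
  move=> e0; have [_ [k _ <-] Hk] := sup_adherent e0 hS.
  by exists k; move: Hk; rewrite -/T /Rt; lra.
(* Normalization giving [A 0 = 1/2], so that averaging moves the support of the cutoff by at most
   1/2. *)
pose k := (4 * Num.sqrt (Rt 0%N))^-1.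
pose q j := Num.sqrt (Rt j).
have q0 j : 0 < q j by rewrite sqrtr_gt0.
have k0 : 0 < k by rewrite invr_gt0 mulr_gt0//; exact: q0.
have qlim e : 0 < e -> exists n, forall j, (n <= j)%N -> q j <= e.
  move=> e0; have [n Hn] := Rtlim (e ^+ 2) (exprn_gt0 2 e0); exists n => j nj.
  have := ltW e0; have := ltW (q0 j); have := ltW (Rt0 j) => R1 q1 e1.
  rewrite -(@ler_pXn2r _ 2)// ?nnegrE// sqr_sqrtr//.
  exact: le_trans (Rtdec _ _ nj) Hn.
exists (fun j => k * r j / q j), (fun j => 2 * k * q j); split.
- by move=> j; rewrite divr_gt0// mulr_gt0.
- by move=> j; rewrite !mulr_ge0// ltW.
- by move=> j; apply: tail_root_bound => //; exact: ltW.
- rewrite /k -/(q 0%N); have q00 : q 0%N != 0 by rewrite gt_eqF.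
  suff -> : 2 * (4 * q 0%N)^-1 * q 0%N = 2^-1 by [].
  by field.
split.
  move=> e e0; have [|n Hn] := qlim (e / (2 * k)); first by rewrite divr_gt0// mulr_gt0.
  by exists n; rewrite mulrC -ler_pdivlMr ?mulr_gt0//; exact: Hn.
move=> h h0.
have [|n Hn] := qlim (h * k / 2); first by rewrite divr_gt0// mulr_gt0.
(* [2 * q j / k] is [2 * r j / a j]. It tends to 0, so its products stay below every geometric
   growth, while the product of the [r j] is [M 0 / M p]. *)
have [|j|N N0 HN] := @prod_geometric_bound (fun j => 2 * q j / k) h n h0.
- by move=> j; rewrite divr_ge0 ?mulr_ge0// ltW.
- move=> nj; rewrite ler_pdivrMr//; have := Hn j nj; rewrite ler_pdivlMr// mulrC; lra.
exists (N / M 0%N); first by rewrite divr_ge0// ltW.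
move=> p.
have rprod : \prod_(j < p) r j = M 0%N / M p.
  elim: p => [|p IH]; first by rewrite big_ord0 divff// gt_eqF.
  by rewrite big_ord_recr/= IH /r mulrA divfK// gt_eqF.
have -> : \prod_(j < p) (k * r j / q j) = (\prod_(j < p) (2 * q j / k))^-1 * 2 ^+ p * (M 0%N / M p).
  rewrite -rprod -[X in 2 ^+ X]card_ord -prodr_const -prodfV -!big_split/=.
  apply: eq_bigr => j _; have := q0 j; have := k0 => /gt_eqF k1 /gt_eqF q1.
  by field; rewrite k1 q1.
set P := \prod_(j < p) _; have P0 : 0 < P by apply: prodr_gt0 => j _; rewrite divr_gt0// mulr_gt0.
have -> : N / M 0%N * (h ^+ p * M p) * (P^-1 * 2 ^+ p * (M 0%N / M p)) = 2 ^+ p * (N * h ^+ p / P).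
  by field; rewrite !gt_eqF.
by rewrite ler_pMr ?exprn_gt0// ler_pdivlMr// mul1r; exact: HN.
Qed.

(* The cutoff is the limit of the iterated means, over the widths [a 0], [a 1], etc,
   of a piecewise linear function. *)
Lemma cutoff_exists (M : nat -> R) : weight_sequence M ->
  exists theta : R -> R, [/\ smooth theta, forall x, x <= 1 -> theta x = 0,
    forall x, 2 <= x -> theta x = 1 & forall h, 0 < h -> exists N, bnd M h N setT theta].
Proof.
move=> wM; have [M0 _ _ _] := wM.
have [a [A [a0 A0 aA A012 [Alim HN]]]] := averaging_widths wM.
have Adec i j : (i <= j)%N -> A j <= A i.
  elim: j => [|j IH]; first by rewrite leqn0 => /eqP ->.
  rewrite leq_eqVlt => /orP[/eqP -> //|]; rewrite ltnS => /IH; apply: le_trans.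
  by have := aA j; have := a0 j; lra.
have Ahalf j : A j <= 2^-1 by apply: le_trans A012; exact: Adec.
(* [prim] picks an antiderivative, so that [avg a u] is the mean of [u] over
   [[x, x + a]]; all its properties follow from the mean value theorem. *)
have /boolp.choice[prim Hprim] : forall u, exists U : R -> R,
    continuous u -> (forall x, x < 1 -> u x = 0) -> forall x : R, is_derive x (1 : R) U (u x).
  move=> u; have [cu|nc] := pselect (continuous u); last by exists u.
  have [u0|nu] := pselect (forall x, x < 1 -> u x = 0); last by exists u.
  by have [U HU] := primitive_exists cu u0; exists U.
pose tame u := lipschitz2 u /\ forall x, x < 1 -> u x = 0.
have dprim u : tame u -> forall x : R, is_derive x (1 : R) (prim u) (u x).
  by move=> [lu u0]; apply: Hprim => //; exact: lipschitz2_continuous.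
pose avg t u x := (prim u (x + t) - prim u x) / t.
have shiftD (F f : R -> R) t : (forall x : R, is_derive x (1 : R) F (f x)) ->
    forall x : R, is_derive x (1 : R) (fun y => F (y + t)) (f (x + t)).
  move=> dF x; have := dF (x + t) => dFx.
  have dt : is_derive x (1 : R) (fun y => y + t) 1.
    have := is_deriveD (is_derive_id x (1 : R)) (is_derive_cst t x (1 : R)).
    by rewrite addr0.
  by have := @is_derive1_comp _ F (fun y => y + t) x _ _ dFx dt; rewrite mulr1.
have subD (F G f g : R -> R) (x : R) : is_derive x (1 : R) F (f x) -> is_derive x (1 : R) G (g x) ->
    is_derive x (1 : R) (fun y => F y - G y) (f x - g x).
  by move=> dF dG; exact: is_deriveB.
have avgE u t x : tame u -> 0 < t -> exists2 y, x <= y <= x + t & avg t u x = u y.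
  move=> tu t0; have xt : x <= x + t by rewrite lerDl ltW.
  have [y] := @MVT_segment _ (prim u) u x (x + t) xt (fun z _ => dprim u tu z)
     (continuous_subspaceT (fun z => @differentiable_continuous _ _ _ _ _
        (proj1 (@derivable1_diffP _ _ _ _) (@ex_derive _ _ _ _ _ _ _ (dprim u tu z))))).
  rewrite in_itv/= => xyt e; exists y => //.
  by rewrite /avg e addrAC subrr add0r mulfK// gt_eqF.
have avgB u v t C : tame u -> tame v -> 0 < t -> (forall x, `|u x - v x| <= C) ->
    forall x, `|avg t u x - avg t v x| <= C.
  move=> tu tv t0 uv x.
  have dd z : is_derive z (1 : R) (fun y => prim u y - prim v y) (u z - v z).
    by apply: subD; exact: dprim.
  have [z _] := MVT_sym x (x + t) dd.
  rewrite [x + t - x]addrAC subrr add0r => e.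
  rewrite /avg -mulrBl; have -> : prim u (x + t) - prim u x - (prim v (x + t) - prim v x) =
    (u z - v z) * t by rewrite -e; ring.
  by rewrite mulfK ?gt_eqF.
have avg_lip u t : tame u -> 0 < t -> lipschitz2 (avg t u).
  move=> tu t0 x y.
  have dd z : is_derive z (1 : R) (fun w => prim u (w + t) - prim u w) (u (z + t) - u z).
    by apply: (subD _ _ (fun z => u (z + t))); [exact: (shiftD _ _ t (dprim u tu)) | exact: dprim].
  have [z _ e] := MVT_sym y x dd.
  rewrite /avg -mulrBl e normrM normfV (ger0_norm (ltW t0)) ler_pdivrMr//.
  rewrite normrM mulrAC ler_wpM2r//.
  by apply: le_trans (proj1 tu _ _) _; rewrite addrAC subrr add0r ger0_norm// ltW.
(* A ramp from 0 at 3/2 to 1 at 2. Means over intervals to the right of a point keep the value 1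
   beyond 2 and enlarge the support on the left by at most [A 0 <= 1/2]. *)
pose u0 x := Num.max 0 (Num.min 1 (2 * x - 3)) : R.
(* [W k n] averages over the widths [a n] to [a (n + k - 1)], with [a n] outermost, so that in the
   limit [v n] is the mean of [v n.+1] over the width [a n]. *)
pose W := fix W k n := if k is k'.+1 then avg (a n) (W k' n.+1) else u0.
have HW k n : [/\ lipschitz2 (W k n), forall x, 0 <= W k n x <= 1,
   forall x, x <= 3/2 - A n -> W k n x = 0 & forall x, 2 <= x -> W k n x = 1].
  elim: k n => [|k IH] n /=.
    split.
    - move=> x y; rewrite /u0 /Num.max /Num.min.
      have : x - y <= `|x - y| by exact: ler_norm.
      have : - (x - y) <= `|x - y| by rewrite -normrN ler_norm.
      move: `|x - y| => d H1 H2.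
      by rewrite ler_norml; do ! case: ifP => //; rewrite ?real_ltNge ?num_real// => *; lra.
    - move=> x; rewrite /u0 le_max lexx/= ge_max ler01/= ge_min lexx//.
    - move=> x xA; rewrite /u0; apply/max_idPl; rewrite ge_min; apply/orP; right.
      by have := A0 n; lra.
    - move=> x x2; rewrite /u0; have /min_idPl -> : 1 <= 2 * x - 3 by lra.
      by apply/max_idPr.
  have [lW W01 W0 W1] := IH n.+1.
  have tW : tame (W k n.+1).
    by split=> // x x1; apply: W0; have := Ahalf n.+1; lra.
  split; first exact: avg_lip.
  - by move=> x; have [y _ ->] := avgE _ _ x tW (a0 n); exact: W01.
  - move=> x xA; have [y /andP[xy yx] ->] := avgE _ _ x tW (a0 n); apply: W0.
    by have := aA n; lra.
  - move=> x x2; have [y /andP[xy yx] ->] := avgE _ _ x tW (a0 n); apply: W1; lra.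
have tW k n : tame (W k n).
  by have [lW _ W0 _] := HW k n; split=> // x x1; apply: W0; have := Ahalf n; lra.
have avg_near u t x : tame u -> 0 < t -> `|avg t u x - u x| <= 2 * t.
  move=> tu t0; have [y /andP[xy yx] ->] := avgE _ _ x tu t0.
  apply: le_trans (proj1 tu _ _) _; rewrite ler_pM2l// ger0_norm; lra.
have stepW k n x : `|W k.+1 n x - W k n x| <= 2 * A (n + k)%N - 2 * A (n + k.+1)%N.
  elim: k n x => [|k IH] n x.
    apply: le_trans (avg_near _ _ _ (tW 0%N n.+1) (a0 n)) _.
    by rewrite addn0 addn1; have := aA n; lra.
  have := avgB _ _ _ _ (tW k.+1 n.+1) (tW k n.+1) (a0 n) (IH n.+1) x.
  by rewrite addSnnS addSnnS.
have limW n x : exists l, forall k, `|l - W k n x| <= 2 * A (n + k)%N.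
  apply: (@telescope_limit _ (fun k => W k n x) (fun k => 2 * A (n + k)%N)) => k.
    exact: stepW.
  by rewrite mulr_ge0.
have /boolp.choice[V HV] : forall nx : nat * R, exists l, forall k,
    `|l - W k nx.1 nx.2| <= 2 * A (nx.1 + k)%N by move=> [n x]; exact: limW.
pose v n x := V (n, x).
have vW n x k : `|v n x - W k n x| <= 2 * A (n + k)%N by exact: (HV (n, x)).
have small (X C : R) n : 0 <= C -> (forall k, X <= C * A (n + k)%N) -> X <= 0.
  move=> C0 H; apply/ler_addgt0Pr => e e0; rewrite add0r.
  have C1 : 0 < C + 1 by lra.
  have [k Hk] := Alim (e / (C + 1)) (divr_gt0 e0 C1).
  apply: le_trans (H k) _; move: Hk; rewrite ler_pdivlMr// => Hk.
  have : A (n + k)%N <= A k by apply: Adec; rewrite leq_addl.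
  have := A0 k; have := A0 (n + k)%N; nra.
have v0 n x : x <= 1 -> v n x = 0.
  move=> x1; apply/eqP; rewrite -normr_le0; apply: (small _ 2 n) => // k.
  have := vW n x k; have [_ _ W0 _] := HW k n; rewrite W0 ?subr0//.
  by have := Ahalf n; lra.
have v1 n x : 2 <= x -> v n x = 1.
  move=> x2; apply/eqP; rewrite -subr_eq0 -normr_le0; apply: (small _ 2 n) => // k.
  by have := vW n x k; have [_ _ _ ->] := HW k n.
have vlip n : lipschitz2 (v n).
  move=> x y; rewrite -subr_le0; apply: (small _ 4 n) => // k.
  have [lW _ _ _] := HW k n; have := lW x y; have := vW n x k; have := vW n y k.
  move: (A (n + k)%N) (W k n x) (W k n y) (v n x) (v n y) `|x - y| => AA wx wy vx vy d.
  rewrite !ler_norml => /andP[? ?] /andP[? ?] /andP[? ?].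
  by rewrite lerBlDr ler_norml; apply/andP; split; lra.
have v01 n x : `|v n x| <= 1.
  rewrite -subr_le0; apply: (small _ 2 n) => // k.
  have [_ W01 _ _] := HW k n; have := W01 x; have := vW n x k.
  move: (A (n + k)%N) (W k n x) (v n x) => AA wx vx.
  rewrite ler_norml => /andP[? ?] /andP[? ?].
  by rewrite lerBlDr ler_norml; apply/andP; split; lra.
have tv n : tame (v n) by split=> // x x1; apply: v0; exact: ltW.
have vavg n : v n = avg (a n) (v n.+1).
  apply/funext => x; apply/eqP; rewrite -subr_eq0 -normr_le0; apply: (small _ 4 n.+1) => // k.
  have H1 := vW n x k.+1.
  have H2 : forall y, `|v n.+1 y - W k n.+1 y| <= 2 * A (n.+1 + k)%N by move=> y; exact: vW.
  have := avgB _ _ _ _ (tv n.+1) (tW k n.+1) (a0 n) H2 x.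
  rewrite -addSnnS /= in H1; move: H1.
  move: (A (n.+1 + k)%N) (v n x) (avg (a n) (v n.+1) x) (avg (a n) (W k n.+1) x) => AA vx wx y.
  rewrite !ler_norml => /andP[? ?] /andP[? ?].
  by apply/andP; split; lra.
(* The derivative of a mean is a difference quotient. Hence the derivative of order [p] of [v n] is
   a [p]-fold difference quotient of [v (n + p)], of size at most [2 ^+ p] over the product of the
   widths. *)
pose D := fix D p n x : R := if p is p'.+1 then (D p' n.+1 (x + a n) - D p' n.+1 x) / a n else v n x.
have divD (F f : R -> R) t (x : R) : is_derive x (1 : R) F (f x) ->
    is_derive x (1 : R) (fun y => F y / t) (f x / t).
  move=> dF; have := is_deriveZ (t^-1) dF.
  rewrite /GRing.scale/= mulrC; congr (is_derive _ _ _ _).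
  by apply/funext => y; rewrite mulrC.
have dD p n : forall x : R, is_derive x (1 : R) (D p n) (D p.+1 n x).
  elim: p n => [|p IH] n x /=.
    rewrite vavg.
    apply: (divD _ (fun x => v n.+1 (x + a n) - v n.+1 x)).
    apply: (subD _ _ (fun x => v n.+1 (x + a n))); last exact: dprim.
    exact: (shiftD _ _ _ (dprim _ (tv n.+1))).
  apply: (divD _ (fun x => D p.+1 n.+1 (x + a n) - D p.+1 n.+1 x)).
have bD p n x : `|D p n x| * \prod_(j < p) a (n + j)%N <= 2 ^+ p.
  elim: p n x => [|p IH] n x /=; first by rewrite big_ord0 mulr1 expr0.
  rewrite big_ord_recl/= addn0 normrM normfV (ger0_norm (ltW (a0 n))).
  rewrite mulrA divfK ?gt_eqF// exprS.
  under eq_bigr => j _ do rewrite /bump/= add1n -addSnnS.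
  have P0 : 0 <= \prod_(j < p) a (n.+1 + j)%N by apply: prodr_ge0 => j _; exact: ltW.
  apply: le_trans (ler_wpM2r P0 (ler_normB _ _)) _.
  by have := IH n.+1 x; have := IH n.+1 (x + a n); rewrite mulrDl; lra.
have jD : jet (fun p => D p 0%N) by move=> p x; exact: dD.
exists (v 0%N); split.
- exact: (jet_smooth jD).
- exact: v0.
- exact: v1.
move=> h h0; have [N N0 HNp] := HN h h0; exists N => p x _.
rewrite (@jet_derive1n _ (fun p => D p 0%N))//.
have P0 : 0 < \prod_(j < p) a j by apply: prodr_gt0 => j _.
by rewrite -(ler_pM2r P0); apply: le_trans (bD p 0%N x) (HNp p).
Qed.

End Cutoff.

(** * Local boundedness of slowly varying functions *)

Section SlowVariationBound.
Context {R : realType}.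
Local Notation outer := ((wlength (idfun : R -> R))^*)%mu.
Local Notation lmeasurable A := (measurable (A : set (caratheodory_type outer))).
Local Notation nu := (@completed_lebesgue_measure R).
Implicit Types (A : set R) (u t : R) (L : R -> R).

Definition dilated u A := [set x | A (u * x)].

Lemma dilatedK u A : u != 0 -> dilated u^-1 (dilated u A) = A.
Proof. by move=> u0; apply/seteqP; split => x /=; rewrite /dilated/= mulVKf. Qed.

Lemma wlength_dilated u A : 0 < u -> ocitv A ->
  ocitv (dilated u A) /\ (wlength idfun (dilated u A) = u^-1%:E * wlength idfun A)%E.
Proof.
move=> u0 [[a b] _ <-].
have -> : dilated u `]a, b]%classic = `](a / u), (b / u)]%classic.
  apply/seteqP; split => x; rewrite /dilated/= !in_itv/=.
    by rewrite ltr_pdivrMr// ler_pdivlMr// !(mulrC u).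
  by rewrite ltr_pdivrMr// ler_pdivlMr// !(mulrC u).
split; first exact: is_ocitv.
rewrite !wlength_itv/= !lte_fin ltr_pM2r ?invr_gt0//; case: ifP => _; last by rewrite mule0.
by rewrite -EFinB -EFinM; congr EFin; ring.
Qed.

(** Dilating a cover by intervals divides its total length by [u]. The outer measure is used because
    preimages under [L] are measurable only for the completed sigma-algebra. *)
Lemma outer_dilated_le u A : 0 < u -> (outer (dilated u A) <= u^-1%:E * outer A)%E.
Proof.
move=> u0; have ui : 0 < u^-1 by rewrite invr_gt0.
rewrite muleC -lee_pdivrMr// {2}/mu_ext; apply: le_ereal_inf_tmp => _ [F [mF AF] <-].
rewrite lee_pdivrMr// muleC -nneseriesZl; last by move=> *; exact: wlength_ge0.
have Fd k := wlength_dilated u0 (mF k).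
under eq_eseriesr => k _ do rewrite -(proj2 (Fd k)).
apply: ereal_inf_lbound; exists (fun k => dilated u (F k)) => //; split.
  by move=> k; exact: (proj1 (Fd k)).
by move=> x /AF[k _ Fkx]; exists k.
Qed.

Lemma outer_dilated u A : 0 < u -> outer (dilated u A) = (u^-1%:E * outer A)%E.
Proof.
move=> u0; apply/eqP; rewrite eq_le outer_dilated_le//=.
have ui : 0 < u^-1 by rewrite invr_gt0.
have := outer_dilated_le (dilated u A) ui; rewrite dilatedK ?gt_eqF// invrK => H.
by rewrite muleC lee_pdivrMr// muleC.
Qed.

(** The Caratheodory criterion for [dilated u A] tested on [X] is the criterion for [A] tested on
    [dilated u^-1 X]. *)
Lemma lmeasurable_dilated u A : 0 < u -> lmeasurable A -> lmeasurable (dilated u A).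
Proof.
move=> u0 mA; have cA : caratheodory_measurable outer A := mA.
suff : caratheodory_measurable outer (dilated u A) by [].
move=> X; have ui : 0 < u^-1 by rewrite invr_gt0.
have := cA (dilated u^-1 X).
have -> : dilated u^-1 X `&` A = dilated u^-1 (X `&` dilated u A).
  by apply/seteqP; split => x /=; rewrite /dilated/= mulVKf ?gt_eqF.
have -> : dilated u^-1 X `&` ~` A = dilated u^-1 (X `&` ~` dilated u A).
  by apply/seteqP; split => x /=; rewrite /dilated/= mulVKf ?gt_eqF.
rewrite !outer_dilated// -muleDr//.
  move=> /(congr1 (mule u^-1%:E)); rewrite !muleA -EFinM invrK mulVf ?gt_eqF//.
  by rewrite !mul1e.
by apply: ge0_adde_def; rewrite inE; exact: mu_ext_ge0.
Qed.

Lemma nu_itv (a b : R) : a <= b -> nu `[a, b]%classic = (b - a)%:E.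
Proof.
move=> ab; have := @lebesgue_measure_itv R `[a, b]; rewrite /= lte_fin.
rewrite lt_neqAle ab andbT; have [->|ab'] := eqVneq a b.
  by move=> H; rewrite subrr; exact: H.
by move=> /= H; rewrite EFinB; exact: H.
Qed.

Lemma lmeasurable_itv (a b : R) : lmeasurable `[a, b]%classic.
Proof. by apply: sub_caratheodory; exact: measurable_itv. Qed.

Definition close_set L (x : nat -> R) n : set R :=
  [set t | 1 <= t <= 4 /\ forall m, (n <= m)%N -> L (x m) / 2 < L (x m * t) < 2 * L (x m)].

(* The measure of [1, 4] is 3, and its subset [close_set L x n] increases to it. *)
Lemma close_set_large L (x : nat -> R) : slowly_varying_at_infinity L ->
  (forall n, 0 < x n) -> (forall n, 0 < L (x n)) -> x n @[n --> \oo] --> +oo ->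
  (forall n, lmeasurable (close_set L x n)) /\
  exists n0, forall n, (n0 <= n)%N -> ((11 / 4)%:E < nu (close_set L x n))%E.
Proof.
move=> [mL Lpos Llim] x0 Lx0 xoo.
have mV n : lmeasurable (close_set L x n).
  have -> : close_set L x n = `[1, 4]%classic `&`
     \bigcap_(m in [set m | (n <= m)%N]) dilated (x m)
        (`]0, +oo[%classic `&` L @^-1` `](L (x m) / 2), (2 * L (x m))[%classic).
    apply/seteqP; split => [t [t14 H]|t [t14 H]].
      split => [|m /= nm]; first by rewrite /= in_itv.
      rewrite /dilated/= !in_itv/= andbT; split; last exact: H.
      by rewrite mulr_gt0// (lt_le_trans ltr01)//; case/andP: t14.
    split => [|m nm]; first by move: t14; rewrite /= in_itv.
    by have := H m nm; rewrite /dilated/= !in_itv/= => -[].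
  apply: measurableI; first exact: lmeasurable_itv.
  apply: bigcap_measurable; first by exists n => /=.
  move=> m _; apply: lmeasurable_dilated => //; apply: mL.
    by apply: sub_caratheodory; exact: measurable_itv.
  exact: measurable_itv.
split=> //.
have nd : nondecreasing_seq (close_set L x).
  move=> n m nm; apply/subsetPset => t [t14 H]; split => // k mk.
  by apply: H; exact: leq_trans mk.
have un : \bigcup_n close_set L x n = `[1, 4]%classic.
  apply/seteqP; split => [t [n _ [t14 _]]|t]; first by rewrite /= in_itv.
  rewrite /= in_itv/= => t14; have t0 : 0 < t by case/andP: t14 => t1 _; exact: lt_le_trans t1.
  have := cvg_comp _ _ xoo (Llim t t0) => /cvgrPdist_lt /(_ 2^-1).
  rewrite invr_gt0 ltr0n => /(_ isT)[n _ Hn]; exists n => //; split => // m nm.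
  have := Hn m nm; rewrite /= ltr_norml (mulrC t) => /andP[H1 H2].
  have := Lx0 m => l0.
  have lb : 2^-1 < L (x m * t) / L (x m) by lra.
  have ub : L (x m * t) / L (x m) < 2 by lra.
  by move: lb ub; rewrite ltr_pdivlMr// ltr_pdivrMr// mulrC => -> ->.
have := @nondecreasing_cvg_mu _ _ _ nu (close_set L x) mV.
rewrite un => /(_ (lmeasurable_itv 1 4) nd).
have e3 : nu `[1, 4]%classic = 3%:E by rewrite nu_itv; [congr EFin; lra | lra].
move=> cv0; have cv : (nu \o close_set L x) @ \oo --> 3%:E by rewrite -e3; exact: cv0.
have /cv[n0 _ Hn0] : nbhs 3%:E [set y : \bar R | ((11 / 4)%:E < y)%E].
  by apply: open_nbhs_nbhs; split; [exact: open_ereal_gt_ereal | rewrite /= lte_fin; lra].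
by exists n0 => n nn; exact: Hn0.
Qed.

(* Otherwise the bound fails at pairs [x n], [x n * t n]; for large [n] the sets of
   [z] with [L (x n * z)] close to [L (x n)], resp. to [L (x n * t n)], are too large
   to be disjoint. *)
Lemma slowly_varying_bounded L : slowly_varying_at_infinity L ->
  exists2 X, 0 < X & forall x t, X <= x -> 1 <= t <= 2 ->
    [/\ 0 < L x, L x <= 4 * L (x * t) & L (x * t) <= 4 * L x].
Proof.
move=> sL; have [_ [X0 [_ HX0]] _] := sL.
apply: contrapT => H.
pose B n := Num.max 1 (X0 + 1) + n%:R.
have Bpos n x : B n <= x -> [/\ 0 < x, n%:R <= x & 0 < L x].
  move=> Bx; have H1 : 1 <= Num.max 1 (X0 + 1) by rewrite le_max lexx.
  have H2 : X0 + 1 <= Num.max 1 (X0 + 1) by rewrite le_max lexx orbT.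
  have n0 : 0 <= n%:R :> R by [].
  by rewrite /B in Bx; split; [lra | lra | apply: HX0; lra].
have /boolp.choice[xt Hxt] : forall n, exists xt : R * R, [/\ B n <= xt.1, 1 <= xt.2 <= 2 &
    ~ (L xt.1 <= 4 * L (xt.1 * xt.2) /\ L (xt.1 * xt.2) <= 4 * L xt.1)].
  move=> n; apply: contrapT => Hn; apply: H; exists (B n).
    by rewrite /B ltr_pwDl// lt_max ltr01.
  move=> x t Bx t12; have [_ _ Lx] := Bpos n x Bx; split => //.
    by apply: contrapT => Q; apply: Hn; exists (x, t); split => //= -[].
  by apply: contrapT => Q; apply: Hn; exists (x, t); split => //= -[].
pose x n := (xt n).1; pose t n := (xt n).2; pose y n := x n * t n.
have t12 n : 1 <= t n <= 2 by case: (Hxt n).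
have Bx n : B n <= x n by case: (Hxt n).
have By n : B n <= y n.
  apply: le_trans (Bx n) _; have [x0 _ _] := Bpos _ _ (Bx n).
  by rewrite ler_pMr//; case/andP: (t12 n).
have large z : (forall n, B n <= z n) -> (forall n, lmeasurable (close_set L z n)) /\
    exists n0, forall n, (n0 <= n)%N -> ((11 / 4)%:E < nu (close_set L z n))%E.
  move=> Bz; apply: close_set_large => //.
  - by move=> n; case: (Bpos _ _ (Bz n)).
  - by move=> n; case: (Bpos _ _ (Bz n)).
  - apply: (@ger_cvgy _ _ _ _ (fun n => n%:R)); last exact: cvgr_idn.
    by near=> n; case: (Bpos _ _ (Bz n)).
have [mx [nx Hx]] := large x Bx; have [my [ny Hy]] := large y By.
pose n := maxn nx ny.
have {Hx} := Hx n (leq_maxl _ _); have {Hy} := Hy n (leq_maxr _ _).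
set VX := close_set L x n; set VY := close_set L y n => HY HX.
have /andP[t1 t2] := t12 n; have t0 : 0 < t n by apply: lt_le_trans t1.
have ti : 0 < (t n)^-1 by rewrite invr_gt0.
pose VY' := dilated (t n)^-1 VY.
have mY' : lmeasurable VY' by apply: lmeasurable_dilated => //; exact: my.
have [z [zX zY]] : exists z, VX z /\ VY' z.
  apply: contrapT => dis.
  have D : VX `&` VY' = set0.
    by apply/seteqP; split => // z [zX zY]; case: dis; exists z.
  have U : VX `|` VY' `<=` `[1, 4 * t n]%classic.
    move=> z [[/andP[z1 z4] _]|[/andP[z1 z4] _]]; rewrite /= in_itv/=.
      by rewrite z1/= (le_trans z4)// ler_pMr.
    rewrite ler_pdivlMl// mulr1 in z1; rewrite ler_pdivrMl// in z4.
    by rewrite (le_trans t1 z1)/= mulrC.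
  have : (nu (VX `|` VY') <= nu `[1%R, (4 * t n)%R]%classic)%E.
    apply: le_measure => //; rewrite inE.
      by apply: measurableU => //; exact: mx.
    exact: lmeasurable_itv.
  have e1 : (nu (VX `|` VY') = nu VX + nu VY')%E by apply: measureU => //; exact: mx.
  have e2 : nu VY' = ((t n)%:E * nu VY)%E.
    by have := @outer_dilated (t n)^-1 VY ti; rewrite invrK.
  have e3 : nu `[1%R, (4 * t n)%R]%classic = (4 * t n - 1)%:E by apply: nu_itv; lra.
  move=> le0; have := le0; rewrite e1 e2 e3.
  apply/negP; rewrite -ltNge.
  (* Since [11 / 4 * (1 + t) > 4 * t - 1] for [t < 3], two disjoint sets of these sizes do not fit
     into [[1, 4 * t]]. *)
  apply: (@lt_le_trans _ _ ((11 / 4)%:E + (t n)%:E * (11 / 4)%:E)%E).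
    by rewrite -EFinM -EFinD lte_fin; lra.
  by apply: leeD; [exact: ltW | rewrite lee_pmul2l//; exact: ltW].
(* At the common point, [L (x n * z)] is within a factor 2 of both [L (x n)] and [L (y n)], which
   are therefore within a factor 4 of each other. *)
have [_ _ Hn] := Hxt n; apply: Hn.
case: zX => _ /(_ n (leqnn n))/andP[X1 X2].
case: zY => _ /(_ n (leqnn n)); rewrite /y mulrA mulfK ?gt_eqF// => /andP[Y1 Y2].
have [_ _ L1] := Bpos _ _ (Bx n); have [_ _ L2] := Bpos _ _ (By n).
move: X1 X2 Y1 Y2 L1 L2; rewrite -/(x n) -/(t n) /y.
by split; lra.
Unshelve. all: by end_near. Qed.

End SlowVariationBound.

(** * Taylor remainders *)

Section TaylorRemainder.
Context {R : realType} (s : ultraclass) (M : nat -> R).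
Context (M_gt0 : forall p, 0 < M p).
Context (M_logconvex : forall p, (1 <= p)%N -> M p ^+ 2 <= M p.-1 * M p.+1).
Implicit Types (u v chi : R -> R) (a b h t : R) (m : nat).

Lemma abs_le_max a b (x : R) : a <= x -> x <= b -> `|x| <= Num.max `|a| `|b|.
Proof.
move=> ax xb; rewrite le_max; have [x0|x0] := leP 0 x.
  by rewrite (ger0_norm x0) (le_trans xb (ler_norm _)) orbT.
rewrite (ler0_norm (ltW x0)); apply/orP; left.
by rewrite -[`|a|]normrN (le_trans _ (ler_norm _))// lerN2.
Qed.

Definition taylor m u (x : R) := \sum_(i < m) derive1n i u 0 / i`!%:R * x ^+ i.
Definition trem m u x := u x - taylor m u x.

(** For [i < p] the falling factorial vanishes, so the truncated exponent [i - p] does no harm. *)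
Definition trem_jet m u p x :=
  derive1n p u x - \sum_(i < m) derive1n i u 0 / i`!%:R * ((i ^_ p)%:R * x ^+ (i - p)).

Lemma jet_sum m (c : nat -> R) (U : nat -> nat -> R -> R) :
  (forall i, jet (U i)) -> jet (fun p x => \sum_(i < m) c i * U i p x).
Proof.
move=> jU; elim: m => [|m IH].
  have j0 : jet (fun p (x : R) => 0 : R) by move=> p x; exact: is_derive_cst.
  by move=> p x; under eq_fun do rewrite big_ord0; rewrite big_ord0; exact: j0.
have := jet_lin (c m) (jU m) IH => j p x; have := j p x.
rewrite big_ord_recr/= addrC; congr (is_derive _ _ _ _).
by apply/funext => y; rewrite big_ord_recr/= addrC.
Qed.

Lemma jet_trem m u : smooth u -> jet (trem_jet m u).
Proof.
move=> su p x.
have js := jet_sum m (fun i => derive1n i u 0 / i`!%:R) jet_monomial.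
have := jet_lin (-1) js (smooth_jet su) p x.
rewrite mulN1r addrC; congr (is_derive _ _ _ _).
by apply/funext => y; rewrite mulN1r addrC.
Qed.

Lemma trem_jet0 m u : trem_jet m u 0%N = trem m u.
Proof.
apply/funext => x; rewrite /trem_jet /trem /taylor; congr (_ - _).
by apply: eq_bigr => i _; rewrite ffactn0 mul1r subn0.
Qed.

Lemma smooth_trem m u : smooth u -> smooth (trem m u).
Proof. by move=> /(jet_trem m)/jet_smooth; rewrite trem_jet0. Qed.

Lemma derive1n_trem m u p : smooth u -> derive1n p (trem m u) = trem_jet m u p.
Proof. by move=> /(jet_trem m)/jet_derive1n <-; rewrite trem_jet0. Qed.

Lemma trem_jet_high m u p x : (m <= p)%N -> trem_jet m u p x = derive1n p u x.
Proof.
move=> mp; rewrite /trem_jet big1 ?subr0// => i _.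
by rewrite ffact_small ?mul0r ?mulr0// (leq_trans (ltn_ord i)).
Qed.

Lemma trem_jet_at0 m u p : (p < m)%N -> trem_jet m u p 0 = 0.
Proof.
move=> pm; rewrite /trem_jet (bigD1 (Ordinal pm))//= subnn expr0 mulr1 ffactnn.
rewrite divfK ?pnatr_eq0 -?lt0n ?fact_gt0// big1 ?addr0 ?subrr// => i ip.
have [ilt|igt] := ltnP i p; first by rewrite ffact_small// mul0r mulr0.
have : (0 < i - p)%N by rewrite subn_gt0 ltn_neqAle igt andbT eq_sym.
by move=> k0; rewrite expr0n gtn_eqF//= !mulr0.
Qed.

(** Descent from order [m]: below it the derivatives of the remainder vanish at 0, and each mean
    value step from 0 brings one factor [|x|]. *)
Lemma trem_jet_bound m u B : smooth u -> (forall x, `|derive1n m u x| <= B) ->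
  forall k x, (k <= m)%N -> `|trem_jet m u (m - k) x| <= `|x| ^+ k * B.
Proof.
move=> su bu; have B0 : 0 <= B by apply: le_trans (bu 0).
elim=> [|k IH] x km.
  by rewrite subn0 expr0 mul1r trem_jet_high.
have [z] := MVT_sym 0 x (jet_trem m su (m - k.+1)%N).
rewrite !subr0 => zx; rewrite trem_jet_at0 ?subr0; last by rewrite ltn_subrL (leq_trans _ km).
move=> ->; rewrite subnSK//.
rewrite normrM exprSr -mulrA (mulrC _ B) mulrA ler_pM//.
apply: le_trans (IH z (ltnW km)) _; rewrite ler_wpM2r//.
by rewrite lerXn2r// nnegrE.
Qed.

(** Bounds for every [h], whatever the class: multiplication by such a function raises the class
    parameter by an arbitrarily small amount. *)
Definition cut a b chi := [/\ smooth chi, forall x, ~~ (a <= x <= b) -> chi x = 0 &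
  forall h, 0 < h -> exists N, bnd M h N setT chi].

Lemma cut_rt h0 a b chi : 0 < h0 -> cut a b chi -> rt s M h0 a b chi.
Proof. by move=> h00 [sc c0 bc]; split => // h /(hset_gt0 h00); exact: bc. Qed.

Lemma cut_mono a b a' b' chi : a' <= a -> b <= b' -> cut a b chi -> cut a' b' chi.
Proof.
move=> aa bb [sc c0 bc]; split => // x xab; apply: c0.
by apply: contra xab => /andP[ax xb]; rewrite (le_trans aa ax) (le_trans xb bb).
Qed.

(** The gain [t ^+ m] is what makes the dyadic series converge. A derivative of order [p >= m]
    carries [t ^+ p <= t ^+ m]; for the finitely many [p < m] the remainder estimate at [t * x]
    supplies the missing [t ^+ (m - p)], at the cost of the constants [k p]. *)
Lemma trem_scaled_bound m h B : 0 < h -> 0 <= B -> exists2 K, 0 < K & forall u N t,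
  smooth u -> bnd M h N setT u -> 0 < t <= 1 ->
  bnd M h (K * N * t ^+ m) [set x | `|x| <= B] (fun x => trem m u (t * x)).
Proof.
move=> h0 B0; have hp p : 0 < h ^+ p * M p by rewrite mulr_gt0// exprn_gt0.
pose k p := B ^+ (m - p) * (h ^+ m * M m) / (h ^+ p * M p).
have k0 p : 0 <= k p by rewrite divr_ge0 ?mulr_ge0 ?exprn_ge0 ?(ltW h0) ?(ltW (M_gt0 _)).
pose K := 1 + \sum_(p < m) k p.
have sk : 0 <= \sum_(p < m) k p by apply: sumr_ge0.
exists K; first by rewrite /K; lra.
move=> u N t su bu /andP[t0 t1] p x xB.
have N0 := bnd_ge0 M_gt0 (I : setT (0 : R)) bu.
have kK : (p < m)%N -> k p <= K.
  move=> pm; have := sk; rewrite /K (bigD1 (Ordinal pm))//=.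
  have : 0 <= \sum_(i < m | i != Ordinal pm) k i by apply: sumr_ge0.
  by move: (\sum_(i < m | i != Ordinal pm) k i) => S; lra.
have K1 : 1 <= K by rewrite /K; lra.
rewrite derive1n_scale; last exact: smooth_trem.
rewrite derive1n_trem// normrM normrX (ger0_norm (ltW t0)).
have [mp|pm] := leqP m p.
  rewrite trem_jet_high//.
  apply: (@le_trans _ _ (t ^+ m * (N * (h ^+ p * M p)))).
    apply: ler_pM => //; [by rewrite exprn_ge0// ltW | | exact: bu].
    by rewrite -(subnK mp) exprD ler_piMl ?exprn_ge0 ?(ltW t0)// exprn_ile1// ltW.
  have -> : K * N * t ^+ m * (h ^+ p * M p) = K * (t ^+ m * (N * (h ^+ p * M p))) by ring.
  by rewrite ler_peMl// !mulr_ge0 ?exprn_ge0 ?(ltW t0) ?(ltW h0) ?(ltW (M_gt0 _)).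
have bm x' : `|derive1n m u x'| <= N * (h ^+ m * M m) by exact: bu.
have := trem_jet_bound su bm (t * x) (leq_subr p m); rewrite subKn ?(ltnW pm)// => Hb.
apply: (@le_trans _ _ (t ^+ p * ((t * B) ^+ (m - p) * (N * (h ^+ m * M m))))).
  apply: ler_wpM2l; first by rewrite exprn_ge0// ltW.
  apply: le_trans Hb _; apply: ler_wpM2r; first by rewrite mulr_ge0 ?(ltW (hp m)).
  rewrite lerXn2r// ?nnegrE// ?mulr_ge0 ?(ltW t0)//.
  by rewrite normrM (ger0_norm (ltW t0)) ler_pM2l.
have -> : t ^+ p * ((t * B) ^+ (m - p) * (N * (h ^+ m * M m))) =
    k p * N * t ^+ m * (h ^+ p * M p).
  have -> : t ^+ m = t ^+ p * t ^+ (m - p) by rewrite -exprD subnKC// ltnW.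
  by rewrite /k exprMn; field; rewrite !gt_eqF// exprn_gt0.
apply: ler_wpM2r; first exact: ltW.
apply: ler_wpM2r; first by rewrite exprn_ge0// ltW.
by apply: ler_wpM2r => //; exact: kK.
Qed.

Lemma cut_trem_bnd m a b chi h1 h : a <= b -> 0 < h1 -> 0 < h -> cut a b chi ->
  exists2 K, 0 <= K & forall u N t, smooth u -> bnd M h N setT u -> 0 < t <= 1 ->
  bnd M (h1 + h) (K * N * t ^+ m) setT (fun x => chi x * trem m u (t * x)).
Proof.
move=> ab h10 h0 [sc c0 bc]; have [N1 bN1] := bc _ h10.
pose B := Num.max `|a| `|b|.
have B0 : 0 <= B by rewrite le_max normr_ge0.
have [K K0 HK] := trem_scaled_bound m h0 B0.
have N10 := bnd_ge0 M_gt0 (I : setT (0 : R)) bN1.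
exists (M 0%N * (N1 * K)); first by rewrite !mulr_ge0// ltW.
move=> u N t su bu t01.
have -> : M 0%N * (N1 * K) * N * t ^+ m = M 0%N * (N1 * (K * N * t ^+ m)) by ring.
apply: (bnd_mul_local M_gt0 M_logconvex ab h10 h0 sc _ c0 bN1).
  by apply: smooth_scale; exact: smooth_trem.
move=> p x /andP[ax xb]; apply: (HK u N t su bu t01 p x) => /=.
exact: abs_le_max.
Qed.

Lemma cut_trem_rt m a b chi h1 h0 u t : a <= b -> 0 < h1 -> 0 < h0 -> cut a b chi ->
  smooth u -> (forall h, hset s h0 h -> exists N, bnd M h N setT u) -> 0 < t <= 1 ->
  rt s M (h1 + h0) a b (fun x => chi x * trem m u (t * x)).
Proof.
move=> ab h10 h00 cc su bu t01; have [sc c0 bc] := cc.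
split; first by apply: (smooth_mul sc); apply: smooth_scale; exact: smooth_trem.
  by move=> x /c0 ->; rewrite mul0r.
move=> h /(hset_split h10 h00)[k1 [k2 [hk1 hk2 <-]]].
have [N bN] := bu _ hk2.
have [K K0 HK] := cut_trem_bnd m ab (hset_gt0 h10 hk1) (hset_gt0 h00 hk2) cc.
by exists (K * N * t ^+ m); exact: HK.
Qed.

Lemma smooth_pow i : smooth (fun x : R => x ^+ i).
Proof.
have := jet_smooth (@jet_monomial R i); congr smooth.
by apply/funext => x; rewrite ffactn0 mul1r subn0.
Qed.

Lemma bnd_pow a b i h : 0 < h ->
  exists N, bnd M h N [set x | a <= x <= b] (fun x => x ^+ i).
Proof.
move=> h0; pose B := Num.max `|a| `|b|.
have hp p : 0 < h ^+ p * M p by rewrite mulr_gt0// exprn_gt0.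
pose k p := (i ^_ p)%:R * B ^+ (i - p) / (h ^+ p * M p).
have B0 : 0 <= B by rewrite le_max normr_ge0.
have k0 p : 0 <= k p by rewrite divr_ge0 ?mulr_ge0 ?exprn_ge0 ?(ltW h0) ?(ltW (M_gt0 _)).
exists (\sum_(p < i.+1) k p) => p x /andP[ax xb].
have xB : `|x| <= B by exact: abs_le_max.
have -> : derive1n p (fun x => x ^+ i) x = (i ^_ p)%:R * x ^+ (i - p).
  have := jet_derive1n (@jet_monomial R i) p => /(congr1 (fun f => f x)) <-.
  congr (derive1n p _ x).
  by apply/funext => y; rewrite ffactn0 mul1r subn0.
have [ip|pi] := ltnP i p.
  by rewrite ffact_small// mul0r normr0 mulr_ge0 ?sumr_ge0// ltW.
apply: (@le_trans _ _ (k p * (h ^+ p * M p))); last first.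
  apply: ler_wpM2r; first exact: ltW.
  have pi1 : (p < i.+1)%N by [].
  rewrite (bigD1 (Ordinal pi1))//= lerDl; exact: sumr_ge0.
rewrite /k divfK ?gt_eqF// normrM normr_nat ler_wpM2l// normrX lerXn2r// nnegrE//.
Qed.

Lemma cut_pow a b chi i : a <= b -> cut a b chi -> cut a b (fun x => chi x * x ^+ i).
Proof.
move=> ab [sc c0 bc]; split; first by apply: (smooth_mul sc); exact: smooth_pow.
  by move=> x /c0 ->; rewrite mul0r.
move=> h h0; have h20 : 0 < h / 2 by rewrite divr_gt0.
have [N bN] := bc _ h20; have [N' bN'] := bnd_pow a b i h20.
exists (M 0%N * (N * N')); have <- : h / 2 + h / 2 = h by lra.
exact: (bnd_mul_local M_gt0 M_logconvex ab h20 h20 sc (@smooth_pow i) c0 bN bN').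
Qed.

Lemma trem_lin m c u v : smooth u -> smooth v ->
  trem m (fun x => c * u x + v x) = fun x => c * trem m u x + trem m v x.
Proof.
move=> su sv; apply/funext => x; rewrite /trem /taylor.
under eq_bigr => i _ do rewrite derive1n_lin//.
rewrite mulrBr addrACA -opprD; congr (_ - _); rewrite mulr_sumr -big_split/=.
by apply: eq_bigr => i _; ring.
Qed.

Lemma trem_scale m u t : smooth u -> trem m (fun x => u (t * x)) = fun x => trem m u (t * x).
Proof.
move=> su; apply/funext => x; rewrite /trem /taylor; congr (_ - _).
apply: eq_bigr => i _; rewrite derive1n_scale// mulr0 exprMn.
by ring.
Qed.

(** What the integrals require of a test function: no reference to [M], and stability under
    differentiation, for integration by parts. Taking [2 <= b] places [b] past the transition of
    [theta]. *)
Definition bounded_test u := [/\ smooth u, exists2 b : R, 2 <= b & forall x, b < x -> u x = 0 &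
  forall n, exists2 B : R, 0 <= B & forall x, `|derive1n n u x| <= B].

Lemma trem_bound u m : bounded_test u -> exists2 B, 0 <= B & forall x, `|trem m u x| <= B * `|x| ^+ m.
Proof.
move=> [su _ bu]; have [B B0 HB] := bu m; exists B => // x.
have := trem_jet_bound su HB x (leqnn m).
by rewrite subnn trem_jet0 mulrC.
Qed.

End TaylorRemainder.

(** * Extension to the line *)

Section RightLimits.
Context {R : realType}.
Implicit Types (g : R -> R).

Lemma near0P (P : R -> Prop) :
  (\forall e \near 0^'+, P e) <-> exists2 d : R, 0 < d & forall e, 0 < e < d -> P e.
Proof.
split.
  move=> [d d0 H]; exists d => // e /andP[e0 ed]; apply: H => //=.
  by rewrite sub0r normrN gtr0_norm.
move=> [d d0 H]; exists d => // e ed e0; apply: H; rewrite e0.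
by move: ed; rewrite /= sub0r normrN gtr0_norm.
Qed.

(** Exchange of the limits in [e] and [J]: the approximation is uniform in [e], so a three-term
    estimate at one fixed [J] is enough. *)
Lemma cvg_uniform_approx (G : R -> R) (S : nat -> R -> R) (l : nat -> R) (L K q d : R) :
  0 <= q < 1 -> 0 < d -> (forall J, S J e @[e --> 0^'+] --> l J) -> l @ \oo --> L ->
  (forall e J, 0 < e < d -> `|G e - S J e| <= K * q ^+ J) ->
  G e @[e --> 0^'+] --> L.
Proof.
move=> /andP[q0 q1] d0 Sl lL GS; apply/cvgrPdist_le => eta eta0.
have e3 : 0 < eta / 3 by rewrite divr_gt0.
have q1' : `|q| < 1 by rewrite ger0_norm.
have cq : (K * q ^+ J) @[J --> \oo] --> (0 : R) by exact: (cvg_geometric K q1').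
have [J [HJ1 HJ2]] : exists J, `|L - l J| <= eta / 3 /\ K * q ^+ J <= eta / 3.
  have [n1 _ Hn1] := (cvgrPdist_le _ _).1 lL _ e3.
  have [n2 _ Hn2] := (cvgrPdist_le _ _).1 cq _ e3.
  exists (maxn n1 n2); split; first by apply: Hn1; exact: leq_maxl.
  have := Hn2 _ (leq_maxr n1 n2); rewrite /= sub0r normrN; apply: le_trans.
  exact: ler_norm.
near=> e.
have ed : 0 < e < d by near: e; apply/near0P; exists d.
have H1 := GS e J ed.
have H2 : `|l J - S J e| <= eta / 3 by near: e; exact: (cvgrPdist_le _ _).1 (Sl J) _ e3.
have -> : L - G e = (L - l J) + (l J - S J e) - (G e - S J e) by ring.
have -> : eta = eta / 3 + eta / 3 + eta / 3 by lra.
apply: le_trans (ler_normB _ _) _; apply: lerD; last exact: le_trans H1 HJ2.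
by apply: le_trans (ler_normD _ _) _; exact: lerD.
Unshelve. all: by end_near. Qed.

Lemma geometric_limit (v : nat -> R) (K q : R) : 0 <= q < 1 -> 0 <= K ->
  (forall J, `|v J.+1 - v J| <= K * q ^+ J) ->
  v @ \oo --> lim (v @ \oo) /\ forall J, `|lim (v @ \oo) - v J| <= K / (1 - q) * q ^+ J.
Proof.
move=> /andP[q0 q1] K0 H; have q1' : 0 < 1 - q by lra.
have K1 : 0 <= K / (1 - q) by rewrite divr_ge0// ltW.
have tele J : K / (1 - q) * q ^+ J - K / (1 - q) * q ^+ J.+1 = K * q ^+ J.
  by rewrite exprSr; field; rewrite gt_eqF.
have [||l Hl] := @telescope_limit _ v (fun J => K / (1 - q) * q ^+ J).
- by move=> J; rewrite tele; exact: H.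
- by move=> J; rewrite mulr_ge0// exprn_ge0.
have cl : v @ \oo --> l.
  apply/cvgrPdist_le => eta eta0.
  have q1'' : `|q| < 1 by rewrite ger0_norm.
  have [n _ Hn] := (cvgrPdist_le _ _).1 (cvg_geometric (K / (1 - q)) q1'') _ eta0.
  exists n => // J nJ; have := Hn J nJ; rewrite sub0r normrN => HJ; apply: le_trans (Hl J) _.
  exact: le_trans (ler_norm _) HJ.
by have -> := cvg_lim (@Rhausdorff R) cl.
Qed.

End RightLimits.

Section Extension.
Context {R : realType} (s : ultraclass) (M : nat -> R).
Context (M_gt0 : forall p, 0 < M p).
Context (M_logconvex : forall p, (1 <= p)%N -> M p ^+ 2 <= M p.-1 * M p.+1).
Context (theta : R -> R) (smooth_theta : smooth theta)
  (theta0 : forall x, x <= 1 -> theta x = 0) (theta1 : forall x, 2 <= x -> theta x = 1)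
  (bnd_theta : forall h, 0 < h -> exists N, bnd M h N setT theta).

Definition wtest (u : R -> R) := exists h0 a b, 0 < h0 /\ rt s M h0 a b u.
Definition ptest (u : R -> R) := exists h0 a b, [/\ 0 < h0, 0 < a & rt s M h0 a b u].
Definition dominated_on (f : (R -> R) -> R) (a b : R) := forall h0, 0 < h0 ->
  exists h C, [/\ hset s h0 h, 0 <= C & forall u N,
     rt s M h0 a b u -> bnd M h N setT u -> `|f u| <= C * N].

Lemma wtest_lin c u v : wtest u -> wtest v -> wtest (fun x => c * u x + v x).
Proof.
move=> [h [a [b [h0 ru]]]] [h' [a' [b' [h0' rv]]]].
exists (Num.max h h'), (Num.min a a'), (Num.max b b'); split; first by rewrite lt_max h0.
by apply: rt_lin; [apply: (rt_mono M_gt0 h0 _ _ _ ru) | apply: (rt_mono M_gt0 h0' _ _ _ rv)];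
  rewrite ?le_max ?ge_min ?lexx ?orbT.
Qed.

Lemma ptest_lin c u v : ptest u -> ptest v -> ptest (fun x => c * u x + v x).
Proof.
move=> [h [a [b [h0 a0 ru]]]] [h' [a' [b' [h0' a0' rv]]]].
exists (Num.max h h'), (Num.min a a'), (Num.max b b'); split; first by rewrite lt_max h0.
  by rewrite lt_min a0.
by apply: rt_lin; [apply: (rt_mono M_gt0 h0 _ _ _ ru) | apply: (rt_mono M_gt0 h0' _ _ _ rv)];
  rewrite ?le_max ?ge_min ?lexx ?orbT.
Qed.

Lemma ptest_wtest u : ptest u -> wtest u.
Proof. by move=> [h [a [b [h0 a0 ru]]]]; exists h, a, b. Qed.

Lemma wtest_smooth u : wtest u -> smooth u.
Proof. by move=> [? [? [? [_ []]]]]. Qed.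

Lemma ptest_scale u t : 0 < t -> ptest u -> ptest (fun x => u (t * x)).
Proof.
move=> t0 [h [a [b [h0 a0 ru]]]]; exists (t * h), (a / t), (b / t); split.
- exact: mulr_gt0.
- exact: divr_gt0.
- exact: rt_scale.
Qed.

Lemma wtest_scale u t : 0 < t -> wtest u -> wtest (fun x => u (t * x)).
Proof.
move=> t0 [h [a [b [h0 ru]]]]; exists (t * h), (a / t), (b / t); split.
  exact: mulr_gt0.
exact: rt_scale.
Qed.

Lemma cut_ptest a b chi : 0 < a -> cut M a b chi -> ptest chi.
Proof. by move=> a0 cc; exists 1, a, b; split; [exact: ltr01 | exact: a0 | exact: cut_rt]. Qed.

(** Annular cutoffs, supported away from 0. They telescope, [chi l k + chi k m = chi l m], and
    dilation acts on both indices; every decomposition of the extension rests on this. *)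
Definition chi (l m : R) (x : R) : R := theta (l * x) - theta (m * x).

Lemma cut_chi_explicit l m : 0 < l -> 0 < m ->
  cut M (Num.min l^-1 m^-1) (2 * Num.max l^-1 m^-1) (chi l m).
Proof.
move=> l0 m0; pose a := Num.min l^-1 m^-1; pose b := 2 * Num.max l^-1 m^-1.
have sl := @smooth_scale _ _ smooth_theta l; have sm := @smooth_scale _ _ smooth_theta m.
have ce : chi l m = fun x => -1 * theta (m * x) + theta (l * x).
  by apply/funext => x; rewrite /chi; ring.
split; first by rewrite ce; exact: (smooth_lin sm sl).
  move=> x xab; rewrite /chi; have [xa|ax] := ltP x a.
    move: xa; rewrite /a lt_min => /andP[xl xm].
    rewrite !theta0 ?subrr//; first by rewrite -ler_pdivlMl// mulr1 ltW.
    by rewrite -ler_pdivlMl// mulr1 ltW.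
  move: xab; rewrite ax/= -ltNge /b => bx.
  have lx : 2 * l^-1 <= x.
    by apply: le_trans (ltW bx); rewrite ler_pM2l// le_max lexx.
  have mx : 2 * m^-1 <= x.
    by apply: le_trans (ltW bx); rewrite ler_pM2l// le_max lexx orbT.
  by rewrite !theta1 ?subrr// mulrC -ler_pdivrMr.
move=> h h0; have [N bN] := bnd_theta (divr_gt0 h0 l0); have [N' bN'] := bnd_theta (divr_gt0 h0 m0).
have b1 := bnd_scale smooth_theta l0 bN; have b2 := bnd_scale smooth_theta m0 bN'.
rewrite mulrC divfK ?gt_eqF// in b1; rewrite mulrC divfK ?gt_eqF// in b2.
by exists (`|-1| * N' + N); rewrite ce; exact: (bnd_lin (-1) sm sl b2 b1).
Qed.

Lemma cut_chi l m : 0 < l -> 0 < m -> exists a b, [/\ 0 < a, a <= b & cut M a b (chi l m)].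
Proof.
move=> l0 m0; exists (Num.min l^-1 m^-1), (2 * Num.max l^-1 m^-1).
split; [by rewrite lt_min !invr_gt0 l0 | | exact: cut_chi_explicit].
apply: (@le_trans _ _ l^-1); first by rewrite ge_min lexx.
have : l^-1 <= Num.max l^-1 m^-1 by rewrite le_max lexx.
have : 0 < l^-1 by rewrite invr_gt0.
by move: (Num.max _ _) => B; lra.
Qed.

Lemma theta_wtest_rt h0 a b u : 0 < h0 -> rt s M h0 a b u ->
  rt s M (h0 + h0) 1 (Num.max b 1) (fun x => theta x * u x).
Proof.
move=> h00 ru; have [su u0 bu] := ru.
split; first exact: smooth_mul.
  move=> x xb; have [x1|x1] := ltP x 1; first by rewrite theta0 ?mul0r// ltW.
  rewrite u0 ?mulr0//; apply: contra xb => /andP[_ xb]; rewrite x1/= le_max xb//.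
move=> h hh; have [k1 [k2 [hk1 hk2 <-]]] := hset_split h00 h00 hh.
have [N bN] := bu _ hk2; have [N' bN'] := bnd_theta (hset_gt0 h00 hk1).
exists (M 0%N * (N' * N)); apply: bnd_mul => //; [exact: hset_gt0 hk1 | exact: hset_gt0 hk2].
Qed.

Lemma theta_ptest u : wtest u -> ptest (fun x => theta x * u x).
Proof.
move=> [h0 [a [b [h00 ru]]]]; exists (h0 + h0), 1, (Num.max b 1); split; [exact: addr_gt0 | exact: ltr01 |].
exact: theta_wtest_rt ru.
Qed.

Context (f : (R -> R) -> R).
Context (f_lin : forall c u v, ptest u -> ptest v ->
  f (fun x => c * u x + v x) = c * f u + f v).
Context (f_dom : forall a b, 0 < a -> dominated_on f a b).

Definition fdil (g : (R -> R) -> R) e u := e^-1 * g (fun x => u (e^-1 * x)).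

Lemma fdilM e t u : e != 0 -> t != 0 ->
  fdil f e (fun x => u (t^-1 * x)) = t * fdil f (e * t) u.
Proof.
move=> e0 t0; rewrite /fdil mulrA.
have -> : t * (e * t)^-1 = e^-1 by field; rewrite e0.
congr (_ * f _); apply/funext => x; congr (u _).
by field; rewrite ?e0 ?t0.
Qed.

Lemma fdil_lin e c u v : 0 < e -> ptest u -> ptest v ->
  fdil f e (fun x => c * u x + v x) = c * fdil f e u + fdil f e v.
Proof.
move=> e0 pu pv; rewrite /fdil f_lin; first by ring.
  by apply: ptest_scale => //; rewrite invr_gt0.
by apply: ptest_scale => //; rewrite invr_gt0.
Qed.

Lemma ptest0 : ptest (fun=> 0).
Proof. by exists 1, 1, 1; split; [exact: ltr01 | exact: ltr01 | exact: rt0]. Qed.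

Lemma f_zero : f (fun=> 0) = 0.
Proof.
have := f_lin 1 ptest0 ptest0.
rewrite (_ : (fun x => _) = (fun=> 0)); last by apply/funext => z; rewrite mulr0 addr0.
by rewrite mul1r => /eqP; rewrite -subr_eq0 opprD addNKr oppr_eq0 => /eqP.
Qed.

Lemma f_scale c u : ptest u -> f (fun x => c * u x) = c * f u.
Proof.
move=> pu; rewrite -[RHS]addr0 -f_zero -(f_lin c pu ptest0).
by congr f; apply/funext => x; rewrite addr0.
Qed.

Context (rho : R -> R) (alpha : R).
Context (Ilim : (R -> R) -> R).
Context (f_quasi : forall u, ptest u -> fdil f e u / rho e @[e --> 0^'+] --> Ilim u).
Context (rho_gt0 : \forall e \near 0^'+, 0 < rho e).
Context (rho_ratio : forall t, 0 < t -> rho (t * e) / rho e @[e --> 0^'+] --> t `^ alpha).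

(** The quasiasymptotic limit bounds the dilates for each test separately; [uniform_boundedness]
    upgrades this to one seminorm valid for all small [e]. *)
Lemma fdil_uniform a b h0 : 0 < a -> 0 < h0 -> exists h C d,
  [/\ hset s h0 h, 0 <= C, 0 < d & forall e u N, 0 < e < d ->
     rt s M h0 a b u -> bnd M h N setT u -> `|fdil f e u| <= C * N * rho e].
Proof.
move=> a0 h00.
pose T e u := fdil f e u / rho e.
have pt u : rt s M h0 a b u -> ptest u.
  by move=> ru; exists h0, a, b; split; [exact: h00 | exact: a0 | exact: ru].
have Tlin e c u v : 0 < e -> rt s M h0 a b u -> rt s M h0 a b v ->
    T e (fun x => c * u x + v x) = c * T e u + T e v.
  by move=> e0 /pt pu /pt pv; rewrite /T fdil_lin//; ring.
have Tdom e : 0 < e -> exists h C, [/\ hset s h0 h, 0 <= C & forall u N,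
     rt s M h0 a b u -> bnd M h N setT u -> `|T e u| <= C * N].
  move=> e0; have ei : 0 < e^-1 by rewrite invr_gt0.
  have [h [C [hh C0 H]]] := f_dom (b / e^-1) (divr_gt0 a0 ei) (mulr_gt0 ei h00).
  exists (e * h), (e^-1 * C * `|(rho e)^-1|); split.
  + by have := hset_scale e0 hh; rewrite mulVKf ?gt_eqF.
  + by apply: mulr_ge0 => //; apply: mulr_ge0 => //; exact: ltW.
  move=> u N ru bu; rewrite /T normrM mulrAC; apply: ler_wpM2r => //.
  rewrite /fdil normrM (gtr0_norm ei) -mulrA ler_pM2l//.
  apply: H; first exact: rt_scale ei ru.
  have su : smooth u by case: ru.
  by have := bnd_scale su ei bu; rewrite mulKf ?gt_eqF.
have Tbd u : rt s M h0 a b u -> exists C d, 0 < d /\ forall e, 0 < e < d -> `|T e u| <= C.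
  move=> /pt pu; have H0 : \forall e \near 0^'+, `|Ilim u - T e u| <= 1.
    exact: (cvgrPdist_le _ _).1 (f_quasi pu) 1 ltr01.
  move/near0P : H0 => [d d0 H].
  exists (`|Ilim u| + 1), d; split => // e ed.
  have -> : T e u = Ilim u - (Ilim u - T e u) by ring.
  by apply: le_trans (ler_normB _ _) _; rewrite lerD2l; exact: H.
have [h [C [d [hh C0 d0 H]]]] := uniform_boundedness M_gt0 h00 Tlin Tdom Tbd.
have /near0P[d' d'0 H'] := rho_gt0.
exists h, C, (Num.min d d'); split; [exact: hh | exact: C0 | by rewrite lt_min d0 |].
move=> e u N /andP[e0]; rewrite lt_min => /andP[ed ed'] ru bu.
have := H e u N; rewrite e0 ed => /(_ isT ru bu); rewrite /T.
have re : 0 < rho e by apply: H'; rewrite e0.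
by rewrite normrM normfV (gtr0_norm re) ler_pdivrMr.
Qed.

(** The ratio of [rho] at [e / 2] and at [e] tends to 2 to the power [- alpha], which is below
    [2 ^+ m.+1]. An [r] strictly in between absorbs the error of slow variation, and [r / 2 ^+ m.+1]
    is the ratio of the geometric series to come. *)
Lemma rho_decay m : 0 < alpha + m.+1%:R -> exists r d,
  [/\ 0 < r, r / 2 ^+ m.+1 < 1, 0 < d & forall e, 0 < e < d -> forall J,
     0 < rho (e / 2 ^+ J) /\ rho (e / 2 ^+ J) <= r ^+ J * rho e].
Proof.
move=> am; pose p := (2^-1 : R) `^ alpha.
have p0 : 0 < p by rewrite powR_gt0// invr_gt0.
have pm : p < 2 ^+ m.+1.
  have : (1 : R) `^ (alpha + m.+1%:R) < 2 `^ (alpha + m.+1%:R).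
    by apply: gt0_ltr_powR => //; rewrite ?nnegrE// ltr1n.
  rewrite powR1 powRD ?powR_mulrn//; last by rewrite pnatr_eq0 implybT.
  rewrite /p -powR_inv1// -powRrM mulN1r powRN.
  have q0 : 0 < 2 `^ alpha :> R by rewrite powR_gt0.
  by rewrite -ltr_pdivrMl// mulr1.
pose r := (p + 2 ^+ m.+1) / 2.
have pr : p < r by rewrite /r; lra.
have rm : r < 2 ^+ m.+1 by rewrite /r; lra.
have r0 : 0 < r by lra.
have Hlim : \forall e \near 0^'+, `|p - rho (2^-1 * e) / rho e| <= r - p.
  by apply: (cvgrPdist_le _ _).1; [apply: rho_ratio; rewrite invr_gt0 | lra].
have /near0P[d1 d10 H1] := rho_gt0; move/near0P : Hlim => [d2 d20 H2].
exists r, (Num.min d1 d2); split; [by [] | | by rewrite lt_min d10 |].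
  by rewrite ltr_pdivrMr ?exprn_gt0// mul1r.
move=> e /andP[e0]; rewrite lt_min => /andP[ed1 ed2].
have eJ J : 0 < e / 2 ^+ J <= e.
  rewrite divr_gt0 ?exprn_gt0//= ler_pdivrMr ?exprn_gt0// ler_peMr ?(ltW e0)//.
  by rewrite exprn_ege1// ler1n.
have pos J : 0 < rho (e / 2 ^+ J).
  by apply: H1; have /andP[-> /le_lt_trans] := eJ J; apply.
move=> J; split; first exact: pos.
elim: J => [|J IH]; first by rewrite !expr0 divr1 mul1r.
have /andP[J1 J2] := eJ J; have := H2 (e / 2 ^+ J); rewrite J1 (le_lt_trans J2 ed2) => /(_ isT).
have -> : 2^-1 * (e / 2 ^+ J) = e / 2 ^+ J.+1 by rewrite exprS invfM mulrCA.
rewrite ler_norml => /andP[H _].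
have {}H : rho (e / 2 ^+ J.+1) / rho (e / 2 ^+ J) <= r by lra.
rewrite ler_pdivrMr// in H; apply: le_trans H _.
by rewrite exprS -mulrA ler_pM2l.
Qed.

(** Bounds without a support condition: these functions enter through Taylor remainders multiplied
    by a cutoff, which alone provides the compact support. *)
Definition cls h0 u := smooth u /\ forall h, hset s h0 h -> exists N, bnd M h N setT u.

Lemma cls_scale h0 t u : 0 < t -> t <= 1 -> 0 < h0 -> cls h0 u -> cls h0 (fun x => u (t * x)).
Proof.
move=> t0 t1 h00 [su bu]; split; first exact: (@smooth_scale _ _ su t).
move=> h hh; have [N bN] := bu h hh; exists N.
have h_0 := hset_gt0 h00 hh.
have N0 := bnd_ge0 M_gt0 (I : setT (0 : R)) bN.
have th : t * h <= h by rewrite ler_piMl// ltW.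
exact: (bnd_mono M_gt0 (mulr_gt0 t0 h_0) th (lexx N) N0 (@subset_refl _ setT) (bnd_scale su t0 bN)).
Qed.

Lemma cls_trem_ptest m a b ch h0 u t : 0 < h0 -> 0 < a -> a <= b -> cut M a b ch -> cls h0 u ->
  0 < t <= 1 -> ptest (fun x => ch x * trem m u (t * x)).
Proof.
move=> h00 a0 ab cc [su bu] t01.
exists (1 + h0), a, b; split; [by rewrite addr_gt0 | exact: a0 |].
exact: (cut_trem_rt M_gt0 M_logconvex m ab ltr01 h00 cc su bu t01).
Qed.

(** Combines the uniform bound for the dilates with the gain [t ^+ m]; the constants do not depend
    on [e], [t] or [u]. *)
Lemma small_scale m a b ch h0 : 0 < h0 -> 0 < a -> a <= b -> cut M a b ch ->
  exists h K d, [/\ hset s h0 h, 0 <= K, 0 < d & forall e t u N, 0 < e < d -> 0 < t <= 1 ->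
    cls h0 u -> bnd M h N setT u ->
    `|fdil f e (fun x => ch x * trem m u (t * x))| <= K * N * t ^+ m * rho e].
Proof.
move=> h00 a0 ab cc.
have [h [C [d [hh C0 d0 H]]]] := fdil_uniform b a0 (addr_gt0 ltr01 h00).
have [k1 [k2 [hk1 hk2 ek]]] := hset_split ltr01 h00 hh.
have [K K0 HK] := cut_trem_bnd M_gt0 M_logconvex m ab (hset_gt0 ltr01 hk1) (hset_gt0 h00 hk2) cc.
exists k2, (C * K), d; split; [exact: hk2 | exact: mulr_ge0 | exact: d0 |].
move=> e t u N ed t01 [su bu] bN.
have bw := HK u N t su bN t01; rewrite ek in bw.
have := H e _ _ ed (cut_trem_rt M_gt0 M_logconvex m ab ltr01 h00 cc su bu t01) bw.
by have -> : C * (K * N * t ^+ m) * rho e = C * K * N * t ^+ m * rho e by ring.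
Qed.

Definition cls_dominated h0 (A : (R -> R) -> R) := exists h C, [/\ hset s h0 h, 0 <= C &
  forall u N, cls h0 u -> bnd M h N setT u -> `|A u| <= C * N].

Lemma cls_dominated_add h0 A B D : 0 < h0 -> cls_dominated h0 A -> cls_dominated h0 B ->
  (forall u, cls h0 u -> `|D u| <= `|A u| + `|B u|) -> cls_dominated h0 D.
Proof.
move=> h00 [h [C [hh C0 HA]]] [h' [C' [hh' C0' HB]]] HD.
have hm := hset_min hh hh'; exists (Num.min h h'), (C + C').
split; [exact: hm | exact: addr_ge0 |].
move=> u N cu bu; have N0 := bnd_ge0 M_gt0 (I : setT (0 : R)) bu.
apply: le_trans (HD u cu) _; rewrite mulrDl; have hm0 := hset_gt0 h00 hm.
apply: lerD.
  apply: HA => //; apply: (bnd_mono M_gt0 hm0 _ (lexx N) N0 (@subset_refl _ setT) bu).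
  by rewrite ge_min lexx.
apply: HB => //; apply: (bnd_mono M_gt0 hm0 _ (lexx N) N0 (@subset_refl _ setT) bu).
by rewrite ge_min lexx orbT.
Qed.

(** Partial sums of the dyadic series: by telescoping, [chi (2 ^+ J) 1] is the sum of the first [J]
    dyadic annuli. *)
Definition Sd m e J u := fdil f e (fun x => chi (2 ^+ J) 1 x * trem m u x).

Let two_gt0 J : 0 < 2 ^+ J :> R. Proof. by rewrite exprn_gt0. Qed.

Lemma chi_trem_ptest m h0 l k u : 0 < h0 -> 0 < l -> 0 < k -> cls h0 u ->
  ptest (fun x => chi l k x * trem m u x).
Proof.
move=> h00 l0 k0 cu; have [a [b [a0 ab cc]]] := cut_chi l0 k0.
have t1 : 0 < (1 : R) <= 1 by rewrite ltr01 lexx.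
have := cls_trem_ptest m h00 a0 ab cc cu t1.
by under eq_fun do rewrite mul1r.
Qed.

(** The new annulus is the fixed one [chi 2 1] at scale [2 ^- J]; a change of variables transfers
    this scale to the functional. *)
Lemma Sd_step m e J h0 u : 0 < e -> 0 < h0 -> cls h0 u ->
  Sd m e J.+1 u - Sd m e J u =
  (2 ^+ J)^-1 * fdil f (e / 2 ^+ J) (fun x => chi 2 1 x * trem m u ((2 ^+ J)^-1 * x)).
Proof.
move=> e0 h00 cu; have tJ := two_gt0 J.
rewrite -fdilM ?gt_eqF// ?invr_gt0//.
have -> : Sd m e J.+1 u = fdil f e (fun x =>
    1 * (chi (2 ^+ J.+1) (2 ^+ J) x * trem m u x) + chi (2 ^+ J) 1 x * trem m u x).
  by rewrite /Sd; congr fdil; apply/funext => x; rewrite /chi; ring.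
rewrite fdil_lin//; [|exact: (chi_trem_ptest m h00)|exact: (chi_trem_ptest m h00)].
rewrite mul1r /Sd addrK; congr fdil; apply/funext => x.
by rewrite invrK mulKf ?gt_eqF// /chi exprS mulrA mul1r.
Qed.

Lemma Sd_lin m e J c u v h0 : 0 < e -> 0 < h0 -> cls h0 u -> cls h0 v ->
  Sd m e J (fun x => c * u x + v x) = c * Sd m e J u + Sd m e J v.
Proof.
move=> e0 h00 cu cv; rewrite /Sd trem_lin; [|by case: cu|by case: cv].
rewrite -fdil_lin//; [|exact: (chi_trem_ptest m h00)|exact: (chi_trem_ptest m h00)].
by congr fdil; apply/funext => x; ring.
Qed.

(** Three factors per step: [2 ^- J] from the change of scale, [2 ^- (J * m)] from the remainder,
    [r ^+ J] from [rho]; together they make [q ^+ J]. *)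
Lemma Sd_uniform m h0 : 0 < h0 -> 0 < alpha + m.+1%:R -> exists h K q d,
  [/\ hset s h0 h, 0 <= K, 0 <= q < 1, 0 < d &
   forall e u N, 0 < e < d -> cls h0 u -> bnd M h N setT u -> forall J,
     `|Sd m e J.+1 u - Sd m e J u| <= K * N * rho e * q ^+ J].
Proof.
move=> h00 am; have [a [b [a0 ab cc]]] := @cut_chi 2 1 (ltr0Sn R 1) ltr01.
have [h [K [d [hh K0 d0 H]]]] := small_scale m h00 a0 ab cc.
have [r [d' [r0 r1 d'0 H']]] := rho_decay am.
exists h, K, (r / 2 ^+ m.+1), (Num.min d d').
split; [exact: hh | exact: K0 | by rewrite r1 divr_ge0 ?(ltW r0)// ltW | by rewrite lt_min d0 |].
move=> e u N /andP[e0]; rewrite lt_min => /andP[ed ed'] cu bu J.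
have N0 := bnd_ge0 M_gt0 (I : setT (0 : R)) bu.
have tJ := two_gt0 J; have t1 : 1 <= 2 ^+ J :> R by rewrite exprn_ege1// ler1n.
have ti : 0 < ((2 : R) ^+ J)^-1 <= 1 by rewrite invr_gt0 tJ invf_le1.
rewrite (Sd_step m J e0 h00 cu) normrM gtr0_norm ?invr_gt0//.
have eJ : 0 < e / 2 ^+ J < d.
  rewrite divr_gt0//= ltr_pdivrMr// (lt_le_trans ed)// ler_peMr// ltW//.
have := H _ _ _ N eJ ti cu bu => HH.
have [_ HJ] := H' e (introT andP (conj e0 ed')) J.
rewrite -ler_pdivlMl ?invr_gt0// invrK; apply: le_trans HH _.
have KN : 0 <= K * N * ((2 ^+ J)^-1) ^+ m by rewrite !mulr_ge0// exprn_ge0// ltW// invr_gt0.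
apply: le_trans (ler_wpM2l KN HJ) _; rewrite le_eqVlt; apply/orP; left; apply/eqP.
have e1 : (2 ^+ m.+1) ^+ J = 2 ^+ J * (2 ^+ J) ^+ m :> R.
  by rewrite -!exprM mulSn exprD (mulnC m).
rewrite exprMn !exprVn e1; field.
by rewrite !gt_eqF// exprn_gt0.
Qed.

Definition Sd_lim m e u := lim (Sd m e J u @[J --> \oo]).

Lemma Sd_lim_bound m h0 : 0 < h0 -> 0 < alpha + m.+1%:R -> exists h K q d,
  [/\ hset s h0 h, 0 <= K, 0 <= q < 1, 0 < d &
   forall e u N, 0 < e < d -> cls h0 u -> bnd M h N setT u ->
     Sd m e J u @[J --> \oo] --> Sd_lim m e u /\
     forall J, `|Sd_lim m e u - Sd m e J u| <= K * N * rho e * q ^+ J].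
Proof.
move=> h00 am; have [h [K [q [d [hh K0 q01 d0 H]]]]] := Sd_uniform h00 am.
have /near0P[d' d'0 H'] := rho_gt0.
have q1 : 0 < 1 - q by case/andP: q01 => _; lra.
exists h, (K / (1 - q)), q, (Num.min d d').
split; [exact: hh | by rewrite divr_ge0// ltW | exact: q01 | by rewrite lt_min d0 |].
move=> e u N /andP[e0]; rewrite lt_min => /andP[ed ed'] cu bu.
have N0 := bnd_ge0 M_gt0 (I : setT (0 : R)) bu.
have r0 : 0 < rho e by apply: H'; rewrite e0.
have K0' : 0 <= K * N * rho e by rewrite !mulr_ge0// ltW.
have ed1 : 0 < e < d by rewrite e0.
have [cv bd] := @geometric_limit _ (fun J => Sd m e J u) _ q q01 K0' (H e u N ed1 cu bu).
split=> // J; apply: le_trans (bd J) _.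
by rewrite le_eqVlt; apply/orP; left; apply/eqP; ring.
Qed.

(* For large [e] the summation only starts at the scale where [e / 2 ^ J] is small. *)
Lemma Sd_lim_dominated m h0 e : 0 < e -> 0 < h0 -> 0 < alpha + m.+1%:R ->
  (forall u, cls h0 u -> Sd m e J u @[J --> \oo] --> Sd_lim m e u) /\
  cls_dominated h0 (Sd_lim m e).
Proof.
move=> e0 h00 am.
have [h [K [q [d [hh K0 q01 d0 H]]]]] := Sd_uniform h00 am.
have q1 : 0 < 1 - q by case/andP: q01 => _; lra.
have [J0 HJ0] : exists J0, e / 2 ^+ J0 < d.
  have [k Hk] := half_small e (divr_gt0 d0 (ltr0Sn R 1)); exists k.
  by apply: le_lt_trans (_ : _ <= d / 2) _; [rewrite -exprVn | lra].
pose t : R := (2 ^+ J0)^-1.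
have t0 : 0 < t by rewrite invr_gt0.
have t1 : t <= 1 by rewrite invf_le1// exprn_ege1// ler1n.
have scaled u J : cls h0 u -> Sd m e (J0 + J) u - Sd m e J0 u =
    t * Sd m (e * t) J (fun x => u (t * x)).
  move=> cu; rewrite /Sd -fdilM ?gt_eqF//.
  have t2 : t^-1 = 2 ^+ J0 by rewrite invrK.
  have -> : fdil f e (fun x => chi (2 ^+ (J0 + J)) 1 x * trem m u x) =
     fdil f e (fun x => 1 * (chi (2 ^+ (J0 + J)) (2 ^+ J0) x * trem m u x) + chi (2 ^+ J0) 1 x * trem m u x).
    by congr fdil; apply/funext => x; rewrite /chi; ring.
  rewrite fdil_lin//; [|exact: (chi_trem_ptest m h00)|exact: (chi_trem_ptest m h00)].
  rewrite mul1r addrK; congr fdil; apply/funext => x.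
  rewrite trem_scale; last by case: cu.
  by rewrite mulVKf ?gt_eqF// t2 /chi exprD mul1r; congr ((theta _ - _) * _); ring.
have et : 0 < e * t < d by rewrite mulr_gt0//=.
have key u N : cls h0 u -> bnd M h N setT u ->
    Sd m e J u @[J --> \oo] --> Sd_lim m e u /\
    `|Sd_lim m e u - Sd m e J0 u| <= K * `|rho (e * t)| / (1 - q) * N.
  move=> cu bu; have N0 := bnd_ge0 M_gt0 (I : setT (0 : R)) bu.
  have ct := cls_scale t0 t1 h00 cu.
  have h_0 := hset_gt0 h00 hh.
  have th : t * h <= h by rewrite ler_piMl// ltW.
  have su : smooth u by case: cu.
  have bt := bnd_mono M_gt0 (mulr_gt0 t0 h_0) th (lexx N) N0 (@subset_refl _ setT) (bnd_scale su t0 bu).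
  pose K1 := K * N * `|rho (e * t)|.
  have K10 : 0 <= K1 by rewrite !mulr_ge0.
  have st J : `|Sd m e (J0 + J.+1) u - Sd m e (J0 + J) u| <= K1 * q ^+ J.
    have -> : Sd m e (J0 + J.+1) u - Sd m e (J0 + J) u =
        (Sd m e (J0 + J.+1) u - Sd m e J0 u) - (Sd m e (J0 + J) u - Sd m e J0 u) by ring.
    rewrite !scaled// -mulrBr normrM gtr0_norm//.
    apply: (@le_trans _ _ (1 * (K * N * rho (e * t) * q ^+ J))).
      by apply: ler_pM => //; [exact: ltW | exact: H].
    rewrite mul1r; apply: ler_wpM2r; first by rewrite exprn_ge0//; case/andP: q01.
    by apply: ler_wpM2l; [rewrite mulr_ge0 | exact: ler_norm].
  have [cv bd] := @geometric_limit _ (fun J => Sd m e (J0 + J) u) _ q q01 K10 st.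
  have cv' : Sd m e J u @[J --> \oo] --> lim (Sd m e (J0 + J) u @[J --> \oo]).
    rewrite -(cvg_shiftn J0); under [X in X @ _ --> _]eq_fun do rewrite addnC.
    exact: cv.
  rewrite /Sd_lim (cvg_lim (@Rhausdorff R) cv'); split=> //.
  have := bd 0%N; rewrite addn0 expr0 mulr1 /K1.
  by have -> : K * N * `|rho (e * t)| / (1 - q) = K * `|rho (e * t)| / (1 - q) * N by ring.
split.
  by move=> u cu; have [_ bu] := cu; have [N bN] := bu _ hh; case: (key u N cu bN).
have [a [b [a0 ab cc]]] := @cut_chi (2 ^+ J0) 1 (two_gt0 J0) ltr01.
have domJ0 : cls_dominated h0 (Sd m e J0).
  have [h1 [C1 [hh1 C10 H1]]] : cls_dominated h0 (fun u => Sd m e J0 u).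
    have ei : 0 < e^-1 by rewrite invr_gt0.
    have [h' [C [hh' C0 HC]]] := f_dom (b / e^-1) (divr_gt0 a0 ei) (mulr_gt0 ei (addr_gt0 ltr01 h00)).
    have hh2 := hset_scale e0 hh'; rewrite mulVKf ?gt_eqF// in hh2.
    have [k1 [k2 [hk1 hk2 ek]]] := hset_split ltr01 h00 hh2.
    have [K2 K20 HK2] := cut_trem_bnd M_gt0 M_logconvex m ab (hset_gt0 ltr01 hk1) (hset_gt0 h00 hk2) cc.
    exists k2, (e^-1 * (C * K2)); split; [exact: hk2 | by rewrite !mulr_ge0// ltW |].
    move=> u N [su bu] bN; have t11 : 0 < (1 : R) <= 1 by rewrite ltr01 lexx.
    have bw := HK2 u N 1 su bN t11; rewrite ek expr1n mulr1 in bw.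
    have rw := cut_trem_rt M_gt0 M_logconvex m ab ltr01 h00 cc su bu t11.
    have bw' := bnd_scale (let: And3 q _ _ := rw in q) ei bw.
    rewrite mulKf ?gt_eqF// in bw'.
    have := HC _ _ (rt_scale ei rw) bw'.
    rewrite /Sd /fdil normrM gtr0_norm// -!mulrA ler_pM2l// => HH.
    by move: HH; under [X in f X]eq_fun do rewrite mul1r.
  by exists h1, C1; split.
have diff : cls_dominated h0 (fun u => Sd_lim m e u - Sd m e J0 u).
  exists h, (K * `|rho (e * t)| / (1 - q)); split; [exact: hh | by rewrite divr_ge0 ?mulr_ge0// ltW |].
  by move=> u N cu bu; case: (key u N cu bu).
apply: (cls_dominated_add h00 domJ0 diff) => u cu.
by have {1}-> : Sd_lim m e u = Sd m e J0 u + (Sd_lim m e u - Sd m e J0 u) by [ring]; exact: ler_normD.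
Qed.

Definition extension m u := f (fun x => theta x * u x) + Sd_lim m 1 u.

Lemma wtest2_cls u v : wtest u -> wtest v -> exists h0, [/\ 0 < h0, cls h0 u & cls h0 v].
Proof.
move=> [h [a [b [h0 ru]]]] [h' [a' [b' [h0' rv]]]].
exists (Num.max h h'); split; first by rewrite lt_max h0.
  have hm : h <= Num.max h h' by rewrite le_max lexx.
  by have [su _ bu] := rt_mono M_gt0 h0 hm (lexx a) (lexx b) ru; split.
have hm : h' <= Num.max h h' by rewrite le_max lexx orbT.
by have [sv _ bv] := rt_mono M_gt0 h0' hm (lexx a') (lexx b') rv; split.
Qed.

Lemma wtest_cls u : wtest u -> exists h0, 0 < h0 /\ cls h0 u.
Proof. by move=> wu; have [h0 [h00 cu _]] := wtest2_cls wu wu; exists h0. Qed.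

Lemma cls_wtest h0 u : cls h0 u -> smooth u. Proof. by case. Qed.

Lemma Sd_lim_cvg m e h0 u : 0 < alpha + m.+1%:R -> 0 < e -> 0 < h0 -> cls h0 u ->
  Sd m e J u @[J --> \oo] --> Sd_lim m e u.
Proof. by move=> am e0 h00 cu; have [H _] := Sd_lim_dominated e0 h00 am; exact: H. Qed.

Lemma extension_lin m c u v : 0 < alpha + m.+1%:R -> wtest u -> wtest v ->
  extension m (fun x => c * u x + v x) = c * extension m u + extension m v.
Proof.
move=> am wu wv; have [h0 [h00 cu cv]] := wtest2_cls wu wv.
rewrite /extension.
have -> : (fun x => theta x * (c * u x + v x)) = (fun x => c * (theta x * u x) + theta x * v x).
  by apply/funext => x; ring.
rewrite f_lin; [|exact: theta_ptest|exact: theta_ptest].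
have -> : Sd_lim m 1 (fun x => c * u x + v x) = c * Sd_lim m 1 u + Sd_lim m 1 v.
  apply: (cvg_lim (@Rhausdorff R)).
  under eq_fun do rewrite (Sd_lin m _ c ltr01 h00 cu cv).
  apply: cvgD; last exact: (Sd_lim_cvg am ltr01 h00 cv).
  by apply: cvgMr; exact: (Sd_lim_cvg am ltr01 h00 cu).
by ring.
Qed.

Lemma extension_dominated m a b : 0 < alpha + m.+1%:R -> dominated_on (extension m) a b.
Proof.
move=> am h0 h00; have [_ [h1 [C1 [hh1 C10 H1]]]] := Sd_lim_dominated ltr01 h00 am.
have [h2 [C2 [hh2 C20 H2]]] := f_dom (Num.max b 1) ltr01 (addr_gt0 h00 h00).
have [k1 [k2 [hk1 hk2 ek]]] := hset_split h00 h00 hh2.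
have k10 := hset_gt0 h00 hk1; have k20 := hset_gt0 h00 hk2.
have [N' bN'] := bnd_theta k10.
have N'0 := bnd_ge0 M_gt0 (I : setT (0 : R)) bN'.
have hm := hset_min hh1 hk2; have hm0 := hset_gt0 h00 hm.
exists (Num.min h1 k2), (C2 * (M 0%N * N') + C1).
split; [exact: hm | by rewrite addr_ge0// !mulr_ge0// ltW |].
move=> u N ru bu; have [su u0 cu] := ru.
have N0 := bnd_ge0 M_gt0 (I : setT (0 : R)) bu.
apply: le_trans (ler_normD _ _) _; rewrite mulrDl; apply: lerD.
  have m2 : Num.min h1 k2 <= k2 by rewrite ge_min lexx orbT.
  have b2 := bnd_mono M_gt0 hm0 m2 (lexx N) N0 (@subset_refl _ setT) bu.
  have b3 := bnd_mul M_gt0 M_logconvex k10 k20 smooth_theta su bN' b2.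
  rewrite ek in b3; have := H2 _ _ (theta_wtest_rt h00 ru) b3.
  by have -> : C2 * (M 0%N * N') * N = C2 * (M 0%N * (N' * N)) by ring.
apply: H1; first by split.
apply: (bnd_mono M_gt0 hm0 _ (lexx N) N0 (@subset_refl _ setT) bu).
by rewrite ge_min lexx.
Qed.

Lemma trem_away0 m (u : R -> R) (a b : R) : ~~ (a <= 0 <= b) -> (forall x, ~~ (a <= x <= b) -> u x = 0) ->
  trem m u = u.
Proof.
move=> ab0 u0; apply/funext => x; rewrite /trem /taylor big1 ?subr0// => i _.
by rewrite (derive1n_out u0)// !mul0r.
Qed.

Lemma fdil1 g u : fdil g 1 u = g u.
Proof.
by rewrite /fdil invr1 mul1r; congr g; apply/funext => x; rewrite mul1r.
Qed.

(** Away from 0 the Taylor polynomial of [u] is zero, and once [2 ^+ J * a >= 2] the outer cutoff is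
    1 on the support; the partial sums then stay at the part of [u] that [theta] leaves out. *)
Lemma extension_extends m u : ptest u -> extension m u = f u.
Proof.
move=> pu; have [h0 [a [b [h00 a0 ru]]]] := pu; have [su u0 bu] := ru.
have cu : cls h0 u by split.
have tu : trem m u = u.
  by apply: (@trem_away0 m u a b) => //; apply/negP => /andP[+ _]; rewrite leNgt a0.
pose one_theta x := -1 * (theta x * u x) + u x.
have pw : ptest one_theta by apply: ptest_lin => //; apply: theta_ptest; exact: ptest_wtest.
have ev : \forall J \near \oo, Sd m 1 J u = f one_theta.
  have [k Hk] := half_small 2 a0; exists k => // J kJ.
  rewrite /Sd fdil1 tu; congr f; apply/funext => x; rewrite /one_theta.
  have [xa|ax] := ltP x a.
    by rewrite u0 ?mulr0 ?addr0// negb_and -ltNge xa.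
  rewrite /chi mul1r theta1; first by ring.
  have J0 := two_gt0 J; have k0 := two_gt0 k.
  apply: (@le_trans _ _ (2 ^+ J * a)); last by rewrite ler_pM2l.
  apply: (@le_trans _ _ (2 ^+ k * a)).
    by rewrite mulrC -ler_pdivrMr// -exprVn.
  by rewrite ler_pM2r// ler_weXn2l// ler1n.
have -> : extension m u = f (fun x => theta x * u x) + f one_theta.
  congr (_ + _); apply: (lim_near_cst (@Rhausdorff R)).
  exact: ev.
have wu := ptest_wtest pu.
rewrite /one_theta f_lin//; last exact: theta_ptest.
by ring.
Qed.

(** All the cutoffs vanish on the negative half line; this is the part of the support statement not
    covered by [extension_extends]. *)
Lemma extension_negative m u h0 a b : b < 0 -> rt s M h0 a b u -> extension m u = 0.
Proof.
move=> b0 [su u0 bu].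
have tu : trem m u = u.
  by apply: (@trem_away0 m u a b) => //; apply/negP => /andP[_]; rewrite leNgt b0.
have z J : 0 <= J -> (fun x => theta (J * x) * u x) = (fun=> 0).
  move=> J0; apply/funext => x; have [bx|xb] := ltP b x.
    by rewrite u0 ?mulr0// negb_and -!ltNge bx orbT.
  rewrite theta0 ?mul0r//; apply: (@le_trans _ _ 0) => //.
  by rewrite mulr_ge0_le0// (le_trans xb)// ltW.
have e1 : (fun x => theta x * u x) = (fun=> 0).
  by rewrite -(z 1)//; apply/funext => x; rewrite mul1r.
have e2 J : Sd m 1 J u = 0.
  rewrite /Sd fdil1 tu (_ : (fun x => _) = (fun=> 0)) ?f_zero//.
  apply/funext => x; rewrite /chi mulrBl.
  have /(congr1 (fun g => g x)) -> := z (2 ^+ J) (ltW (two_gt0 J)).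
  by have /(congr1 (fun g => g x)) -> := z 1 ler01; rewrite subrr.
rewrite /extension e1 f_zero add0r; apply: (cvg_lim (@Rhausdorff R)).
by under eq_fun do rewrite e2; exact: cvg_cst.
Qed.

Definition moment i e := f (fun x => chi e^-1 1 x * x ^+ i).

Lemma trem0 (u : R -> R) : trem 0 u = u.
Proof. by apply/funext => x; rewrite /trem /taylor big_ord0 subr0. Qed.

Lemma chi_ptest h0 l k u : 0 < h0 -> 0 < l -> 0 < k -> cls h0 u ->
  ptest (fun x => chi l k x * u x).
Proof. by move=> h00 l0 k0 cu; have := chi_trem_ptest 0 h00 l0 k0 cu; rewrite trem0. Qed.

Lemma chi_pow_ptest l k i : 0 < l -> 0 < k -> ptest (fun x => chi l k x * x ^+ i).
Proof.
move=> l0 k0; have [a [b [a0 ab cc]]] := cut_chi l0 k0.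
exact: cut_ptest a0 (cut_pow M_gt0 M_logconvex i ab cc).
Qed.

Lemma f_sub_sum m (c : nat -> R) (w : R -> R) (p : nat -> R -> R) :
  ptest w -> (forall i, ptest (p i)) ->
  ptest (fun x => w x - \sum_(i < m) c i * p i x) /\
  f (fun x => w x - \sum_(i < m) c i * p i x) = f w - \sum_(i < m) c i * f (p i).
Proof.
move=> pw pp; elim: m => [|m [IH1 IH2]].
  have -> : (fun x => w x - \sum_(i < 0) c i * p i x) = w.
    by apply/funext => x; rewrite big_ord0 subr0.
  by rewrite big_ord0 subr0.
have -> : (fun x => w x - \sum_(i < m.+1) c i * p i x) =
  (fun x => - c m * p m x + (w x - \sum_(i < m) c i * p i x)).
  by apply/funext => x; rewrite big_ord_recr/=; ring.
split; first exact: ptest_lin.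
by rewrite f_lin// IH2 big_ord_recr/=; ring.
Qed.

(** The extension applied to a dilate of [u] cuts at [2 ^+ J], the dilated partial sum at
    [2 ^+ J / e]. The annulus in between is at scale [2 ^- J] and is negligible by the estimates
    behind [Sd_uniform]. *)
Lemma vanishing_scale m l k h0 u : 0 < l -> 0 < k -> 0 < alpha + m.+1%:R -> 0 < h0 -> cls h0 u ->
  f (fun x => chi (2 ^+ J * l) (2 ^+ J * k) x * trem m u x) @[J --> \oo] --> (0 : R).
Proof.
move=> l0 k0 am h00 cu; have [a [b [a0 ab cc]]] := cut_chi l0 k0.
have [h [K [d [hh K0 d0 H]]]] := small_scale m h00 a0 ab cc.
have [r [d' [r0 r1 d'0 H']]] := rho_decay am.
have [su bu] := cu; have [N bN] := bu _ hh.
have N0 := bnd_ge0 M_gt0 (I : setT (0 : R)) bN.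
have dd0 : 0 < Num.min d d' by rewrite lt_min d0.
(* [small_scale] and [rho_decay] hold only near 0; the shift by [J0] starts there. *)
have [J0 HJ0] : exists J0, (2 ^+ J0)^-1 < Num.min d d'.
  have [J0 HJ0] := half_small 1 (divr_gt0 dd0 (ltr0Sn R 1)); exists J0.
  by rewrite -exprVn -[X in X < _]mul1r; apply: le_lt_trans HJ0 _; lra.
move: HJ0; rewrite lt_min => /andP[J0d J0d'].
rewrite -(cvg_shiftn J0); apply/cvgrPdist_le => eta eta0.
pose t0 : R := (2 ^+ J0)^-1; have t00 : 0 < t0 by rewrite invr_gt0.
pose q := r / 2 ^+ m.+1.
have q1 : `|q| < 1 by rewrite ger0_norm// divr_ge0// ltW.
have [n _ Hn] := (cvgrPdist_le _ _).1 (cvg_geometric (K * N * `|rho t0|) q1) _ eta0.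
exists n => // J nJ; have := Hn J nJ; rewrite !sub0r !normrN => HJ.
apply: le_trans HJ; apply: le_trans (ler_norm _); rewrite /geometric/=.
have tJ0 := two_gt0 (J + J0); pose t : R := (2 ^+ (J + J0))^-1.
have t_0 : 0 < t by rewrite invr_gt0.
have t1 : t <= 1 by rewrite invf_le1// exprn_ege1// ler1n.
have tE : t = t0 / 2 ^+ J by rewrite /t /t0 exprD invfM mulrC.
have tt0 : t <= t0.
  by rewrite tE ler_pdivrMr// ler_peMr ?(ltW t00)// exprn_ege1// ler1n.
have -> : f (fun x => chi (2 ^+ (J + J0) * l) (2 ^+ (J + J0) * k) x * trem m u x) =
    t * fdil f t (fun x => chi l k x * trem m u (t * x)).
  rewrite /fdil mulrA divff ?gt_eqF// mul1r; congr f; apply/funext => x.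
  rewrite mulrA divff ?gt_eqF// mul1r /t invrK /chi; congr ((theta _ - theta _) * _); ring.
rewrite normrM gtr0_norm//.
have td : 0 < t < d by rewrite t_0/= (le_lt_trans tt0).
have := H t t u N td (introT andP (conj t_0 t1)) cu bN => HH.
have [_ Hr] := H' t0 (introT andP (conj t00 J0d')) J; rewrite -tE in Hr.
rewrite -ler_pdivlMl//; apply: le_trans HH _.
have KN : 0 <= K * N * t ^+ m by rewrite !mulr_ge0// exprn_ge0// ltW.
apply: le_trans (ler_wpM2l KN Hr) _.
have rt0 : rho t0 <= `|rho t0| by exact: ler_norm.
have rJ : 0 <= r ^+ J by rewrite exprn_ge0// ltW.
apply: le_trans (ler_wpM2l KN (ler_wpM2l rJ rt0)) _.
have e1 : (2 ^+ m.+1) ^+ J = 2 ^+ J * (2 ^+ J) ^+ m :> R.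
  by rewrite -!exprM mulSn exprD (mulnC m).
have -> : q ^+ J = r ^+ J / (2 ^+ J * (2 ^+ J) ^+ m) by rewrite /q exprMn exprVn e1.
have -> : t ^+ m = t0 ^+ m / (2 ^+ J) ^+ m by rewrite tE exprMn; congr (_ * _); exact: exprVn.
have t01 : t0 <= 1 by rewrite invf_le1// exprn_ege1// ler1n.
set A := `|rho t0|; have A0 : 0 <= A by exact: normr_ge0.
have two0 := two_gt0 J; have twom : 0 < (2 ^+ J) ^+ m :> R by rewrite exprn_gt0.
set X := r ^+ J in rJ *.
have -> : t^-1 * (K * N * A * (X / (2 ^+ J * (2 ^+ J) ^+ m))) =
   t0^-1 * (K * N * A * X / (2 ^+ J) ^+ m).
  by rewrite tE; field; rewrite ?gt_eqF.
have -> : K * N * (t0 ^+ m / (2 ^+ J) ^+ m) * (X * A) =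
   t0 ^+ m * (K * N * A * X / (2 ^+ J) ^+ m) by ring.
apply: ler_wpM2r; first by rewrite divr_ge0 ?mulr_ge0// ltW.
apply: le_trans (_ : 1 <= t0^-1); last by rewrite invf_ge1.
by apply: exprn_ile1 => //; exact: ltW.
Qed.

(* The sum collects the difference between cutting off at scale [1] and at scale [e]. *)
Lemma fdil_extension m e u : 0 < alpha + m.+1%:R -> 0 < e -> wtest u ->
  fdil (extension m) e u = fdil f e (fun x => theta x * u x) + Sd_lim m e u
    - \sum_(i < m) derive1n i u 0 / i`!%:R * ((e^-1) ^+ i.+1 * moment i e).
Proof.
move=> am e0 wu; have ei : 0 < e^-1 by rewrite invr_gt0.
pose v x := u (e^-1 * x).
have wv : wtest v by exact: wtest_scale.
have [h0 [h00 cu cv]] := wtest2_cls wu wv.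
have su := cls_wtest cu.
have tv : trem m v = fun x => trem m u (e^-1 * x) by exact: trem_scale.
pose Y := f (fun x => chi e^-1 1 x * trem m v x).
(* The annulus from [2 ^+ J] to 1 is cut at [2 ^+ J / e] and at [1 / e]: a vanishing term, [e] times
   a partial sum at scale [e], and the term [Y] that carries the moments. *)
have decomp J : Sd m 1 J v = f (fun x => chi (2 ^+ J * 1) (2 ^+ J * e^-1) x * trem m v x)
    + (e * Sd m e J u + Y).
  have J1 : 0 < 2 ^+ J * 1 :> R by rewrite mulr1.
  have Je : 0 < 2 ^+ J * e^-1 by rewrite mulr_gt0.
  have -> : e * Sd m e J u = f (fun x => chi (2 ^+ J * e^-1) e^-1 x * trem m v x).
    rewrite /Sd /fdil mulrA divff ?gt_eqF// mul1r; congr f; apply/funext => x.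
    by rewrite tv /chi !mul1r mulrA.
  have p1 := chi_trem_ptest m h00 J1 Je cv.
  have p2 := chi_trem_ptest m h00 Je ei cv.
  have p3 := chi_trem_ptest m h00 ei ltr01 cv.
  rewrite /Y -[f (fun x => chi (2 ^+ J * e^-1) _ x * _)]mul1r -f_lin//.
  rewrite -[X in X + _]mul1r -f_lin//; last exact: ptest_lin.
  rewrite /Sd fdil1; congr f; apply/funext => x; rewrite /chi !mulr1; ring.
have lim1 : Sd_lim m 1 v = 0 + (e * Sd_lim m e u + Y).
  apply: (cvg_lim (@Rhausdorff R)); under eq_fun do rewrite decomp.
  apply: cvgD; first exact: (vanishing_scale ltr01 ei am h00 cv).
  apply: cvgD; last exact: cvg_cst.
  by apply: cvgMr; exact: (Sd_lim_cvg am e0 h00 cu).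
have YE : Y = f (fun x => chi e^-1 1 x * v x)
    - \sum_(i < m) (derive1n i u 0 / i`!%:R * (e^-1) ^+ i) * moment i e.
  have pcv := chi_ptest h00 ei ltr01 cv.
  have pp i : ptest (fun x => chi e^-1 1 x * x ^+ i) by exact: chi_pow_ptest.
  have [_ <-] := f_sub_sum m (fun i => derive1n i u 0 / i`!%:R * (e^-1) ^+ i) pcv pp.
  rewrite /Y; congr f; apply/funext => x; rewrite tv /trem mulrBr /taylor; congr (_ - _).
  by rewrite mulr_sumr; apply: eq_bigr => i _; rewrite exprMn; ring.
have tE : fdil f e (fun x => theta x * u x) =
    e^-1 * (f (fun x => theta x * v x) + f (fun x => chi e^-1 1 x * v x)).
  rewrite /fdil; congr (_ * _).
  rewrite -[X in X + _]mul1r -f_lin; [|exact: theta_ptest|exact: (chi_ptest h00 ei ltr01 cv)].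
  by congr f; apply/funext => x; rewrite /chi /v (mul1r x); ring.
have -> : fdil (extension m) e u = e^-1 * (f (fun x => theta x * v x) + Sd_lim m 1 v) by [].
rewrite lim1 YE tE.
have -> : \sum_(i < m) derive1n i u 0 / i`!%:R * ((e^-1) ^+ i.+1 * moment i e) =
  e^-1 * \sum_(i < m) derive1n i u 0 / i`!%:R * (e^-1) ^+ i * moment i e.
  by rewrite mulr_sumr; apply: eq_bigr => i _; rewrite exprS; ring.
set S := \sum_(i < m) _; rewrite add0r.
by field; rewrite gt_eqF.
Qed.

(** The partial sums approximate their limit uniformly relative to [rho e], so the limit in [e] may
    be taken term by term; [V] is the result of letting [J] grow afterwards. *)
Lemma extension_main_limit m u (V : R) : 0 < alpha + m.+1%:R -> wtest u ->
  Ilim (fun x => chi (2 ^+ J) 1 x * trem m u x) @[J --> \oo] --> V ->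
  (fdil f e (fun x => theta x * u x) + Sd_lim m e u) / rho e @[e --> 0^'+] -->
  Ilim (fun x => theta x * u x) + V.
Proof.
move=> am wu HV; have [h0 [h00 cu]] := wtest_cls wu.
under eq_fun do rewrite mulrDl.
apply: cvgD; first by apply: f_quasi; exact: theta_ptest.
have [h [K [q [d [hh K0 q01 d0 H]]]]] := Sd_lim_bound h00 am.
have [_ /(_ _ hh)[N bN]] := cu.
have /near0P[d' d'0 H'] := rho_gt0.
apply: (@cvg_uniform_approx _ _ (fun J e => Sd m e J u / rho e)
  (fun J => Ilim (fun x => chi (2 ^+ J) 1 x * trem m u x)) _ (K * N) q (Num.min d d')) => //.
- by rewrite lt_min d0.
- by move=> J; apply: f_quasi; exact: (chi_trem_ptest m h00).
move=> e J /andP[e0]; rewrite lt_min => /andP[ed ed'].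
have [_ /(_ J) HJ] := H e u N (introT andP (conj e0 ed)) cu bN.
have r0 : 0 < rho e by apply: H'; rewrite e0.
rewrite -mulrBl normrM normfV (gtr0_norm r0) ler_pdivrMr//.
by apply: le_trans HJ _; rewrite mulrAC.
Qed.

(** By telescoping, the difference is [f] on a single annulus at scale [e]: a dilate of [f] on one
    fixed test of the half line, where the hypothesis applies. *)
Lemma moment_increment i a : 0 < a ->
  (moment i (a * e) - moment i e) / (e ^+ i.+1 * rho e) @[e --> 0^'+] -->
  Ilim (fun x => chi a^-1 1 x * x ^+ i).
Proof.
move=> a0; have ai : 0 < a^-1 by rewrite invr_gt0.
have pq := chi_pow_ptest i ai ltr01.
apply: cvg_trans (f_quasi pq); apply: near_eq_cvg; near=> e.
have e0 : 0 < e by [].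
have ei : 0 < e^-1 by rewrite invr_gt0.
have -> : moment i (a * e) - moment i e = e ^+ i.+1 * fdil f e (fun x => chi a^-1 1 x * x ^+ i).
  have -> : e ^+ i.+1 * fdil f e (fun x => chi a^-1 1 x * x ^+ i) =
      e ^+ i * f (fun x => chi (a^-1 * e^-1) e^-1 x * (e^-1 * x) ^+ i).
    rewrite /fdil exprSr mulrA mulfK ?gt_eqF//; congr (_ * f _); apply/funext => x.
    by rewrite /chi mul1r mulrA.
  have p1 := chi_pow_ptest i (mulr_gt0 ai ei) ei.
  have -> : moment i (a * e) = 1 * f (fun x => chi (a^-1 * e^-1) e^-1 x * x ^+ i) + moment i e.
    rewrite /moment -f_lin//; last exact: chi_pow_ptest.
    by congr f; apply/funext => x; rewrite invfM /chi; ring.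
  rewrite addrK mul1r.
  have -> : (fun x => chi (a^-1 * e^-1) e^-1 x * (e^-1 * x) ^+ i) =
     (fun x => (e^-1) ^+ i * (chi (a^-1 * e^-1) e^-1 x * x ^+ i)).
    by apply/funext => x; rewrite exprMn; ring.
  by rewrite f_scale// mulrA -exprMn divff ?gt_eqF// expr1n mul1r.
by rewrite invfM mulrACA divff ?mul1r// gt_eqF// exprn_gt0.
Unshelve. all: by end_near. Qed.

(** Increments compare moments only with one another; this gives the starting bound on a dyadic
    window, where the cutoffs share one support and one set of bounds. *)
Lemma moment_bounded i dl : 0 < dl -> exists B, forall e, dl <= e <= 2 * dl -> `|moment i e| <= B.
Proof.
move=> dl0; pose a := Num.min dl 1; pose b := 2 * Num.max (2 * dl) 1.
have a0 : 0 < a by rewrite lt_min dl0 ltr01.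
have ab : a <= b.
  have : a <= 1 by rewrite ge_min lexx orbT.
  have : 1 <= Num.max (2 * dl) 1 by rewrite le_max lexx orbT.
  by rewrite /b; move: (Num.max _ _) => B; lra.
have [h [C [hh C0 H]]] := f_dom b a0 (ltr0Sn R 1).
have h0 := hset_gt0 (ltr0Sn R 1) hh.
have h20 : 0 < h / 2 by rewrite divr_gt0.
have [N bN] := bnd_pow M_gt0 a b i h20.
have [N1 bN1] := bnd_theta h20.
(* Dilation by [e^-1 <= dl^-1] multiplies the parameter by at most [dl^-1], which the factor [dl]
   compensates. *)
have [N2 bN2] := bnd_theta (mulr_gt0 dl0 h20).
have N10 := bnd_ge0 M_gt0 (I : setT (0 : R)) bN1.
have N20 := bnd_ge0 M_gt0 (I : setT (0 : R)) bN2.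
exists (C * (M 0%N * ((`|-1| * N1 + N2) * N))) => e /andP[de e2].
have e0 : 0 < e by apply: lt_le_trans de.
have ei : 0 < e^-1 by rewrite invr_gt0.
have cc : cut M a b (chi e^-1 1).
  apply: (cut_mono _ _ (cut_chi_explicit ei ltr01)); rewrite invrK invr1.
    by rewrite le_min !ge_min de lexx orbT.
  by rewrite /b ler_pM2l// ge_max !le_max e2 lexx orbT.
apply: H; first by apply: cut_rt => //; exact: (cut_pow M_gt0 M_logconvex i ab cc).
have [sc c0 _] := cc.
have bc : bnd M (h / 2) (`|-1| * N1 + N2) setT (chi e^-1 1).
  have ce : chi e^-1 1 = fun x => -1 * theta x + theta (e^-1 * x).
    by apply/funext => x; rewrite /chi mul1r; ring.
  rewrite ce; apply: bnd_lin => //; first exact: (@smooth_scale _ _ smooth_theta).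
  have eh : e^-1 * (dl * (h / 2)) <= h / 2.
    by rewrite mulrA ler_piMl ?(ltW h20)// mulrC ler_pdivrMr// mul1r.
  apply: (bnd_mono M_gt0 _ eh (lexx N2) N20 (@subset_refl _ setT) (bnd_scale smooth_theta ei bN2)).
  by rewrite !mulr_gt0.
have <- : h / 2 + h / 2 = h by lra.
exact: (bnd_mul_local M_gt0 M_logconvex ab h20 h20 sc (@smooth_pow R i) c0 bc bN).
Qed.

End Extension.

(** * Regular variation *)

Section Stolz.
Context {R : realType}.
Implicit Types (P W : R -> R).

Lemma dyadic_scale (dl e : R) : 0 < e -> e <= dl ->
  exists n, dl <= 2 ^+ n * e <= 2 * dl.
Proof.
move=> e0 ed.
have ex : exists n, dl <= 2 ^+ n * e.
  have [n Hn] := half_small dl e0; exists n.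
  by rewrite mulrC -ler_pdivrMr ?exprn_gt0// -exprVn.
case: (ex_minnP ex) => -[|n] Hn Hmin.
  by exists 0%N; rewrite Hn/= expr0 mul1r; lra.
exists n.+1; rewrite Hn/= exprS -mulrA ler_pM2l//.
by apply: ltW; rewrite ltNge; apply/negP => /Hmin; rewrite ltnn.
Qed.

(* Regular variation of negative index, with the local bounds that hold for
   measurable functions. *)
Definition decays P (tau : R) := [/\ 0 < tau < 1, P (2 * e) / P e @[e --> 0^'+] --> tau &
  exists2 d : R, 0 < d & forall dl, 0 < dl < d -> exists b B, 0 < b /\
    forall e, dl <= e <= 2 * dl -> b <= P e <= B].

Lemma decays_step P tau : decays P tau -> exists q d, [/\ 0 < q < 1, 0 < d &
  forall e, 0 < e < d -> 0 < P e /\ P (2 * e) <= q * P e].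
Proof.
move=> [/andP[t0 t1] Plim [d d0 Hd]].
pose q := (tau + 1) / 2.
have qt : 0 < q - tau by rewrite /q; lra.
have : \forall e \near 0^'+, `|tau - P (2 * e) / P e| <= q - tau.
  exact: (cvgrPdist_le _ _).1 Plim _ qt.
move=> /near0P[d1 d10 H1].
exists q, (Num.min d d1); split; [by rewrite /q; lra | by rewrite lt_min d0 |].
move=> e /andP[e0]; rewrite lt_min => /andP[ed ed1].
have Pe : 0 < P e.
  have [|b [B [b0 /(_ e)]]] := Hd e; first by rewrite e0.
  by rewrite lexx ler_peMl ?(ltW e0)// ?ler1n// => /(_ isT)/andP[be _]; exact: lt_le_trans be.
split=> //; have := H1 e; rewrite e0 ed1 => /(_ isT).
rewrite ler_norml => /andP[H _]; rewrite -ler_pdivrMr//.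
by move: (P (2 * e) / P e) H => X; lra.
Qed.

(** The lower bound [b] on one dyadic window is carried down to [e] by [n] halvings as
    [b <= q ^+ n * P e], and [n] grows as [e] tends to 0. *)
Lemma decays_infty P tau : decays P tau -> forall C, \forall e \near 0^'+, C <= P e.
Proof.
move=> dP C; have [q [d [/andP[q0 q1] d0 Hq]]] := decays_step dP.
have [_ _ [d1 d10 Hd1]] := dP.
pose dl := Num.min d d1 / 4.
have m0 : 0 < Num.min d d1 by rewrite lt_min d0.
have mld : Num.min d d1 <= d by rewrite ge_min lexx.
have mld1 : Num.min d d1 <= d1 by rewrite ge_min lexx orbT.
have dl0 : 0 < dl by rewrite divr_gt0.
have [|b [B [b0 Hb]]] := Hd1 dl; first by rewrite dl0/= /dl; lra.
have key n e : 0 < e -> dl <= 2 ^+ n * e <= 2 * dl -> b <= q ^+ n * P e.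
  elim: n e => [|n IH] e e0; first by rewrite !expr0 !mul1r => /Hb/andP[].
  rewrite exprSr -mulrA => H; have e20 : 0 < 2 * e by rewrite mulr_gt0.
  apply: le_trans (IH _ e20 H) _; rewrite exprSr -mulrA; apply: ler_wpM2l.
    by rewrite exprn_ge0// ltW.
  apply: (proj2 (Hq e _)); rewrite e0/=.
  have : 2 * e <= 2 * dl.
    apply: le_trans (_ : 2 ^+ n * (2 * e) <= _); last by case/andP: H.
    by rewrite ler_peMl ?(ltW e20)// exprn_ege1// ler1n.
  by rewrite /dl; lra.
have q1' : `|q| < 1 by rewrite gtr0_norm.
have C1 : 0 < `|C| + 1 by apply: ltr_wpDl.
have [n0 _ Hn0] := (cvgrPdist_le _ _).1 (cvg_geometric (1 : R) q1') _ (divr_gt0 b0 C1).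
apply/near0P; exists (dl / 2 ^+ n0); first by rewrite divr_gt0// exprn_gt0.
move=> e /andP[e0 en].
have ed : e <= dl.
  apply: le_trans (ltW en) _; rewrite ler_pdivrMr ?exprn_gt0// ler_peMr ?(ltW dl0)//.
  by rewrite exprn_ege1// ler1n.
have [n Hn] := dyadic_scale e0 ed.
have nn : (n0 <= n)%N.
  rewrite leqNgt; apply/negP => nlt.
  have /andP[H _] := Hn; move: en; rewrite ltNge => /negP; apply.
  rewrite ler_pdivrMr ?exprn_gt0//; apply: le_trans H _; rewrite mulrC ler_pM2l//.
  by rewrite ler_weXn2l ?ler1n// ltnW.
have Hb1 := key n e e0 Hn; have := Hn0 n nn.
rewrite /geometric/= mul1r sub0r normrN gtr0_norm ?exprn_gt0// => Hq1.
have Pe : 0 < P e.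
  by rewrite -(pmulr_rgt0 _ (exprn_gt0 n q0)); exact: lt_le_trans Hb1.
have : b <= b / (`|C| + 1) * P e by apply: le_trans Hb1 _; rewrite ler_pM2r.
rewrite mulrAC ler_pdivlMr// ler_pM2l//; have := ler_norm C.
by move: `|C| (P e) => x y; lra.
Qed.

(* [W - l / (tau - 1) * P] has increments [o(P)], and the values of [P] on a dyadic
   sequence are dominated by a geometric series. *)
Lemma stolz P W (tau l : R) : decays P tau ->
  (W (2 * e) - W e) / P e @[e --> 0^'+] --> l ->
  (forall dl, 0 < dl -> exists B, forall e, dl <= e <= 2 * dl -> `|W e| <= B) ->
  W e / P e @[e --> 0^'+] --> l / (tau - 1).
Proof.
move=> dP Wl Wb; have [/andP[t0 t1] Plim [d1 d10 Hd1]] := dP.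
have [q [d [/andP[q0 q1] d0 Hq]]] := decays_step dP.
pose A := l / (tau - 1); pose D e := W e - A * P e.
have Dl : (D (2 * e) - D e) / P e @[e --> 0^'+] --> (0 : R).
  have H : (W (2 * e) - W e) / P e - A * (P (2 * e) / P e - 1) @[e --> 0^'+] --> l - A * (tau - 1).
    apply: cvgB; first exact: Wl.
    by apply: cvgMr; apply: cvgB; [exact: Plim | exact: cvg_cst].
  have e0 : l - A * (tau - 1) = 0 by rewrite /A divfK ?subrr//; lra.
  rewrite e0 in H; apply: cvg_trans H; apply: near_eq_cvg.
  apply/near0P; exists d => // e ed; have [Pe _] := Hq e ed.
  by rewrite /D; field; rewrite gt_eqF.
apply/cvgrPdist_le => eta eta0.
(* Chosen so that [eps * P + eta / 2 * (q * P) = eta / 2 * P]: the bound by [eta / 2 * P] reproduces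
   itself in the induction [key]. *)
pose eps := eta / 2 * (1 - q).
have q1' : 0 < 1 - q by lra.
have eps0 : 0 < eps by rewrite !mulr_gt0// invr_gt0.
have : \forall e \near 0^'+, `|0 - (D (2 * e) - D e) / P e| <= eps.
  exact: (cvgrPdist_le _ _).1 Dl _ eps0.
move=> /near0P[d2 d20 H2].
pose mn := Num.min d (Num.min d1 d2).
have m0 : 0 < mn by rewrite !lt_min d0 d10.
have m1 : mn <= d by rewrite !ge_min lexx.
have m2 : mn <= d1 by rewrite !ge_min lexx orbT.
have m3 : mn <= d2 by rewrite !ge_min lexx !orbT.
pose dl := mn / 4; have dl0 : 0 < dl by rewrite divr_gt0.
have dlmn : 2 * dl < mn by rewrite /dl; lra.
have [|b [B [b0 Hb]]] := Hd1 dl; first by rewrite dl0/=; lra.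
have [B2 HB2] := Wb dl dl0.
pose B3 := B2 + `|A| * B.
have D3 e : dl <= e <= 2 * dl -> `|D e| <= B3.
  move=> ee; apply: le_trans (ler_normB _ _) _; apply: lerD; first exact: HB2.
  have /andP[Pb PB] := Hb e ee; rewrite normrM; apply: ler_wpM2l => //.
  by rewrite ger0_norm//; lra.
have key n e : 0 < e -> dl <= 2 ^+ n * e <= 2 * dl -> `|D e| <= eta / 2 * P e + B3.
  elim: n e => [|n IH] e e0 => [|H].
    rewrite expr0 mul1r => H; apply: le_trans (D3 _ H) _; rewrite lerDr.
    have /andP[+ _] := Hb e H => ?; apply: mulr_ge0; lra.
  have e20 : 0 < 2 * e by rewrite mulr_gt0.
  rewrite exprSr -mulrA in H.
  have e2 : 2 * e <= 2 * dl.
    apply: le_trans (_ : 2 ^+ n * (2 * e) <= _); last by case/andP: H.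
    by rewrite ler_peMl ?(ltW e20)// exprn_ege1// ler1n.
  have [|Pe P2] := Hq e; first by rewrite e0/=; lra.
  have := H2 e; rewrite e0 (_ : e < d2); last lra.
  move=> /(_ isT); rewrite sub0r normrN normrM normfV (gtr0_norm Pe) ler_pdivrMr// => HD.
  have HI := IH _ e20 H.
  have : `|D e| <= `|D (2 * e)| + `|D (2 * e) - D e|.
    have {1}-> : D e = D (2 * e) - (D (2 * e) - D e) by ring.
    exact: ler_normB.
  have : eta / 2 * P (2 * e) <= eta / 2 * (q * P e) by rewrite ler_pM2l// divr_gt0.
  have : eps * P e = eta / 2 * P e - eta / 2 * (q * P e) by rewrite /eps; ring.
  move: HD HI; move: (eta / 2 * P e) (eta / 2 * (q * P e)) (eta / 2 * P (2 * e)) (eps * P e).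
  move: (`|D e|) (`|D (2 * e)|) (`|D (2 * e) - D e|) => *; lra.
have /near0P[d3 d30 H3] := decays_infty dP (B3 / (eta / 2)).
apply/near0P; exists (Num.min dl d3); first by rewrite lt_min dl0.
move=> e /andP[e0]; rewrite lt_min => /andP[edl ed3].
have [n Hn] := dyadic_scale e0 (ltW edl).
have HD := key n e e0 Hn.
have [|Pe _] := Hq e; first by rewrite e0/=; lra.
have := H3 e; rewrite e0 ed3 => /(_ isT).
rewrite ler_pdivrMr ?divr_gt0// => HP.
have -> : A - W e / P e = - (D e / P e) by rewrite /D; field; rewrite gt_eqF.
rewrite normrN normrM normfV (gtr0_norm Pe) ler_pdivrMr//; apply: le_trans HD _.
rewrite [P e * _]mulrC in HP.
by have -> : eta * P e = eta / 2 * P e + eta / 2 * P e by [lra]; rewrite lerD2l.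
Qed.

End Stolz.

Section RegularVariation.
Context {R : realType} (L : R -> R) (alpha : R).
Context (sL : slowly_varying_at_origin L).
Let rho e := e `^ alpha * L e.

Lemma sv_positive : \forall e \near 0^'+, 0 < L e.
Proof.
have [_ [X [Xr HX]] _] := sL.
have X1 : 0 < `|X| + 1 by apply: ltr_wpDl.
apply/near0P; exists (`|X| + 1)^-1; first by rewrite invr_gt0.
move=> e /andP[e0 eX]; have := HX e^-1; rewrite invrK; apply.
rewrite -[e]invrK ltf_pV2 ?posrE ?invr_gt0// in eX.
by have := ler_norm X; lra.
Qed.

Lemma sv_ratio t : 0 < t -> L (t * e) / L e @[e --> 0^'+] --> (1 : R).
Proof.
move=> t0; have ti : 0 < t^-1 by rewrite invr_gt0.
have [_ _ /(_ _ ti) H] := sL.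
have cvi : (e^-1 : R) @[e --> 0^'+] --> +oo.
  apply/cvgryPge => A; have A1 : 0 < `|A| + 1 by apply: ltr_wpDl.
  apply/near0P; exists (`|A| + 1)^-1; first by rewrite invr_gt0.
  move=> e /andP[e0]; rewrite -[X in X < _]invrK ltf_pV2 ?posrE ?invr_gt0//.
  by have := ler_norm A; move: `|A| e^-1 => x y; lra.
have := cvg_comp _ _ cvi H; apply: cvg_trans; apply: near_eq_cvg; near=> e.
by rewrite /= invfM !invrK.
Unshelve. all: by end_near. Qed.

Lemma rv_positive : \forall e \near 0^'+, 0 < rho e.
Proof.
have /near0P[d d0 H] := sv_positive; apply/near0P; exists d => // e ed.
by rewrite mulr_gt0 ?H// powR_gt0//; case/andP: ed.
Qed.

Lemma rv_ratio t : 0 < t -> rho (t * e) / rho e @[e --> 0^'+] --> t `^ alpha.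
Proof.
move=> t0; have H : t `^ alpha * (L (t * e) / L e) @[e --> 0^'+] --> t `^ alpha * 1.
  by apply: cvgMr; exact: sv_ratio.
rewrite mulr1 in H; apply: cvg_trans H; apply: near_eq_cvg; near=> e.
have e0 : 0 < e by [].
rewrite /rho powRM ?(ltW t0) ?(ltW e0)// invfM.
have ea : e `^ alpha != 0 by rewrite gt_eqF// powR_gt0.
set E := e `^ alpha in ea *; set T := t `^ alpha.
have -> : T * E * L (t * e) * (E^-1 * (L e)^-1) = T * (L (t * e) * (L e)^-1) * (E * E^-1) by ring.
by rewrite divff// mulr1.
Unshelve. all: by end_near. Qed.

Lemma rv_decays i : alpha + i.+1%:R < 0 ->
  decays (fun e => e ^+ i.+1 * rho e) (2 `^ (alpha + i.+1%:R)).
Proof.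
move=> ai; have t0 : 0 < 2 `^ (alpha + i.+1%:R) :> R by rewrite powR_gt0.
split.
- rewrite t0/=; have : (1 : R) `^ (- (alpha + i.+1%:R)) < 2 `^ (- (alpha + i.+1%:R)).
    by apply: gt0_ltr_powR; rewrite ?oppr_gt0// ?nnegrE// ltr1n.
  by rewrite powR1 powRN invf_gt1.
- have two0 : 0 < 2 :> R by [].
  have H : 2 ^+ i.+1 * (rho (2 * e) / rho e) @[e --> 0^'+] --> 2 ^+ i.+1 * 2 `^ alpha.
    by apply: cvgMr; exact: rv_ratio.
  have -> : 2 `^ (alpha + i.+1%:R) = 2 ^+ i.+1 * 2 `^ alpha :> R.
    by rewrite powRD ?powR_mulrn ?pnatr_eq0 ?implybT// mulrC.
  apply: cvg_trans H; apply: near_eq_cvg; near=> e.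
  have e0 : 0 < e by [].
  have ee : e ^+ i.+1 != 0 by rewrite gt_eqF// exprn_gt0.
  rewrite /= exprMn [in RHS]invfM.
set E := e ^+ i.+1 in ee *; set T := 2 ^+ i.+1.
  have -> : T * E * rho (2 * e) * (E^-1 * (rho e)^-1) = T * (rho (2 * e) * (rho e)^-1) * (E * E^-1).
    by ring.
  by rewrite divff// mulr1.
have [X X0 HX] := slowly_varying_bounded sL.
(* [slowly_varying_bounded] concerns the inverse argument: below this threshold [(2 * dl)^-1] is at
   least [X], and [e] in [[dl, 2 * dl]] corresponds to the factor [2 * dl / e] in [[1, 2]]. *)
exists (2 * X)^-1; first by rewrite invr_gt0 mulr_gt0.
move=> dl /andP[dl0 dlX].
have d20 : 0 < 2 * dl by rewrite mulr_gt0.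
have dX : X <= (2 * dl)^-1.
  rewrite -[X]invrK lef_pV2 ?posrE ?invr_gt0//.
  by move: dlX; rewrite invfM; move: (X^-1) => y; lra.
have H12 : 1 <= (1 : R) <= 2 by rewrite lexx ler1n.
have [L0 _ _] := HX _ 1 dX H12; rewrite invrK in L0.
pose sg := alpha + i.+1%:R.
have PE e : 0 < e -> e ^+ i.+1 * rho e = e `^ sg * L e.
  move=> e0; rewrite /rho mulrA -powR_mulrn ?(ltW e0)// mulrC -powRD ?(gt_eqF e0) ?implybT//.
  by rewrite /sg addrC mulrC.
have mono x y : 0 < x -> x <= y -> y `^ sg <= x `^ sg.
  move=> x0 xy; have y0 : 0 < y by exact: lt_le_trans xy.
  have : x `^ (- sg) <= y `^ (- sg).
    by apply: ge0_ler_powR; rewrite ?nnegrE ?oppr_ge0 ?(ltW ai) ?(ltW x0) ?(ltW y0).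
  by rewrite !powRN lef_pV2// posrE powR_gt0.
exists ((2 * dl) `^ sg * (L (2 * dl) / 4)), (dl `^ sg * (4 * L (2 * dl))).
split; first by rewrite mulr_gt0 ?powR_gt0 ?divr_gt0.
move=> e /andP[de e2]; have e0 : 0 < e by exact: lt_le_trans de.
have te : 1 <= 2 * dl / e <= 2.
  by rewrite ler_pdivlMr// mul1r e2/= ler_pdivrMr// ler_pM2l.
have [_ H1 H2] := HX _ _ dX te.
have ee : ((2 * dl)^-1 * (2 * dl / e))^-1 = e by rewrite mulKf ?gt_eqF// invrK.
rewrite ee invrK in H1 H2; rewrite PE//; apply/andP; split.
  by apply: ler_pM; [exact: powR_ge0 | by rewrite divr_ge0 ?(ltW L0) | exact: mono | lra].
apply: ler_pM; [exact: powR_ge0 | | exact: mono | exact: H2].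
by have := L0; lra.
Unshelve. all: by end_near. Qed.

End RegularVariation.

(** * Finite parts of power integrals *)

Section Integrals.
Context {R : realType}.
Local Notation mu := (@lebesgue_measure R).
Implicit Types (f g G : R -> R) (a b : R).

Definition ci a b g := (\int[mu]_(x in `[a, b]) g x)%R.
Definition cont_pos g := forall x : R, 0 < x -> {for x, continuous g}.

Lemma is_derive_continuous (x l : R) g : is_derive x (1 : R) g l -> {for x, continuous g}.
Proof.
move=> dg; apply: differentiable_continuous; apply/derivable1_diffP.
exact: (@ex_derive _ _ _ _ _ _ _ dg).
Qed.

Lemma cont_pos_within a b g : 0 < a -> cont_pos g -> {within `[a, b], continuous g}.
Proof.
move=> a0 cg; apply: continuous_in_subspaceT => x; rewrite inE/= in_itv/= => /andP[ax _].
by apply: cg; exact: lt_le_trans ax.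
Qed.

Lemma ci_integrable a b g : 0 < a -> cont_pos g -> mu.-integrable `[a, b] (EFin \o g).
Proof.
move=> a0 cg; apply: continuous_compact_integrable; first exact: segment_compact.
exact: cont_pos_within.
Qed.

Lemma ci_FTC a b g G : 0 < a -> a <= b -> cont_pos g ->
  (forall x : R, 0 < x -> is_derive x (1 : R) G (g x)) -> ci a b g = G b - G a.
Proof.
move=> a0; rewrite le_eqVlt => /orP[/eqP <- _ _|ab cg dG].
  by rewrite /ci set_itv1 Rintegral_set1 subrr.
rewrite /ci /Rintegral (@continuous_FTC2 _ g G)//.
- exact: cont_pos_within.
- split.
  + move=> x; rewrite in_itv/= => /andP[ax _].
    by apply: (@ex_derive _ _ _ _ _ _ _ (dG x _)); exact: lt_trans ax.
  + by apply: cvg_at_right_filter; exact: (is_derive_continuous (dG _ a0)).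
  + by apply: cvg_at_left_filter; exact: (is_derive_continuous (dG _ (lt_trans a0 ab))).
- move=> x; rewrite in_itv/= => /andP[ax _]; rewrite derive1E.
  by apply: (@derive_val _ _ _ _ _ _ _ (dG x _)); exact: lt_trans ax.
Qed.

Lemma ci_lin a b c f g : 0 < a -> cont_pos f -> cont_pos g ->
  ci a b (fun x => c * f x + g x) = c * ci a b f + ci a b g.
Proof.
move=> a0 cf cg; rewrite /ci.
have ccf : cont_pos (fun x => c * f x) by move=> x x0; apply: cvgMr; exact: cf.
rewrite RintegralD//; [|exact: (ci_integrable _ a0 ccf)|exact: (ci_integrable _ a0 cg)].
by rewrite RintegralZl//; exact: ci_integrable.
Qed.

Lemma ci_eq a b f g : (forall x, a <= x <= b -> f x = g x) -> ci a b f = ci a b g.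
Proof. by move=> fg; apply: eq_Rintegral => x; rewrite inE/= in_itv/=; exact: fg. Qed.

Lemma ci_split m a b g : 0 < a -> a <= m -> m <= b -> cont_pos g ->
  ci a b g = ci a m g + ci m b g.
Proof.
move=> a0 am mb cg; rewrite /ci.
have ig : mu.-integrable `[a, b] (EFin \o g) by exact: ci_integrable.
have := Rintegral_itvB ig (x := m); rewrite !bnd_simp => /(_ am mb) H.
have -> : (\int[mu]_(x in `[m, b]) g x)%R = (\int[mu]_(x in `]m, b]) g x)%R.
  rewrite -Rintegral_itv_obnd_cbnd//; apply: integrableS ig => //.
  by apply: subset_itvr; rewrite bnd_simp.
by rewrite -H addrC subrK.
Qed.

Lemma ci_zero a b g : (forall x, a <= x <= b -> g x = 0) -> ci a b g = 0.
Proof.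
move=> g0; rewrite (@ci_eq a b g (fun=> 0))//.
by rewrite /ci /Rintegral integral0.
Qed.

Lemma integral_pos_ci a b g : 0 < a -> (forall x, ~~ (a <= x <= b) -> g x = 0) ->
  (\int[mu]_(x in `]0, +oo[) g x)%R = ci a b g.
Proof.
move=> a0 g0; rewrite /ci Rintegral_mkcond [RHS]Rintegral_mkcond; congr Rintegral.
apply/funext => x; rewrite /patch !mem_setE !in_itv/= andbT.
have [xab|xab] := boolP (a <= x <= b).
  by rewrite (lt_le_trans a0)//; case/andP: xab.
by rewrite g0//; case: ifP.
Qed.

Lemma integral_pos1_ci b g : mu.-integrable `[1, b] (EFin \o g) -> (forall x, b < x -> g x = 0) ->
  (\int[mu]_(x in `]1, +oo[) g x)%R = ci 1 b g.
Proof.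
move=> ig g0; rewrite /ci -Rintegral_itv_obnd_cbnd//; last first.
  by apply: integrableS ig => //; apply: subset_itvr; rewrite bnd_simp.
rewrite Rintegral_mkcond [RHS]Rintegral_mkcond; congr Rintegral.
apply/funext => x; rewrite /patch !mem_setE !in_itv/= andbT.
by case: (ltP 1 x) => //= x1; case: leP => // bx; rewrite g0.
Qed.

Lemma powR_cont_pos (al : R) : cont_pos (fun x => x `^ al).
Proof. by move=> x x0; exact: (is_derive_continuous (is_derive1_powR al x0)). Qed.

Lemma is_derive_powR_prim (be x : R) : be != -1 -> 0 < x ->
  is_derive x (1 : R) (fun y => y `^ (be + 1) / (be + 1)) (x `^ be).
Proof.
move=> b1 x0; have b0 : be + 1 != 0 by rewrite addr_eq0.
have := @is_deriveZ _ _ _ _ (be + 1)^-1 x 1 _ (is_derive1_powR (be + 1) x0).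
rewrite /GRing.scale/= addrK mulKf// => H.
by have -> : (fun y => y `^ (be + 1) / (be + 1)) = (be + 1)^-1 \*: (fun y => y `^ (be + 1)) by apply/funext => y; rewrite /GRing.scale/= mulrC.
Qed.

(** The fundamental theorem applies on the compact intervals [[eta / n.+1, eta]], and monotone
    convergence passes to their union. *)
Lemma power_integral (eta be : R) : -1 < be -> 0 < eta ->
  (\int[mu]_(x in `]0%R, eta]) (x `^ be)%:E <= (eta `^ (be + 1) / (be + 1))%:E)%E.
Proof.
move=> b1 e0; have bb : 0 < be + 1 by lra.
pose F n : set (measurableTypeR R) := `[eta / n.+1%:R, eta]%classic.
have un : \bigcup_n F n = `]0, eta]%classic.
  apply/seteqP; split => [x [n _]|x]; rewrite /F /= !in_itv/= => /andP[x1 x2].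
    by rewrite x2 andbT; apply: lt_le_trans x1; rewrite divr_gt0.
  have [n] := ltr_add_invr (divr_gt0 x1 e0); rewrite add0r => Hn.
  exists n => //; rewrite /= in_itv/= x2 andbT; apply: ltW.
  by rewrite mulrC -ltr_pdivlMr.
have mF n : measurable (F n) by exact: measurable_itv.
have nd : nondecreasing_seq F.
  move=> n m nm; apply/subsetPset; apply: subset_itvr; rewrite bnd_simp ler_pM2l//.
  by rewrite lef_pV2 ?posrE// ler_nat.
have f0 n x : F n x -> (0 <= (x `^ be)%:E)%E by rewrite lee_fin powR_ge0.
have mp : measurable_fun (setT : set (measurableTypeR R)) (fun x : R => x `^ be).
  exact: measurable_powR.
have mf n : measurable_fun (F n) (EFin \o (fun x : R => x `^ be)).
  by apply/measurable_EFinP; exact: (measurable_funS measurableT (@subsetT _ (F n)) mp).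
have cv := @ge0_nondecreasing_set_cvg_integral _ _ _ F (fun x : R => (x `^ be)%:E) mu nd mF mf f0.
rewrite un in cv; rewrite -(cvg_lim _ cv)//; apply: lime_le; first by apply/cvg_ex; eexists; exact: cv.
near=> n.
have en : 0 < eta / n.+1%:R by rewrite divr_gt0.
have ene : eta / n.+1%:R <= eta by rewrite ler_pdivrMr// ler_peMr ?(ltW e0)// ler1n.
have ig := ci_integrable eta en (@powR_cont_pos be).
have -> : (\int[mu]_(x in F n) (x `^ be)%:E)%E = (ci (eta / n.+1%:R) eta (fun x => x `^ be))%:E.
  by rewrite /ci /Rintegral fineK//; exact: integrable_fin_num.
have dp (x : R) : 0 < x -> is_derive x (1 : R) (fun y => y `^ (be + 1) / (be + 1)) (x `^ be).
  by move=> x0; apply: is_derive_powR_prim => //; rewrite gt_eqF.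
rewrite (ci_FTC en ene (@powR_cont_pos be) dp).
by rewrite lee_fin lerBlDr lerDl divr_ge0// ?powR_ge0// ltW.
Unshelve. all: by end_near. Qed.

Lemma power_integrable (b be C : R) : -1 < be -> 0 < b ->
  mu.-integrable `]0%R, b] (EFin \o (fun x => C * x `^ be)).
Proof.
move=> b1 b0.
have mp : measurable_fun (setT : set (measurableTypeR R)) (fun x : R => x `^ be).
  exact: measurable_powR.
suff : mu.-integrable `]0%R, b] (EFin \o (fun x => x `^ be)).
  by move=> /(@integrableZl _ _ _ mu _ (measurable_itv _) C); apply.
apply/integrableP; split.
  by apply/measurable_EFinP; exact: (measurable_funS measurableT (@subsetT _ _) mp).
under eq_integral do rewrite gee0_abs ?lee_fin ?powR_ge0//.
by apply: le_lt_trans (power_integral b1 b0) _; exact: ltry.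
Qed.

Lemma singular_integrable (b C be : R) g : -1 < be -> 0 < b -> 0 <= C -> cont_pos g ->
  (forall x, 0 < x -> x <= b -> `|g x| <= C * x `^ be) ->
  mu.-integrable `]0%R, b] (EFin \o g).
Proof.
move=> b1 b0 C0 cg gC.
have mg : measurable_fun (`]0%R, b]%classic : set (measurableTypeR R)) g.
  apply: (@measurable_funS _ _ _ _ (`]0, +oo[%classic : set (measurableTypeR R))) => //.
    by apply: subset_itvl; rewrite bnd_simp.
  apply: open_continuous_measurable_fun; first exact: interval_open.
  by move=> x; rewrite inE/= in_itv/= andbT; exact: cg.
apply: (@le_integrable _ _ _ mu _ _ _ (EFin \o (fun x => C * x `^ be))) => //.
- exact/measurable_EFinP.
- move=> x; rewrite /= in_itv/= => /andP[x0 x1]; rewrite lee_fin.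
  by rewrite [X in _ <= X]ger0_norm ?gC// mulr_ge0// powR_ge0.
- exact: power_integrable.
Qed.

(** A rate for the improper integral at 0, used both to remove the dyadic cutoffs and to discard
    boundary terms at 0. *)
Lemma singular_integral (C be : R) g : -1 < be -> 0 <= C -> cont_pos g ->
  (forall x, 0 < x -> x <= 1 -> `|g x| <= C * x `^ be) ->
  forall eta, 0 < eta -> eta < 1 ->
  `|(\int[mu]_(x in `]0%R, 1%R[) g x)%R - ci eta 1 g| <= C * (eta `^ (be + 1) / (be + 1)).
Proof.
move=> b1 C0 cg gC eta e0 e1.
have ig : mu.-integrable `]0%R, 1%R] (EFin \o g) by exact: (singular_integrable b1 ltr01 C0 cg gC).
have ig' : mu.-integrable `]0%R, eta] (EFin \o g).
  by apply: integrableS ig => //; apply: subset_itvl; rewrite bnd_simp ltW.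
have -> : (\int[mu]_(x in `]0%R, 1%R[) g x)%R = (\int[mu]_(x in `]0%R, 1%R]) g x)%R.
  rewrite Rintegral_itv_bndo_bndc//; apply: integrableS ig => //.
  by apply: subset_itvl; rewrite bnd_simp.
have -> : ci eta 1 g = (\int[mu]_(x in `]eta, 1%R]) g x)%R.
  rewrite /ci -Rintegral_itv_obnd_cbnd//; apply: integrableS ig => //.
  by apply: subset_itvr; rewrite bnd_simp ltW.
have := Rintegral_itvB ig (x := eta); rewrite !bnd_simp => /(_ (ltW e0) (ltW e1)) <-.
rewrite subKr; apply: le_trans (le_normr_Rintegral _ ig') _ => //.
have ip := power_integrable C b1 e0.
apply: (@le_trans _ _ (\int[mu]_(x in `]0%R, eta]) (C * x `^ be))%R).
  apply: le_Rintegral => //; first exact/integrable_norm.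
  by move=> x; rewrite /= in_itv/= => /andP[x0 xe]; apply: gC => //; rewrite (le_trans xe)// ltW.
have ip1 : mu.-integrable `]0%R, eta] (EFin \o (fun x => x `^ be)).
  have := power_integrable 1 b1 e0.
  by congr (mu.-integrable _ _); apply/funext => x; rewrite /= mul1r.
rewrite RintegralZl//.
apply: ler_wpM2l => //; rewrite /Rintegral -lee_fin fineK; first exact: power_integral.
exact: integrable_fin_num ip1.
Qed.

Lemma integral_pos_split (b C be : R) g : -1 < be -> 1 <= b -> 0 <= C -> cont_pos g ->
  (forall x, 0 < x -> `|g x| <= C * x `^ be) -> (forall x, b < x -> g x = 0) ->
  (\int[mu]_(x in `]0%R, +oo[) g x)%R =
  (\int[mu]_(x in `]0%R, 1%R[) g x)%R + (\int[mu]_(x in `]1%R, +oo[) g x)%R.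
Proof.
move=> b1 b_1 C0 cg gC g0; have b0 : 0 < b by exact: lt_le_trans b_1.
have ig : mu.-integrable `]0%R, b] (EFin \o g).
  by apply: (singular_integrable b1 b0 C0 cg) => x x0 _; exact: gC.
have e1 : (\int[mu]_(x in `]0%R, +oo[) g x)%R = (\int[mu]_(x in `]0%R, b]) g x)%R.
  rewrite Rintegral_mkcond [RHS]Rintegral_mkcond; congr Rintegral.
  apply/funext => x; rewrite /patch !mem_setE !in_itv/= andbT.
  by case: (ltP 0 x) => //= x1; case: leP => // bx; rewrite g0.
have e2 : (\int[mu]_(x in `]1%R, +oo[) g x)%R = (\int[mu]_(x in `]1%R, b]) g x)%R.
  rewrite Rintegral_mkcond [RHS]Rintegral_mkcond; congr Rintegral.
  apply/funext => x; rewrite /patch !mem_setE !in_itv/= andbT.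
  by case: (ltP 1 x) => //= x1; case: leP => // bx; rewrite g0.
have e3 : (\int[mu]_(x in `]0%R, 1%R[) g x)%R = (\int[mu]_(x in `]0%R, 1%R]) g x)%R.
  rewrite Rintegral_itv_bndo_bndc//; apply: integrableS ig => //.
  by apply: subset_itvl; rewrite bnd_simp.
rewrite e1 e2 e3.
have := Rintegral_itvB ig (x := 1); rewrite !bnd_simp => /(_ ler01 b_1) <-.
by rewrite addrC subrK.
Qed.

End Integrals.

Section FinitePart.
Context {R : realType} (s : ultraclass) (M : nat -> R).
Context (M_gt0 : forall p, 0 < M p).
Context (M_logconvex : forall p, (1 <= p)%N -> M p ^+ 2 <= M p.-1 * M p.+1).
Context (theta : R -> R) (smooth_theta : smooth theta)
  (theta0 : forall x, x <= 1 -> theta x = 0) (theta1 : forall x, 2 <= x -> theta x = 1)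
  (bnd_theta : forall h, 0 < h -> exists N, bnd M h N setT theta).
Local Notation mu := (@lebesgue_measure R).
Local Notation wtest := (wtest s M).
Local Notation chi := (chi theta).

Definition pow_functional (al : R) (u : R -> R) := (\int[mu]_(x in `]0%R, +oo[) (x `^ al * u x))%R.

Lemma smooth_continuous (u : R -> R) : smooth u -> continuous u.
Proof.
by move=> su x; have := smooth_jet su 0 x; exact: is_derive_continuous.
Qed.

Lemma cont_pos_powM (al : R) (u : R -> R) : continuous u -> cont_pos (fun x => x `^ al * u x).
Proof. by move=> cu x x0; apply: cvgM; [exact: powR_cont_pos | exact: cu]. Qed.

(** The factor [theta] removes the singularity at 0. Beyond 2 the primitive is, up to constants, a
    power, or a logarithm exactly when [be = -1]; this is the source of [log a] in the expansion. *)
Lemma theta_primitive (be : R) : exists G : R -> R,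
  [/\ forall x : R, is_derive x (1 : R) G (x `^ be * theta x),
      forall x, x <= 1 -> G x = G 1,
      be + 1 != 0 -> forall x, 2 <= x -> G x = G 2 + (x `^ (be + 1) - 2 `^ (be + 1)) / (be + 1) &
      be + 1 = 0 -> forall x, 2 <= x -> G x = G 2 + (ln x - ln 2)].
Proof.
pose h x := x `^ be * theta x.
have h0 x : x < 1 -> h x = 0 by move=> x1; rewrite /h theta0 ?mulr0// ltW.
have ct := smooth_continuous smooth_theta.
have ch : continuous h.
  move=> x; have [x0|x0] := ltP 0 x; first exact: cont_pos_powM.
  apply: (@is_derive_continuous _ x 0); apply: is_derive_near0; near=> y.
  by apply: h0; near: y; apply: lt_nbhsl; exact: le_lt_trans x0 _.
have [G HG] := primitive_exists ch h0; exists G.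
have const (F f : R -> R) (a b : R) : a <= b -> (forall x : R, is_derive x (1 : R) F (f x)) ->
    (forall x, a <= x <= b -> f x = 0) -> F b = F a.
  move=> ab dF f0.
  have [z] := @MVT_segment _ F f a b ab (fun z _ => dF z)
     (continuous_subspaceT (fun z => is_derive_continuous (dF z))).
  by rewrite in_itv/= => /f0 -> /eqP; rewrite mul0r subr_eq0 => /eqP.
split => //.
- move=> x x1; apply/esym; apply: (const _ _ _ _ x1 HG) => y /andP[_ y1].
  by rewrite /h theta0 ?mulr0.
- move=> b0 x x2; have b1 : be != -1 by rewrite -addr_eq0.
  have x20 : 0 < 2 :> R by [].
  have ceq : ci 2 x h = ci 2 x (fun x => x `^ be).
    by apply: ci_eq => y /andP[y2 _]; rewrite /h theta1// mulr1.
  have e1 : ci 2 x h = G x - G 2.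
    by apply: ci_FTC => //; move=> y y0; exact: ch.
  have dp (y : R) : 0 < y -> is_derive y (1 : R) (fun y => y `^ (be + 1) / (be + 1)) (y `^ be).
    by move=> y0; exact: is_derive_powR_prim.
  have := ci_FTC x20 x2 (@powR_cont_pos R be) dp; rewrite -ceq e1 mulrBl.
  by move: (_ / (be + 1)) (_ / (be + 1)) => A B; lra.
- move=> b0 x x2; have x20 : 0 < 2 :> R by [].
  have ceq : ci 2 x h = ci 2 x (fun x => x `^ be).
    by apply: ci_eq => y /andP[y2 _]; rewrite /h theta1// mulr1.
  have e1 : ci 2 x h = G x - G 2.
    by apply: ci_FTC => //; move=> y y0; exact: ch.
  have dp (y : R) : 0 < y -> is_derive y (1 : R) (@ln R) (y `^ be).
    move=> y0; have -> : be = -1 by lra.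
    by rewrite powR_inv1 ?(ltW y0)//; exact: is_derive1_ln.
  have := ci_FTC x20 x2 (@powR_cont_pos R be) dp; rewrite -ceq e1.
  by move: (ln x) (ln 2) => A B; lra.
Unshelve. all: by end_near. Qed.

Lemma powR_exprn (al x : R) i : 0 < x -> x `^ al * x ^+ i = x `^ (al + i%:R).
Proof. by move=> x0; rewrite powRD ?powR_mulrn ?(ltW x0)// (gt_eqF x0) implybT. Qed.

(** By homogeneity a combination of [G (x / a)] and [G x] is a primitive of the integrand. The
    endpoint [B] may be any point past the support, and is chosen at each use. *)
Lemma chi_pow_functional (al a : R) i G : 0 < a ->
  (forall x : R, is_derive x (1 : R) G (x `^ (al + i%:R) * theta x)) ->
  (forall x, x <= 1 -> G x = G 1) ->
  forall B, 2 <= B -> 2 * a <= B ->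
  pow_functional al (fun x => chi a^-1 1 x * x ^+ i) =
    a `^ (al + i.+1%:R) * (G (B / a) - G 1) - (G B - G 1).
Proof.
move=> a0 dG G1 B B2 Ba; pose lo := Num.min a 1.
have lo0 : 0 < lo by rewrite lt_min a0 ltr01.
have loB : lo <= B by apply: le_trans (_ : 1 <= B); [rewrite ge_min lexx orbT | lra].
have ct := smooth_continuous smooth_theta.
have ai : 0 < a^-1 by rewrite invr_gt0.
pose sg := al + i.+1%:R.
rewrite /pow_functional (@integral_pos_ci _ lo B)//; last first.
  move=> x xab; have [xl|lx] := ltP x lo.
    move: xl; rewrite /lo lt_min => /andP[xa x1].
    rewrite /chi !theta0 ?subrr ?mul0r ?mulr0//; first by rewrite mul1r ltW.
    by rewrite mulrC ler_pdivrMr// mul1r ltW.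
  move: xab; rewrite lx/= -ltNge => Bx.
  rewrite /chi !theta1 ?subrr ?mul0r ?mulr0//; first by rewrite mul1r; lra.
  by rewrite mulrC ler_pdivlMr//; lra.
pose F x := a `^ sg * G (a^-1 * x) - G x.
have dF (x : R) : 0 < x -> is_derive x (1 : R) F (x `^ al * (chi a^-1 1 x * x ^+ i)).
  move=> x0.
  have dax : is_derive x (1 : R) (fun y => a^-1 * y) a^-1.
    have := @is_deriveZ _ _ _ id a^-1 x 1 _ (is_derive_id x 1).
    by rewrite /GRing.scale/= mulr1.
  have dc := @is_derive1_comp _ G (fun y => a^-1 * y) x _ _ (dG (a^-1 * x)) dax.
  have dz := is_deriveZ (a `^ sg) dc.
  have dd := is_deriveB dz (dG x).
  have -> : x `^ al * (chi a^-1 1 x * x ^+ i) =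
     a `^ sg *: ((a^-1 * x) `^ (al + i%:R) * theta (a^-1 * x) * a^-1) - x `^ (al + i%:R) * theta x.
    rewrite /GRing.scale/= powRM ?(ltW ai) ?(ltW x0)// -!powR_exprn//.
    have -> : a^-1 `^ al = (a `^ al)^-1 by rewrite -powR_inv1 ?(ltW a0)// -powRrM mulN1r powRN.
    rewrite /chi mul1r exprVn exprS; have aal : a `^ al != 0 by rewrite gt_eqF// powR_gt0.
    have aii : a ^+ i != 0 by rewrite gt_eqF// exprn_gt0.
    by field; rewrite aal aii gt_eqF.
  by [].
have cg : cont_pos (fun x => x `^ al * (chi a^-1 1 x * x ^+ i)).
  apply: cont_pos_powM => x; apply: cvgM.
    by apply: (smooth_continuous (u := chi a^-1 1)); have [? _ _] := cut_chi_explicit smooth_theta theta0 theta1 bnd_theta ai ltr01.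
  exact: (smooth_continuous (@smooth_pow R i)).
rewrite (ci_FTC lo0 loB cg dF) /F.
rewrite (G1 lo); last by rewrite ge_min lexx orbT.
rewrite (G1 (a^-1 * lo)); last by rewrite mulrC ler_pdivrMr// mul1r ge_min lexx.
by rewrite (mulrC a^-1 B); ring.
Qed.

(* A term with [al + i + 1 = 0] would be logarithmic and is left out: this is the
   normalization of the Hadamard finite part. *)
Definition finite_part (al : R) m (u : R -> R) :=
  (\int[mu]_(x in `]0%R, 1%R[) (x `^ al * trem m u x))%R +
  (\int[mu]_(x in `]1%R, +oo[) (x `^ al * u x))%R +
  \sum_(i < m | al + i.+1%:R != 0) derive1n i u 0 / i`!%:R / (al + i.+1%:R).

Lemma wtest_bounded u n : wtest u -> exists2 B, 0 <= B & forall x, `|derive1n n u x| <= B.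
Proof.
move=> [h0 [a [b [h00 [su _ bu]]]]]; have [h hh] := hset_neq0 s h00.
have [N bN] := bu h hh; exists (N * (h ^+ n * M n)); last by move=> x; exact: bN.
have h_0 := hset_gt0 h00 hh.
by rewrite !mulr_ge0 ?exprn_ge0 ?(ltW h_0) ?(ltW (M_gt0 _))// (bnd_ge0 M_gt0 (I : setT (0 : R)) bN).
Qed.

Lemma wtest_support u : wtest u -> exists2 b, 2 <= b & forall x, b < x -> u x = 0.
Proof.
move=> [h0 [a [b [h00 [su u0 bu]]]]]; exists (Num.max b 2); first by rewrite le_max lexx orbT.
by move=> x; rewrite gt_max => /andP[bx _]; rewrite u0// negb_and -!ltNge bx orbT.
Qed.

Lemma wtest_bounded_test u : wtest u -> bounded_test u.
Proof.
move=> wu; split; [exact: wtest_smooth wu | exact: wtest_support wu |].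
by move=> n; exact: (wtest_bounded n wu).
Qed.

Lemma ci_sum a b m (c : nat -> R) (p : nat -> R -> R) : 0 < a -> (forall i, cont_pos (p i)) ->
  cont_pos (fun x => \sum_(i < m) c i * p i x) /\
  ci a b (fun x => \sum_(i < m) c i * p i x) = \sum_(i < m) c i * ci a b (p i).
Proof.
move=> a0 cp; elim: m => [|m [IH1 IH2]].
  have -> : (fun x : R => \sum_(i < 0) c i * p i x) = (fun=> 0).
    by apply/funext => x; rewrite big_ord0.
  by rewrite big_ord0; split; [move=> x _; exact: cst_continuous | exact: ci_zero].
have -> : (fun x => \sum_(i < m.+1) c i * p i x) =
  (fun x => c m * p m x + (\sum_(i < m) c i * p i x)).
  by apply/funext => x; rewrite big_ord_recr/= addrC.
split.
  by move=> x x0; apply: cvgD; [apply: cvgMr; exact: cp | exact: IH1].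
by rewrite ci_lin// IH2 big_ord_recr/= addrC.
Qed.

Lemma powR_small (K sg : R) (eta : R) : 0 < sg -> 0 < eta -> exists2 d, 0 < d &
  forall t, 0 < t < d -> K * t `^ sg <= eta.
Proof.
move=> sg0 eta0.
have H : K * t `^ sg @[t --> 0^'+] --> K * 0 by apply: cvgMr; exact: powR_cvg0.
have : \forall t \near 0^'+, `|K * 0 - K * t `^ sg| <= eta by exact: (cvgrPdist_le _ _).1 H _ eta0.
move=> /near0P[d d0 Hd]; exists d => // t td; have := Hd t td.
by rewrite mulr0 sub0r normrN; apply: le_trans; exact: ler_norm.
Qed.

(** The defect between the smooth cutoff [theta] and the sharp cutoff at 1 of the finite part; these
    constants cancel in [extension_limit]. *)
Definition transition_moment al i := ci 1 2 (fun x => x `^ al * ((1 - theta x) * x ^+ i)).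

Lemma theta_bounded : exists2 B, 0 <= B & forall x, `|theta x| <= B.
Proof.
have [N bN] := bnd_theta ltr01; exists (N * (1 ^+ 0 * M 0%N)); last by move=> x; exact: (bN 0%N x I).
by rewrite !mulr_ge0 ?exprn_ge0 ?(ltW (M_gt0 _))// (bnd_ge0 M_gt0 (I : setT (0 : R)) bN).
Qed.

(** On [(0, 1)] only the remainder is seen, as [theta] vanishes there. Beyond 1, [theta * u] and
    [1 - theta] times the remainder add up to [u] minus [1 - theta] times the Taylor polynomial,
    whence the transition moments. *)
Lemma main_limit_value (al : R) m u : 0 < al + m.+1%:R -> wtest u ->
  exists V, [/\ pow_functional al (fun x => chi (2 ^+ J) 1 x * trem m u x) @[J --> \oo] --> V &
  pow_functional al (fun x => theta x * u x) + V =
   (\int[mu]_(x in `]0%R, 1%R[) (x `^ al * trem m u x))%R +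
   (\int[mu]_(x in `]1%R, +oo[) (x `^ al * u x))%R
   - \sum_(i < m) derive1n i u 0 / i`!%:R * transition_moment al i].
Proof.
move=> am wu; have su := wtest_smooth wu.
have ct := smooth_continuous smooth_theta.
have cu := smooth_continuous su.
have cr := smooth_continuous (@smooth_trem _ m _ su).
have [Bt Bt0 HBt] := theta_bounded.
have [Br Br0 HBr] := trem_bound m (wtest_bounded_test wu).
pose be := al + m%:R; have be1 : be + 1 = al + m.+1%:R by rewrite /be -natr1 addrA.
have be_1 : -1 < be by lra.
pose g x := x `^ al * trem m u x.
pose gJ J x := x `^ al * (theta (2 ^+ J * x) * trem m u x).
have two0 J : 0 < 2 ^+ J :> R by rewrite exprn_gt0.
have cgJ J : cont_pos (gJ J).
  apply: cont_pos_powM => x; apply: cvgM; last exact: cr.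
  exact: (smooth_continuous (@smooth_scale _ _ smooth_theta (2 ^+ J))).
have cg : cont_pos g by exact: cont_pos_powM.
have gB x : 0 < x -> `|g x| <= Br * x `^ be.
  move=> x0; rewrite /g normrM (ger0_norm (powR_ge0 _ _)).
  have := HBr x; rewrite (gtr0_norm x0) => H.
  rewrite /be -powR_exprn// mulrCA; apply: ler_wpM2l; first exact: powR_ge0.
  exact: H.
have gJB J x : 0 < x -> `|gJ J x| <= (Bt * Br) * x `^ be.
  move=> x0; have -> : gJ J x = theta (2 ^+ J * x) * g x by rewrite /gJ /g mulrCA.
  by rewrite normrM -mulrA; apply: ler_pM => //; exact: gB.
pose V1 := (\int[mu]_(x in `]0%R, 1%R[) g x)%R.
pose V2 := ci 1 2 (fun x => x `^ al * ((1 - theta x) * trem m u x)).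
have lim1 : ci (2 ^+ J)^-1 1 (gJ J) @[J --> \oo] --> V1.
  apply/cvgrPdist_le => eta eta0.
  (* Three tails are estimated: [gJ J] below [t] and below [2 * t], and [g] below [2 * t], the point
     from which the outer cutoff equals 1. *)
  pose K := (2 * (Bt * Br) + Br) / (be + 1).
  have K0 : 0 <= K.
    rewrite divr_ge0//; last by lra.
    by rewrite addr_ge0// !mulr_ge0.
  have [|d d0 Hd] := powR_small K (sg := be + 1) _ eta0; first by lra.
  have [k Hk] := half_small 2 (divr_gt0 d0 (ltr0Sn R 1)).
  exists (maxn k 2) => // J /=; rewrite geq_max => /andP[kJ J2].
  pose t : R := (2 ^+ J)^-1; have t0 : 0 < t by rewrite invr_gt0.
  have t2 : 2 * t < d.
    apply: (@le_lt_trans _ _ (d / 2)); last by lra.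
    apply: le_trans Hk; rewrite exprVn ler_pM2l// lef_pV2 ?posrE//.
    by rewrite ler_weXn2l// ler1n.
  have t21 : 2 * t < 1.
    rewrite /t; have -> : J = (J - 2).+2 by rewrite -[LHS](subnK J2) addn2.
    by rewrite exprS invfM mulrA divff// mul1r invf_lt1// exprn_egt1// ltr1n.
  have t1 : t < 1 by lra.
  have t20 : 0 < 2 * t by rewrite mulr_gt0.
  have H1 := singular_integral be_1 (mulr_ge0 Bt0 Br0) (cgJ J) (fun x x0 _ => gJB J x x0) t0 t1.
  have H2 := singular_integral be_1 (mulr_ge0 Bt0 Br0) (cgJ J) (fun x x0 _ => gJB J x x0) t20 t21.
  have H3 := singular_integral be_1 Br0 cg (fun x x0 _ => gB x x0) t20 t21.
  have eqc : ci (2 * t) 1 (gJ J) = ci (2 * t) 1 g.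
    apply: ci_eq => x /andP[tx x1]; rewrite /gJ /g theta1 ?mul1r//.
    have : 2 ^+ J * (2 * t) <= 2 ^+ J * x by rewrite ler_pM2l.
    by rewrite mulrCA divff ?mulr1// gt_eqF.
  have mono : t `^ (be + 1) <= (2 * t) `^ (be + 1).
    by apply: ge0_ler_powR; rewrite ?nnegrE ?(ltW t0) ?(ltW t20)//; lra.
  have HK := Hd _ (introT andP (conj t20 t2)).
  rewrite eqc in H2; rewrite -/V1 in H3.
  move: (\int[mu]_(x in `]0%R, 1%R[) gJ J x)%R H1 H2 => X H1 H2.
  have -> : V1 - ci t 1 (gJ J) = (V1 - ci (2 * t) 1 g) - (X - ci (2 * t) 1 g) + (X - ci t 1 (gJ J)) by ring.
  apply: le_trans (ler_normD _ _) _; apply: le_trans (lerD (ler_normB _ _) (lexx _)) _.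
  apply: le_trans (lerD (lerD H3 H2) H1) _; apply: le_trans HK.
  have b0 : 0 < (be + 1)^-1 by rewrite invr_gt0; lra.
  have H4 : Bt * Br * (t `^ (be + 1) / (be + 1)) <= Bt * Br * ((2 * t) `^ (be + 1) / (be + 1)).
    by apply: ler_wpM2l; [exact: mulr_ge0 | rewrite ler_pM2r].
  apply: le_trans (lerD (lexx _) H4) _.
  by rewrite le_eqVlt; apply/orP; left; apply/eqP; rewrite /K; ring.
exists (V1 + V2); split.
  have ev : \forall J \near \oo, ci (2 ^+ J)^-1 1 (gJ J) + V2 =
      pow_functional al (fun x => chi (2 ^+ J) 1 x * trem m u x).
    exists 1%N => // J /= J1.
    have J2 : 2 <= 2 ^+ J :> R by rewrite -[X in X <= _]expr1 ler_weXn2l// ler1n.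
    have ti : (2 ^+ J)^-1 <= 1 :> R by rewrite invf_le1//; lra.
    have t0 : 0 < (2 ^+ J)^-1 :> R by rewrite invr_gt0.
    have cc : cont_pos (fun x => x `^ al * (chi (2 ^+ J) 1 x * trem m u x)).
      apply: cont_pos_powM => x; apply: cvgM; last exact: cr.
      by apply: (smooth_continuous (u := chi (2 ^+ J) 1)); have [? _ _] := cut_chi_explicit smooth_theta theta0 theta1 bnd_theta (two0 J) ltr01.
    rewrite /pow_functional (@integral_pos_ci _ (2 ^+ J)^-1 2)//; last first.
      move=> x xab; have [xl|lx] := ltP x (2 ^+ J)^-1.
        rewrite /chi !theta0 ?subrr ?mul0r ?mulr0//.
          by rewrite mul1r; lra.
        by rewrite -ler_pdivlMl// mulr1 ltW.
      move: xab; rewrite lx/= -ltNge => x2.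
      rewrite /chi !theta1 ?subrr ?mul0r ?mulr0//; first by rewrite mul1r ltW.
      by apply: le_trans (ltW x2) _; rewrite ler_peMl//; lra.
    rewrite (ci_split t0 ti _ cc); last by rewrite ler1n.
    congr (_ + _).
      apply: ci_eq => x /andP[tx x1]; rewrite /gJ /chi mul1r (theta0 x1); ring.
    apply: ci_eq => x /andP[x1 x2]; rewrite /chi mul1r (theta1 (x := 2 ^+ J * x)); first by ring.
    by apply: le_trans J2 _; rewrite ler_peMr//; lra.
  apply: cvg_trans; first exact: (near_eq_cvg ev).
  by apply: cvgD; [exact: lim1 | exact: cvg_cst].
have [b b2 ub] := wtest_support wu.
have b1 : 1 <= b by lra.
pose p1 x := x `^ al * (theta x * u x).
pose p2 x := x `^ al * ((1 - theta x) * trem m u x).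
pose p3 i x := x `^ al * ((1 - theta x) * x ^+ i).
have ct1 : continuous (fun x => 1 - theta x) by move=> x; apply: cvgB; [exact: cvg_cst | exact: ct].
have c1 : cont_pos p1 by apply: cont_pos_powM => x; apply: cvgM; [exact: ct | exact: cu].
have c2 : cont_pos p2 by apply: cont_pos_powM => x; apply: cvgM; [exact: ct1 | exact: cr].
have c3 i : cont_pos (p3 i).
  by apply: cont_pos_powM => x; apply: cvgM; [exact: ct1 | exact: (smooth_continuous (@smooth_pow R i))].
have cau : cont_pos (fun x => x `^ al * u x) by exact: cont_pos_powM.
have e1 : pow_functional al (fun x => theta x * u x) = ci 1 b p1.
  rewrite /pow_functional (@integral_pos_ci _ 1 b)// => x xab.
  have [x1|x1] := ltP x 1; first by rewrite theta0 ?mul0r ?mulr0// ltW.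
  by move: xab; rewrite x1/= -ltNge => /ub ->; rewrite !mulr0.
have e2 : V2 = ci 1 b p2.
  rewrite (@ci_split _ 2 1 b p2 ltr01 _ b2 c2) ?ler1n// [X in _ = _ + X]ci_zero ?addr0//.
  by move=> x /andP[x2 _]; rewrite /p2 theta1// subrr mul0r mulr0.
have e3 i : transition_moment al i = ci 1 b (p3 i).
  rewrite (@ci_split _ 2 1 b (p3 i) ltr01 _ b2 (c3 i)) ?ler1n// [X in _ = _ + X]ci_zero ?addr0//.
  by move=> x /andP[x2 _]; rewrite /p3 theta1// subrr mul0r mulr0.
have e4 : (\int[mu]_(x in `]1%R, +oo[) (x `^ al * u x))%R = ci 1 b (fun x => x `^ al * u x).
  apply: integral_pos1_ci; first exact: (ci_integrable b ltr01 cau).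
  by move=> x /ub ->; rewrite mulr0.
rewrite e1 e2 e4 -/V1.
under [X in _ = _ - X]eq_bigr => i _ do rewrite e3.
have [cs es] := ci_sum b m (fun i => derive1n i u 0 / i`!%:R) ltr01 c3.
rewrite -es addrCA -addrA; congr (_ + _).
rewrite -[ci 1 b p1]mul1r -ci_lin// addrC -mulN1r -ci_lin//; apply: ci_eq => x _.
rewrite /p1 /p2 /trem /taylor mulN1r.
have -> : \sum_(i < m) derive1n i u 0 / i`!%:R * p3 i x =
    x `^ al * ((1 - theta x) * \sum_(i < m) derive1n i u 0 / i`!%:R * x ^+ i).
  by rewrite !mulr_sumr; apply: eq_bigr => i _; rewrite /p3; ring.
by ring.
Qed.

End FinitePart.

Section ByParts.
Context {R : realType}.
Local Notation mu := (@lebesgue_measure R).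
Implicit Types (u : R -> R).

Lemma derive1n_derive1 u n : derive1n n (derive1n 1 u) = derive1n n.+1 u.
Proof. by rewrite /derive1n -iterSr. Qed.

Lemma bounded_test_derive u : bounded_test u -> bounded_test (derive1n 1 u).
Proof.
move=> [su [b b2 ub] bu]; split.
- by move=> n x; rewrite derive1n_derive1; exact: su.
- exists b => // x bx.
  have ob : open [set y : R | b < y] by exact: open_gt.
  by have [] := @derive1n_open0 R u [set y | b < y] ob ub 1 x bx.
- by move=> n; have [B B0 HB] := bu n.+1; exists B => // x; rewrite derive1n_derive1.
Qed.

Lemma is_derive_trem u m (x : R) : smooth u ->
  is_derive x (1 : R) (trem m.+1 u) (trem m (derive1n 1 u) x).
Proof.
move=> su; have := jet_trem m.+1 su 0 x; rewrite trem_jet0.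
suff -> : trem_jet m.+1 u 1 x = trem m (derive1n 1 u) x by [].
rewrite /trem_jet /trem /taylor big_ord_recl/= ffactn1 mul0r mulr0 add0r; congr (_ - _).
apply: eq_bigr => i _; rewrite derive1n_derive1 /bump/= add1n ffactn1 subn1/=.
rewrite factS natrM mulrA; congr (_ * _).
have i0 : (i`!%:R : R) != 0 by rewrite pnatr_eq0 -lt0n fact_gt0.
by rewrite invfM mulrA mulrAC divfK.
Qed.

Lemma is_derive_powM (al x : R) w dw : al + 1 != 0 -> 0 < x ->
  is_derive x (1 : R) w dw ->
  is_derive x (1 : R) (fun y => y `^ (al + 1) * w y)
     ((al + 1) * (x `^ al * w x) + x `^ (al + 1) * dw).
Proof.
move=> a1 x0 dw'; have := is_deriveM (is_derive1_powR (al + 1) x0) dw'.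
rewrite addrK /GRing.scale/= => H.
have -> : (al + 1) * (x `^ al * w x) + x `^ (al + 1) * dw =
  x `^ (al + 1) * dw + w x * ((al + 1) * x `^ al) by ring.
exact: H.
Qed.

Lemma vanishing_power (X K sg : R) : 0 < sg ->
  (forall eta, 0 < eta -> eta < 1 -> `|X| <= K * eta `^ sg) -> X = 0.
Proof.
move=> sg0 H; apply/eqP; rewrite -normr_le0; apply/ler_addgt0Pr => e e0; rewrite add0r.
have [d d0 Hd] := powR_small K sg0 e0.
pose t := Num.min (d / 2) (2^-1).
have t0 : 0 < t by rewrite lt_min divr_gt0//= invr_gt0.
have td : t < d by apply: le_lt_trans (_ : t <= d / 2) _; [rewrite ge_min lexx | lra].
have t1 : t < 1 by apply: le_lt_trans (_ : t <= 2^-1) _; [rewrite ge_min lexx orbT | lra].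
by apply: le_trans (H t t0 t1) _; apply: Hd; rewrite t0.
Qed.

(** Integration by parts on [(0, 1)] and on [(1, oo)]. The boundary term at [eta] is of order [eta]
    to the power [al + k.+2]; those at 1 combine to a sum of Taylor coefficients, which accounts for
    the change of denominators in the last term of [finite_part]. *)
Lemma finite_part_step (al : R) k u : bounded_test u -> al + 1 != 0 ->
  (forall i, al + i.+1%:R != 0) -> 0 < al + k.+2%:R ->
  finite_part al k.+1 u = - (al + 1)^-1 * finite_part (al + 1) k (derive1n 1 u).
Proof.
move=> bu a1 nz ak; have bu' := bounded_test_derive bu.
have [su [b b2 ub] _] := bu; have [su' _ _] := bu'.
have cu := smooth_continuous su; have cu' := smooth_continuous su'.
have cr := smooth_continuous (@smooth_trem _ k.+1 _ su).
have cr' := smooth_continuous (@smooth_trem _ k _ su').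
have [B B0 HB] := trem_bound k.+1 bu; have [B' B'0 HB'] := trem_bound k bu'.
have e1 : al + k.+1%:R + 1 = al + k.+2%:R by rewrite -(natr1 k.+1) addrA.
have e2 : al + 1 + k%:R + 1 = al + k.+2%:R by rewrite -e1 -(natr1 k); lra.
have be1 : -1 < al + k.+1%:R by lra.
have be2 : -1 < al + 1 + k%:R by lra.
pose g x := x `^ al * trem k.+1 u x.
pose g' x := x `^ (al + 1) * trem k (derive1n 1 u) x.
have cg : cont_pos g by exact: cont_pos_powM.
have cg' : cont_pos g' by exact: cont_pos_powM.
have gB x : 0 < x -> x <= 1 -> `|g x| <= B * x `^ (al + k.+1%:R).
  move=> x0 _; rewrite /g normrM (ger0_norm (powR_ge0 _ _)).
  have := HB x; rewrite (gtr0_norm x0) => H.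
  by rewrite -powR_exprn// mulrCA; apply: ler_wpM2l => //; exact: powR_ge0.
have gB' x : 0 < x -> x <= 1 -> `|g' x| <= B' * x `^ (al + 1 + k%:R).
  move=> x0 _; rewrite /g' normrM (ger0_norm (powR_ge0 _ _)).
  have := HB' x; rewrite (gtr0_norm x0) => H.
  by rewrite -powR_exprn// mulrCA; apply: ler_wpM2l => //; exact: powR_ge0.
pose X := (\int[mu]_(x in `]0%R, 1%R[) g x)%R.
pose X' := (\int[mu]_(x in `]0%R, 1%R[) g' x)%R.
have near1 : (al + 1) * X + X' = trem k.+1 u 1.
  apply/eqP; rewrite -subr_eq0; apply/eqP.
  pose sg := al + k.+2%:R.
  apply: (@vanishing_power _ (`|al + 1| * (B / sg) + B' / sg + B) sg) => // eta e0 eta1.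
  have H1 := singular_integral be1 B0 cg gB e0 eta1.
  have H2 := singular_integral be2 B'0 cg' gB' e0 eta1.
  rewrite e1 -/X in H1; rewrite e2 -/X' in H2.
  have dF (x : R) : 0 < x -> is_derive x (1 : R) (fun y => y `^ (al + 1) * trem k.+1 u y)
      ((al + 1) * g x + g' x).
    by move=> x0; apply: is_derive_powM => //; exact: is_derive_trem.
  have cF : cont_pos (fun x => (al + 1) * g x + g' x).
    by move=> x x0; apply: cvgD; [apply: cvgMr; exact: cg | exact: cg'].
  have := ci_FTC e0 (ltW eta1) cF dF; rewrite (ci_lin _ _ e0 cg cg') powR1 mul1r => H3.
  have H4 : `|eta `^ (al + 1) * trem k.+1 u eta| <= B * eta `^ sg.
    rewrite normrM (ger0_norm (powR_ge0 _ _)); have := HB eta; rewrite (gtr0_norm e0) => H.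
    have -> : B * eta `^ sg = eta `^ (al + 1) * (B * eta ^+ k.+1).
      rewrite mulrCA powR_exprn//; congr (_ * _ `^ _).
      by rewrite /sg -(natr1 k.+1); lra.
    by apply: ler_wpM2l => //; exact: powR_ge0.
  have -> : (al + 1) * X + X' - trem k.+1 u 1 = (al + 1) * (X - ci eta 1 g) + (X' - ci eta 1 g')
      - eta `^ (al + 1) * trem k.+1 u eta.
    by rewrite mulrBr; move: H3; move: (ci eta 1 g) (ci eta 1 g') (trem k.+1 u 1) (_ * trem k.+1 u eta) => y1 y2 y3 y4 H3; rewrite -[y3](subrK y4) -H3; ring.
  apply: le_trans (ler_normB _ _) _; rewrite [X in _ <= X]mulrDl; apply: lerD => //.
  apply: le_trans (ler_normD _ _) _; rewrite [X in _ <= X]mulrDl; apply: lerD.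
    rewrite normrM -mulrA; apply: ler_wpM2l => //; apply: le_trans H1 _.
    by rewrite mulrA mulrAC.
  by apply: le_trans H2 _; rewrite mulrA mulrAC.
have b1 : 1 <= b by lra.
pose Y := (\int[mu]_(x in `]1%R, +oo[) (x `^ al * u x))%R.
pose Y' := (\int[mu]_(x in `]1%R, +oo[) (x `^ (al + 1) * derive1n 1 u x))%R.
have ub' x : b < x -> derive1n 1 u x = 0.
  move=> bx; have ob : open [set y : R | b < y] by exact: open_gt.
  by have [] := @derive1n_open0 R u [set y | b < y] ob ub 1 x bx.
have cau : cont_pos (fun x => x `^ al * u x) by exact: cont_pos_powM.
have cau' : cont_pos (fun x => x `^ (al + 1) * derive1n 1 u x) by exact: cont_pos_powM.
(* [u] is known to vanish only strictly beyond [b], hence the endpoint [b + 1]. *)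
have b11 : 1 <= b + 1 by lra.
have far : (al + 1) * Y + Y' = - u 1.
  have -> : Y = ci 1 (b + 1) (fun x => x `^ al * u x).
    apply: integral_pos1_ci; first exact: (ci_integrable _ ltr01 cau).
    by move=> x bx; rewrite ub ?mulr0//; lra.
  have -> : Y' = ci 1 (b + 1) (fun x => x `^ (al + 1) * derive1n 1 u x).
    apply: integral_pos1_ci; first exact: (ci_integrable _ ltr01 cau').
    by move=> x bx; rewrite ub' ?mulr0//; lra.
  have dF (x : R) : 0 < x -> is_derive x (1 : R) (fun y => y `^ (al + 1) * u y)
      ((al + 1) * (x `^ al * u x) + x `^ (al + 1) * derive1n 1 u x).
    by move=> x0; apply: is_derive_powM => //; exact: (smooth_jet su 0 x).
  have cF : cont_pos (fun x => (al + 1) * (x `^ al * u x) + x `^ (al + 1) * derive1n 1 u x).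
    by move=> x x0; apply: cvgD; [apply: cvgMr; exact: cau | exact: cau'].
  rewrite -(ci_lin _ _ ltr01 cau cau') (ci_FTC ltr01 b11 cF dF).
  by rewrite (ub (b + 1)) ?mulr0 ?powR1 ?mul1r ?sub0r//; lra.
rewrite /finite_part -/X -/Y -/X' -/Y'.
rewrite (eq_bigl xpredT); last by move=> i; rewrite nz.
rewrite [in RHS](eq_bigl xpredT); last first.
  move=> i; have -> : al + 1 + i.+1%:R = al + i.+2%:R by rewrite -(natr1 i.+1); lra.
  by rewrite nz.
have taylor1 : trem k.+1 u 1 = u 1 - \sum_(i < k.+1) derive1n i u 0 / i`!%:R.
  by rewrite /trem /taylor; congr (_ - _); apply: eq_bigr => i _; rewrite expr1n mulr1.
have XE : X + Y = - (al + 1)^-1 * (X' + Y') - (al + 1)^-1 * \sum_(i < k.+1) derive1n i u 0 / i`!%:R.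
  have H : (al + 1) * (X + Y) + (X' + Y') = - \sum_(i < k.+1) derive1n i u 0 / i`!%:R.
    have -> : (al + 1) * (X + Y) + (X' + Y') = ((al + 1) * X + X') + ((al + 1) * Y + Y') by ring.
    by rewrite near1 far taylor1; ring.
  rewrite -mulNr -mulrDr; apply: (mulfI a1); rewrite mulrA mulrN divff// mulN1r opprD.
  by rewrite -H; ring.
rewrite XE -addrA [RHS]mulrDr; congr (_ + _).
rewrite -mulNr [in RHS]mulr_sumr [X in X + _]mulr_sumr -big_split/= big_ord_recl/=.
rewrite -[RHS]add0r; congr (_ + _); first by rewrite fact0 divr1; field.
apply: eq_bigr => i _; rewrite derive1n_derive1 /bump/= add1n factS natrM.
have i0 : (i`!%:R : R) != 0 by rewrite pnatr_eq0 -lt0n fact_gt0.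
have i1 : (i.+1%:R : R) != 0 by rewrite pnatr_eq0.
have n2 := nz i.+1.
have e3 : al + i.+2%:R = (al + 1) + i.+1%:R by rewrite -(natr1 i.+1); lra.
rewrite e3 in n2 *.
move: (i.+1%:R) (i`!%:R) i0 i1 n2 => z w w0 z0 n2.
by field; rewrite w0 z0 n2 a1.
Qed.

Lemma finite_part_integrable (al : R) u : bounded_test u -> -1 < al ->
  finite_part al 0 u = pow_functional al u.
Proof.
move=> [su [b b2 ub] bu] al1; have [B B0 HB] := bu 0%N.
rewrite /finite_part big_ord0 addr0 trem0 /pow_functional (@integral_pos_split _ b B al)//; last 3 first.
- by apply: cont_pos_powM; exact: smooth_continuous.
- move=> x x0; rewrite normrM (ger0_norm (powR_ge0 _ _)) mulrC.
  by apply: ler_wpM2r; [exact: powR_ge0 | exact: HB].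
- by move=> x /ub ->; rewrite mulr0.
by lra.
Qed.

(** Each integration by parts raises the exponent by one and lowers the order by one, until the
    integral converges without subtraction; the factors collect into the product. *)
Lemma finite_part_xplus k (al : R) u : bounded_test u ->
  (forall i, al + i.+1%:R != 0) -> 0 < al + k.+1%:R ->
  finite_part al k u = (\prod_(1 <= j < k.+1) (al + j%:R))^-1 *
    ((-1) ^+ k * pow_functional (al + k%:R) (derive1n k u)).
Proof.
elim: k al u => [|k IH] al u bu nz ak.
  rewrite big_geq// invr1 !mul1r addr0; apply: finite_part_integrable => //; lra.
have a1 := nz 0%N.
have e1 i : al + 1 + i.+1%:R = al + i.+2%:R by rewrite -(natr1 i.+1); lra.
rewrite finite_part_step// IH; first last.
- by rewrite e1.
- by move=> i; rewrite e1.
- exact: bounded_test_derive.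
rewrite derive1n_derive1 [X in _ = X^-1 * _]big_nat_recl// exprS invfM.
have -> : \prod_(1 <= i < k.+1) (al + i.+1%:R) = \prod_(1 <= j < k.+1) (al + 1 + j%:R).
  by apply: eq_bigr => j _; rewrite -(natr1 j); lra.
have -> : al + 1 + k%:R = al + k.+1%:R by rewrite -(natr1 k); lra.
by rewrite mulN1r !mulNr !mulrN mulrA.
Qed.

Lemma finite_part_Pf k u : (0 < k)%N -> finite_part (- k%:R) k u =
  (\int[mu]_(x in `]0%R, 1%R[)
     ((u x - \sum_(0 <= j < k) derive1n j u 0 * (x ^+ j / j`!%:R)) / x ^+ k))%R +
  (\int[mu]_(x in `]1%R, +oo[) (u x / x ^+ k))%R -
  \sum_(0 <= j < k.-1) derive1n j u 0 / (j`!%:R * (k.-1 - j)%:R).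
Proof.
case: k => // k _; rewrite /finite_part -sumrN; congr (_ + _ + _).
- apply: eq_Rintegral => x; rewrite inE/= in_itv/= => /andP[x0 _].
  rewrite powRN powR_mulrn ?(ltW x0)// mulrC /trem /taylor big_mkord; congr ((_ - _) * _).
  by apply: eq_bigr => j _; rewrite mulrA mulrAC.
- apply: eq_Rintegral => x; rewrite inE/= in_itv/= andbT => x1.
  by rewrite powRN powR_mulrn ?(ltW (lt_trans ltr01 x1))// mulrC.
(* The last index is the critical one and is left out by [finite_part], which is why the sum in [Pf]
   has one term less. *)
rewrite big_mkcond big_ord_recr/= addNr eqxx addr0 big_mkord.
apply: eq_bigr => j _; have jk := ltn_ord j.
have -> : - k.+1%:R + j.+1%:R = - (k - j)%:R :> R.
  by rewrite (natrB _ (ltnW jk)) -(natr1 j) -(natr1 k); lra.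
rewrite oppr_eq0 pnatr_eq0 subn_eq0 -ltnNge jk.
by rewrite invrN mulrN invfM mulrA.
Qed.

End ByParts.

(** * Asymptotic expansion of the extension *)

Section RealExpansion.
Context {R : realType} (s : ultraclass) (M : nat -> R).
Context (M_gt0 : forall p, 0 < M p).
Context (M_logconvex : forall p, (1 <= p)%N -> M p ^+ 2 <= M p.-1 * M p.+1).
Context (theta : R -> R) (smooth_theta : smooth theta)
  (theta0 : forall x, x <= 1 -> theta x = 0) (theta1 : forall x, 2 <= x -> theta x = 1)
  (bnd_theta : forall h, 0 < h -> exists N, bnd M h N setT theta).
Context (L : R -> R) (alpha c : R).
Context (sL : slowly_varying_at_origin L).
Local Notation rho := (fun e => e `^ alpha * L e).
Local Notation wtest := (wtest s M).
Local Notation ptest := (ptest s M).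
Local Notation Ilim := (fun u => c * pow_functional alpha u).
Local Notation T_ i := (transition_moment theta alpha i).

Context (f : (R -> R) -> R).
Context (f_lin : forall c u v, ptest u -> ptest v ->
  f (fun x => c * u x + v x) = c * f u + f v).
Context (f_dom : forall a b, 0 < a -> dominated_on s M f a b).
Context (f_quasi : forall u, ptest u -> fdil f e u / rho e @[e --> 0^'+] --> Ilim u).
Local Notation moment := (moment theta f).
Local Notation extension := (extension theta f).

(** A primitive of the integrand is the explicit power minus [G]. Thus [G 2 - G 1], which depends on
    [theta], can be traded for the transition moment. *)
Lemma transition_value (i : nat) G : (forall x : R, is_derive x (1 : R) G (x `^ (alpha + i%:R) * theta x)) ->
  alpha + i.+1%:R != 0 ->
  T_ i = (2 `^ (alpha + i.+1%:R) - 1) / (alpha + i.+1%:R) - (G 2 - G 1).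
Proof.
move=> dG sg0; have e1 : alpha + i%:R + 1 = alpha + i.+1%:R by rewrite -natr1 addrA.
have be1 : alpha + i%:R != -1 by rewrite -addr_eq0 e1.
pose F x := x `^ (alpha + i%:R + 1) / (alpha + i%:R + 1) - G x.
have dF (x : R) : 0 < x -> is_derive x (1 : R) F (x `^ alpha * ((1 - theta x) * x ^+ i)).
  move=> x0; have := is_deriveB (is_derive_powR_prim be1 x0) (dG x).
  by rewrite -[X in X - _ * _]mulr1 -mulrBr -powR_exprn// -mulrA (mulrC (x ^+ i)).
have cg : cont_pos (fun x => x `^ alpha * ((1 - theta x) * x ^+ i)).
  apply: cont_pos_powM => x; apply: cvgM; last exact: (smooth_continuous (@smooth_pow R i)).
  by apply: cvgB; [exact: cvg_cst | exact: (smooth_continuous smooth_theta)].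
have l12 : 1 <= 2 :> R by rewrite ler1n.
rewrite /transition_moment (ci_FTC ltr01 l12 cg dF) /F e1 powR1; ring.
Qed.

(** The value given by [stolz] contains [G 2 - G 1]; in terms of [T_ i], what remains is the
    coefficient [(alpha + i + 1)^-1] that the finite part requires. *)
Lemma moment_limit i : alpha + i.+1%:R < 0 ->
  (e^-1 ^+ i.+1 * moment i e) / rho e @[e --> 0^'+] --> - c * ((alpha + i.+1%:R)^-1 + T_ i).
Proof.
move=> sg0; pose sg := alpha + i.+1%:R.
have sgn : sg != 0 by rewrite lt_eqF.
have [G [dG G1 G2 _]] := theta_primitive smooth_theta theta0 theta1 (alpha + i%:R).
have e1 : alpha + i%:R + 1 = sg by rewrite /sg -natr1 addrA.
have tau1 : 2 `^ sg - 1 != 0.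
  have [/andP[_ t1] _ _] := rv_decays sL sg0; by rewrite subr_eq0 lt_eqF.
have W := moment_increment M_gt0 M_logconvex smooth_theta theta0 theta1 bnd_theta f_lin f_quasi (i := i) (ltr0Sn R 1).
have B := moment_bounded M_gt0 M_logconvex smooth_theta theta0 theta1 bnd_theta f_dom i.
have := stolz (rv_decays sL sg0) W B.
(* For [a = 2] the endpoint [B = 4] is the least allowed; it calls for [G] at 4 and at 2 only. *)
have four : 2 <= 4 :> R by rewrite ler_nat.
have ff : 2 * 2 <= 4 :> R by lra.
have p4 : 4 `^ sg = 2 `^ sg * 2 `^ sg :> R by rewrite -powRM//; congr (_ `^ _); lra.
rewrite (chi_pow_functional smooth_theta theta0 theta1 bnd_theta (ltr0Sn R 1) dG G1 four ff).
rewrite (G2 _ 4 four) e1// p4 (transition_value dG sgn) -/sg.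
have -> : 4 / 2 = 2 :> R by lra.
have -> : c * (2 `^ sg * (G 2 - G 1) - (G 2 + (2 `^ sg * 2 `^ sg - 2 `^ sg) / sg - G 1)) / (2 `^ sg - 1)
    = - c * (sg^-1 + ((2 `^ sg - 1) / sg - (G 2 - G 1))).
  by move: sgn tau1; move: (2 `^ sg) (sg) (G 2) (G 1) => y x z w x0 y0; field; rewrite x0 y0.
apply: cvg_trans; apply: near_eq_cvg; near=> e.
have e0 : e != 0 by rewrite gt_eqF.
by rewrite exprVn invfM; move: (_ * L e)^-1 (moment i e) (e ^+ _)^-1 => x y z; ring.
Unshelve. all: by end_near. Qed.

Lemma critical_scale i e : alpha + i.+1%:R = 0 -> 0 < e -> e ^+ i.+1 * rho e = L e.
Proof.
by move=> sg0 e0; rewrite mulrA (mulrC (e ^+ _)) powR_exprn// sg0 powRr0 mul1r.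
Qed.

(** At exponent 0 the dilation factor is 1 and the primitive is logarithmic, so only a difference of
    logarithms survives. *)
Lemma critical_moment_increment i a : alpha + i.+1%:R = 0 -> 0 < a ->
  (moment i (a * e) - moment i e) / L e @[e --> 0^'+] --> - c * ln a.
Proof.
move=> sg0 a0.
have [G [dG G1 _ G2]] := theta_primitive smooth_theta theta0 theta1 (alpha + i%:R).
have := moment_increment M_gt0 M_logconvex smooth_theta theta0 theta1 bnd_theta f_lin f_quasi (i := i) a0.
pose B := Num.max 2 (2 * a).
have B2 : 2 <= B by rewrite le_max lexx.
have Ba : 2 * a <= B by rewrite le_max lexx orbT.
have Ba2 : 2 <= B / a by rewrite ler_pdivlMr.
have B0 : 0 < B by apply: lt_le_trans B2.
rewrite (chi_pow_functional smooth_theta theta0 theta1 bnd_theta a0 dG G1 B2 Ba).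
have e1 : alpha + i%:R + 1 = 0 by rewrite -sg0 -natr1 addrA.
rewrite sg0 powRr0 mul1r (G2 e1 _ Ba2) (G2 e1 _ B2) ln_div ?posrE//.
have -> : c * (G 2 + (ln B - ln a - ln 2) - G 1 - (G 2 + (ln B - ln 2) - G 1)) = - c * ln a by ring.
apply: cvg_trans; apply: near_eq_cvg; near=> e.
have e0 : 0 < e by [].
by rewrite (critical_scale sg0 e0).
Unshelve. all: by end_near. Qed.

(* At most one index is critical, and only if [alpha] is a negative integer. *)
Definition correction m (u : R -> R) e := \sum_(i < m | alpha + i.+1%:R == 0)
  derive1n i u 0 / i`!%:R * (e^-1 ^+ i.+1 * (moment i e + c * T_ i * L e)).

(** The main terms bring [- T_ i] for every [i]. A noncritical moment brings [T_ i] and a term of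
    the finite part; [correction] removes a critical moment and supplies its [T_ i]. *)
Lemma extension_limit m u : 0 < alpha + m.+1%:R -> (forall i, (i < m)%N -> alpha + i.+1%:R <= 0) ->
  wtest u -> (fdil (extension m) e u + correction m u e) / rho e @[e --> 0^'+] -->
  c * finite_part alpha m u.
Proof.
move=> am ai wu.
have [V [HV EV]] := main_limit_value M_gt0 smooth_theta theta0 theta1 bnd_theta am wu.
have rp := rv_positive alpha sL.
have HcV : c * pow_functional alpha (fun x => chi theta (2 ^+ J) 1 x * trem m u x) @[J --> \oo] --> c * V by exact: cvgMr.
have H1 := extension_main_limit M_gt0 M_logconvex smooth_theta theta0 theta1 bnd_theta f_lin f_dom f_quasi
   rp (rv_ratio sL) am wu HcV.
pose w i := derive1n i u 0 / i`!%:R.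
pose D i := c * (if alpha + i.+1%:R == 0 then 0 else (alpha + i.+1%:R)^-1) + c * T_ i.
pose S i e := (if alpha + i.+1%:R == 0 then c * T_ i else - (e^-1 ^+ i.+1 * moment i e / rho e)).
have H2 i : (i < m)%N -> w i * S i e @[e --> 0^'+] --> w i * D i.
  move=> im; apply: cvgMr; rewrite /S /D; case: eqP => [_|/eqP sg0].
    by rewrite mulr0 add0r; exact: cvg_cst.
  have sg1 : alpha + i.+1%:R < 0 by rewrite lt_neqAle sg0 ai.
  have -> : c * (alpha + i.+1%:R)^-1 + c * T_ i = - (- c * ((alpha + i.+1%:R)^-1 + T_ i)) by ring.
  by apply: cvgN; exact: moment_limit.
have H3 : \sum_(i < m) w i * S i e @[e --> 0^'+] --> \sum_(i < m) w i * D i.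
  apply: cvg_big; first exact: add_continuous.
  by move=> i _; exact: H2 (ltn_ord i).
have H4 := cvgD H1 H3.
have -> : c * finite_part alpha m u = c * pow_functional alpha (fun x => theta x * u x) + c * V + \sum_(i < m) w i * D i.
  rewrite -mulrDr EV /finite_part /w; move: (\int[_]_(_ in _) _)%R (\int[_]_(_ in _) _)%R => x y.
  rewrite big_mkcond/= !mulrDr -[in RHS]addrA; congr (_ + _).
  rewrite mulrN !mulr_sumr -sumrN -big_split/=; apply: eq_bigr => i _; rewrite /D.
  by case: eqP => _ /=; ring.
have ev : \forall e \near 0^'+,
   (fdil f e (fun x => theta x * u x) + Sd_lim theta f m e u) / rho e + \sum_(i < m) w i * S i e =
   (fdil (extension m) e u + correction m u e) / rho e; last first.
  by apply: cvg_trans (near_eq_cvg ev) _; exact: H4.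
have /near0P[d d0 Hd] := rp; apply/near0P; exists d => // e ed.
have r0 := Hd e ed; have e0 : 0 < e by case/andP: ed.
rewrite (fdil_extension M_gt0 M_logconvex smooth_theta theta0 theta1 bnd_theta f_lin f_dom f_quasi rp
  (rv_ratio sL) am e0 wu).
rewrite -addrA [RHS]mulrDl; congr (_ + _).
rewrite /correction [X in _ + X]big_mkcond/= addrC -sumrB mulr_suml; apply: eq_bigr => i _.
rewrite /S -/(w i); case: eqP => [sg0|_]; last by ring.
rewrite -{1}(critical_scale sg0 e0) exprVn.
have ei : e ^+ i.+1 != 0 by rewrite gt_eqF// exprn_gt0.
move: r0 ei; rewrite /=; move: (_ * L e) (e ^+ _) => r x r0 x0.
by field; rewrite x0 gt_eqF.
Qed.

End RealExpansion.

(** * Ultradistributions *)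

Section ComplexTests.
Local Open Scope complex_scope.
Import ComplexField.Normc.
Context {R : realType} (s : ultraclass) (M : nat -> R).
Context (M_gt0 : forall p, 0 < M p).
Implicit Types (phi psi : R -> R[i]) (U K : set R) (z w : R[i]).
Local Notation Re := complex.Re.
Local Notation Im := complex.Im.

Definition rpart phi : R -> R := fun x => Re (phi x).
Definition ipart phi : R -> R := fun x => Im (phi x).

Lemma ReD z w : Re (z + w) = Re z + Re w. Proof. by case: z; case: w. Qed.
Lemma ImD z w : Im (z + w) = Im z + Im w. Proof. by case: z; case: w. Qed.
Lemma ReB z w : Re (z - w) = Re z - Re w. Proof. by case: z; case: w. Qed.
Lemma ImB z w : Im (z - w) = Im z - Im w. Proof. by case: z; case: w. Qed.
Lemma ReM z w : Re (z * w) = Re z * Re w - Im z * Im w. Proof. by case: z; case: w. Qed.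
Lemma ImM z w : Im (z * w) = Re z * Im w + Im z * Re w. Proof. by case: z; case: w. Qed.

Lemma eqC z w : Re z = Re w -> Im z = Im w -> z = w.
Proof. by case: z; case: w => /= a b c d -> ->. Qed.

Lemma abs_Re_le z : `|Re z| <= normc z.
Proof.
case: z => a b /=; rewrite -sqrtr_sqr ler_sqrt ?addr_ge0 ?sqr_ge0//.
by rewrite lerDl sqr_ge0.
Qed.

Lemma abs_Im_le z : `|Im z| <= normc z.
Proof.
case: z => a b /=; rewrite -sqrtr_sqr ler_sqrt ?addr_ge0 ?sqr_ge0//.
by rewrite lerDr sqr_ge0.
Qed.

Lemma normc_le z : normc z <= `|Re z| + `|Im z|.
Proof.
case: z => a b /=; have ab : 0 <= `|a| + `|b| by rewrite addr_ge0.
rewrite -(ger0_norm ab) -sqrtr_sqr ler_sqrt ?sqr_ge0//.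
rewrite sqrrD !real_normK ?num_real// -addrA (addrC (_ *+ 2)) addrA lerDl.
by rewrite mulrn_wge0// mulr_ge0.
Qed.

Lemma normc_real (a : R) : normc a%:C = `|a|.
Proof. by rewrite /= expr0n addr0 sqrtr_sqr. Qed.

Lemma cvg_complex (z : R -> R[i]) (l : R[i]) :
  (Re (z t) @[t --> 0^'+] --> Re l) -> (Im (z t) @[t --> 0^'+] --> Im l) ->
  (z t : R[i]^o) @[t --> 0^'+] --> (l : R[i]^o).
Proof.
move=> Hr Hi; apply/cvgrPdist_lt => -[e e'].
(* A positive element of [R[i]] is real. *)
rewrite ltcE/= => /andP[/eqP -> e0].
have e2 : 0 < e / 2 by lra.
have Hr' := (cvgrPdist_lt _ _).1 Hr _ e2; have Hi' := (cvgrPdist_lt _ _).1 Hi _ e2.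
near=> t; rewrite normc_def.
rewrite -[X in X < _]/((normc (Re (l - z t) +i* Im (l - z t)))%:C) -/(e%:C) ltcR.
apply: le_lt_trans (normc_le _) _; rewrite /= ReB ImB.
have h1 : `|Re l - Re (z t)| < e / 2 by near: t; exact: Hr'.
have h2 : `|Im l - Im (z t)| < e / 2 by near: t; exact: Hi'.
by lra.
Unshelve. all: by end_near. Qed.

Lemma cvg_complex_parts (z : R -> R[i]) (l : R[i]) :
  (z t : R[i]^o) @[t --> 0^'+] --> (l : R[i]^o) ->
  (Re (z t) @[t --> 0^'+] --> Re l) /\ (Im (z t) @[t --> 0^'+] --> Im l).
Proof.
move=> H.
have main (e : R) : 0 < e -> \forall t \near 0^'+, normc (l - z t) < e.
  move=> e0; have e0' : 0 < e%:C by rewrite ltcR.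
  have H' := (cvgrPdist_lt _ _).1 H _ e0'; near=> t.
  have : `|l - z t| < e%:C by near: t; exact: H'.
  rewrite normc_def.
  by rewrite -[X in X < _]/((normc (Re (l - z t) +i* Im (l - z t)))%:C) ltcR; case: (l - z t).
split; apply/cvgrPdist_lt => e e0; near=> t.
  rewrite -ReB; apply: le_lt_trans (abs_Re_le _) _; near: t; exact: main.
rewrite -ImB; apply: le_lt_trans (abs_Im_le _) _; near: t; exact: main.
Unshelve. all: by end_near. Qed.

Lemma fsupp_out phi K x : fsupp phi `<=` K -> ~ K x -> phi x = 0.
Proof.
move=> sK nK; apply: contrapT => /eqP p0; apply: nK; apply: sK.
by apply: subset_closure.
Qed.

Lemma off_fsupp phi x n : ~ fsupp phi x ->
  [/\ is_derive x (1 : R) (derive1n n (rpart phi)) 0, derive1n n (rpart phi) x = 0,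
      is_derive x (1 : R) (derive1n n (ipart phi)) 0 & derive1n n (ipart phi) x = 0].
Proof.
move=> nx; have oK : open (~` fsupp phi) by rewrite openC; exact: closed_closure.
have z y : (~` fsupp phi) y -> phi y = 0 by apply: fsupp_out.
have r0 y : (~` fsupp phi) y -> rpart phi y = 0 by move=> /z; rewrite /rpart => ->.
have i0 y : (~` fsupp phi) y -> ipart phi y = 0 by move=> /z; rewrite /ipart => ->.
have [? ?] := derive1n_open0 oK r0 n nx; have [? ?] := derive1n_open0 oK i0 n nx.
by split.
Qed.

(** Off its support [phi] vanishes on an open set, so smoothness on [U] extends to the whole
    line. *)
Lemma smooth_on_smooth U phi : fsupp phi `<=` U -> smooth_on U phi ->
  smooth (rpart phi) /\ smooth (ipart phi).
Proof.
move=> sU sm; split=> n x; have [Ux|nx] := pselect (fsupp phi x).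
- by have [] := sm n x (sU _ Ux).
- by have [d _ _ _] := off_fsupp n nx; exact: (@ex_derive _ _ _ _ _ _ _ d).
- by have [] := sm n x (sU _ Ux).
- by have [_ _ d _] := off_fsupp n nx; exact: (@ex_derive _ _ _ _ _ _ _ d).
Qed.

Lemma ultranorm_ge0 K h phi : (0 <= ultranorm M K h phi)%E.
Proof. by apply: ereal_sup_ubound; left. Qed.

Lemma ultranorm_bnd K h phi N : 0 < h -> fsupp phi `<=` K -> (ultranorm M K h phi <= N%:E)%E ->
  bnd M h N setT (rpart phi) /\ bnd M h N setT (ipart phi).
Proof.
move=> h0 sK un.
have N0 : 0 <= N by rewrite -lee_fin; apply: le_trans un; exact: ultranorm_ge0.
have main p x : fsupp phi x -> normc (cderivn p phi x) <= N * (h ^+ p * M p).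
  move=> fx; have hM : 0 < h ^+ p * M p by rewrite mulr_gt0// exprn_gt0.
  rewrite -ler_pdivrMr// -lee_fin; apply: le_trans un; apply: ereal_sup_ubound.
  by right; exists (p, x) => //; split => //; exact: sK.
have z p : 0 <= N * (h ^+ p * M p).
  by rewrite !mulr_ge0 ?exprn_ge0 ?(ltW h0) ?(ltW (M_gt0 p)).
split=> p x _; have [fx|nx] := pselect (fsupp phi x).
- exact: le_trans (abs_Re_le _) (main p x fx).
- by have [_ -> _ _] := off_fsupp p nx; rewrite normr0.
- exact: le_trans (abs_Im_le _) (main p x fx).
- by have [_ _ _ ->] := off_fsupp p nx; rewrite normr0.
Qed.

Lemma bnd_ultranorm K h phi N N' : 0 < h -> bnd M h N setT (rpart phi) -> bnd M h N' setT (ipart phi) ->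
  (ultranorm M K h phi <= (N + N')%:E)%E.
Proof.
move=> h0 b1 b2; apply: ge_ereal_sup => _ [->|[[p x] _ <-]].
  by rewrite lee_fin addr_ge0// (bnd_ge0 M_gt0 (I : setT (0 : R)) b1, bnd_ge0 M_gt0 (I : setT (0 : R)) b2).
have hM : 0 < h ^+ p * M p by rewrite mulr_gt0// exprn_gt0.
rewrite lee_fin -[(p, x).1]/p -[(p, x).2]/x ler_pdivrMr// mulrDl; apply: le_trans (normc_le _) _.
by apply: lerD; [exact: b1 | exact: b2].
Qed.

(** The dictionary between tests and bounds on real functions. One [h0] serves both parts, as the
    norm controls them jointly, and the support itself is a sufficient compact set. *)
Lemma testfunP U phi : testfun s M U phi <->
  [/\ compact (fsupp phi), fsupp phi `<=` U &
      exists h0, [/\ 0 < h0, cls s M h0 (rpart phi) & cls s M h0 (ipart phi)]].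
Proof.
split.
  move=> [[sm un] cK sU]; split => //.
  have [sr si] := smooth_on_smooth sU sm.
  have key h : 0 < h -> (ultranorm M (fsupp phi) h phi < +oo)%E -> exists N,
      bnd M h N setT (rpart phi) /\ bnd M h N setT (ipart phi).
    move=> h0 fin; exists (fine (ultranorm M (fsupp phi) h phi)).
    apply: (ultranorm_bnd h0 (@subset_refl _ _)); rewrite fineK//.
    by rewrite ge0_fin_numE// ultranorm_ge0.
  have := un _ cK sU; rewrite /cls /hset; case: s => [H|[h h0 H]].
    exists 1; split; [by []|split; [exact: sr|]|split; [exact: si|]] => h h0.
      by have [N [? ?]] := key h h0 (H h h0); exists N.
    by have [N [? ?]] := key h h0 (H h h0); exists N.
  have [N [b1 b2]] := key h h0 H.
  exists h; split; [by []|split; [exact: sr|]|split; [exact: si|]] => _ ->; by exists N.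
move=> [cK sU [h0 [h00 [sr br] [si bi]]]]; split => //; split.
  by move=> n x _; split; [exact: sr | exact: si].
move=> K _ _; have key h : hset s h0 h -> (ultranorm M K h phi < +oo)%E.
  move=> hh; have [N b1] := br h hh; have [N' b2] := bi h hh.
  exact: le_lt_trans (bnd_ultranorm K (hset_gt0 h00 hh) b1 b2) (ltry _).
move: key; rewrite /hset; case: s => key; last by exists h0 => //; exact: key.
by move=> h hh; exact: key.
Qed.

End ComplexTests.

Section ComplexFunctionals.
Local Open Scope complex_scope.
Import ComplexField.Normc.
Context {R : realType} (s : ultraclass) (M : nat -> R).
Context (M_gt0 : forall p, 0 < M p).
Implicit Types (phi psi : R -> R[i]) (U K : set R) (F G : functional R).
Local Notation Re := complex.Re.
Local Notation Im := complex.Im.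
Local Notation wtest := (wtest s M).
Local Notation ptest := (ptest s M).
Local Notation rt := (rt s M).

Lemma compact_hull K : compact K -> exists b, K `<=` `[- b, b].
Proof.
move=> /compact_bounded [B [Br HB]]; exists (B + 1) => x Kx /=.
have := HB (B + 1); rewrite ltrDl ltr01 => /(_ isT x Kx).
by rewrite in_itv/= ler_norml.
Qed.

Lemma compact_hull_pos K : compact K -> K `<=` `]0, +oo[ -> exists a b, 0 < a /\ K `<=` `[a, b].
Proof.
move=> cK sK; have [b Kb] := compact_hull cK.
have oK : open (~` K) by rewrite openC; exact: compact_closed.
have nK : (~` K) 0 by move=> /sK; rewrite /= in_itv/= ltxx.
have /nbhs_ballP[a /= a0 Ha] : nbhs 0 (~` K) by exact: open_nbhs_nbhs.
exists a, b; split => // x Kx.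
have := Kb x Kx; rewrite /= !in_itv/= => /andP[_ ->]; rewrite andbT.
rewrite leNgt; apply/negP => xa; have := sK x Kx; rewrite /= in_itv/= andbT => x0.
by apply: (Ha x _ Kx); rewrite /ball/= sub0r normrN gtr0_norm.
Qed.

Lemma rt_testfun h0 a b U phi : 0 < h0 -> `[a, b] `<=` U ->
  rt h0 a b (rpart phi) -> rt h0 a b (ipart phi) ->
  testfun s M U phi /\ fsupp phi `<=` `[a, b].
Proof.
move=> h00 abU [sr r0 br] [si i0 bi].
have sab : fsupp phi `<=` `[a, b].
  have cab : closed (`[a, b]%classic : set R) by exact: itv_closed.
  rewrite [X in _ `<=` X]((closure_id _).1 cab).
  apply: closure_subset => x /= /eqP px; rewrite in_itv/=; apply: contrapT => /negP nx; apply: px.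
  by apply: eqC; [exact: r0 nx | exact: i0 nx].
split => //; apply/(testfunP s M_gt0); split.
- apply: subclosed_compact sab; last exact: segment_compact.
  exact: closed_closure.
- exact: subset_trans sab abU.
- by exists h0.
Qed.

Lemma testfun_rt U phi a b : testfun s M U phi -> fsupp phi `<=` `[a, b] ->
  exists h0, [/\ 0 < h0, rt h0 a b (rpart phi) & rt h0 a b (ipart phi)].
Proof.
move=> /(testfunP s M_gt0) [_ _ [h0 [h00 [sr br] [si bi]]]] sab.
have z x : ~~ (a <= x <= b) -> phi x = 0.
  by move=> /negP nx; apply: fsupp_out sab _ => /=; rewrite in_itv.
exists h0; split; [exact: h00|split; [exact: sr| |exact: br]|split; [exact: si| |exact: bi]].
  by move=> x /z; rewrite /rpart => ->.
by move=> x /z; rewrite /ipart => ->.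
Qed.

Lemma testfun_wtest phi : testfun s M setT phi -> wtest (rpart phi) /\ wtest (ipart phi).
Proof.
move=> tp; have [_ cK _] := tp; have [b sb] := compact_hull cK.
have [h0 [h00 r1 r2]] := testfun_rt tp sb.
by split; exists h0, (- b), b.
Qed.

Lemma testfun_ptest phi : testfun s M `]0, +oo[ phi -> ptest (rpart phi) /\ ptest (ipart phi).
Proof.
move=> tp; have [_ cK sK] := tp; have [a [b [a0 sb]]] := compact_hull_pos cK sK.
have [h0 [h00 r1 r2]] := testfun_rt tp sb.
by split; exists h0, a, b.
Qed.

Lemma itv_pos (a b : R) : 0 < a -> (`[a, b] : set R) `<=` `]0, +oo[.
Proof.
by move=> a0 x /=; rewrite !in_itv/= andbT => /andP[ax _]; exact: lt_le_trans ax.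
Qed.

Lemma ptest_testfun u : ptest u -> testfun s M `]0, +oo[ (fun x => (u x)%:C).
Proof.
move=> [h0 [a [b [h00 a0 ru]]]].
have [] := @rt_testfun h0 a b `]0, +oo[ (fun x => (u x)%:C) h00 (@itv_pos a b a0) ru (rt0 s M h0 a b).
by [].
Qed.

Definition clinear U F := forall (a : R[i]) phi psi, testfun s M U phi -> testfun s M U psi ->
  F (fun x => a * phi x + psi x) = a * F phi + F psi.

Definition cdominated U F := forall a b h0, `[a, b] `<=` U -> 0 < h0 -> exists h C,
  [/\ hset s h0 h, 0 <= C & forall phi N, rt h0 a b (rpart phi) -> rt h0 a b (ipart phi) ->
    bnd M h N setT (rpart phi) -> bnd M h N setT (ipart phi) -> normc (F phi) <= C * N].

Lemma testfun0 U : testfun s M U (fun=> 0).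
Proof.
have e : fsupp (fun=> 0 : R[i]) = set0 :> set R.
  rewrite /fsupp (_ : [set x | _] = set0) ?closure0//.
  by apply/seteqP; split => x //=; rewrite eqxx.
apply/(testfunP s M_gt0); rewrite e; split; [exact: compact0|exact: sub0set|].
by exists 1; split; [by []| |]; have [? _ ?] := rt0 s M 1 0 0; split.
Qed.

Lemma clinear0 U F : clinear U F -> F (fun=> 0) = 0.
Proof.
move=> lF; have := lF 1 _ _ (testfun0 U) (testfun0 U).
rewrite (_ : (fun x : R => _) = (fun=> 0)); last by apply/funext => x; rewrite mulr0 addr0.
by rewrite mul1r => /eqP; rewrite -subr_eq0 opprD addNKr oppr_eq0 => /eqP.
Qed.

Lemma clinearZ U F a phi : clinear U F -> testfun s M U phi -> F (fun x => a * phi x) = a * F phi.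
Proof.
move=> lF tp; rewrite -[RHS]addr0 -(clinear0 lF) -(lF a _ _ tp (testfun0 U)).
by congr F; apply/funext => x; rewrite addr0.
Qed.

(** Continuity at 0 gives a seminorm [q] such that [q < 1] forces the modulus of [F] below 1;
    applying this to [phi] divided by the modulus of [F phi] gives the estimate. The factor 2 in the
    constant accounts for the real and imaginary parts. *)
Lemma ultradistribution_dominated U F : ultradistribution s M U F -> cdominated U F.
Proof.
move=> [lF cF] a b h0 abU h00.
have [q [_ qZ qK] Hq] := cF _ (testfun0 U) 1 ltr01.
have cab : compact (`[a, b]%classic : set R) by exact: segment_compact.
have [h [C [hh C0 HC]]] : exists h C, [/\ hset s h0 h, 0 < C & forall phi,
    testfun_in s M U `[a, b] phi -> ((q phi)%:E <= C%:E * ultranorm M `[a, b] h phi)%E].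
  have := qK _ cab abU; rewrite /hset; case: s => [[h hgt [C C0 HC]]|HK]; first by exists h, C.
  by have [C C0 HC] := HK h0 h00; exists h0, C.
exists h, (C * 2); split; [exact: hh | by rewrite mulr_ge0// ltW |].
move=> phi N r1 r2 b1 b2; have [tp sp] := rt_testfun h00 abU r1 r2.
have N0 := bnd_ge0 M_gt0 (I : setT (0 : R)) b1.
have qN : q phi <= C * 2 * N.
  rewrite -lee_fin; apply: le_trans (HC phi (conj tp sp)) _.
  rewrite -mulrA mulr2n mulrDl mul1r EFinM; apply: lee_wpmul2l; first by rewrite lee_fin ltW.
  exact: bnd_ultranorm (hset_gt0 h00 hh) b1 b2.
rewrite leNgt; apply/negP => Nt; have t0 : 0 < normc (F phi).
  by apply: le_lt_trans Nt; rewrite !mulr_ge0// ltW.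
pose t := normc (F phi); have ta : normc (t^-1)%:C = t^-1.
  by rewrite normc_real ger0_norm// invr_ge0 ltW.
have tp' : testfun s M U (fun x => (t^-1)%:C * phi x).
  have sc u : rt h0 a b u -> rt h0 a b (fun x => t^-1 * u x).
    move=> ru; have := rt_lin t^-1 ru (rt0 s M h0 a b).
    by under eq_fun do rewrite addr0.
  have [] := @rt_testfun h0 a b U (fun x => (t^-1)%:C * phi x) h00 abU; last by [].
    have -> : rpart (fun x => (t^-1)%:C * phi x) = (fun x => t^-1 * rpart phi x).
      by apply/funext => x; rewrite /rpart ReM/= mul0r subr0.
    exact: sc.
  have -> : ipart (fun x => (t^-1)%:C * phi x) = (fun x => t^-1 * ipart phi x).
    by apply/funext => x; rewrite /ipart ImM/= mul0r addr0.
  exact: sc.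
have := Hq _ tp'.
have -> : (fun x => (t^-1)%:C * phi x - 0) = (fun x => (t^-1)%:C * phi x).
  by apply/funext => x; rewrite subr0.
rewrite qZ// ta (clinear0 lF) subr0 (clinearZ _ lF tp) normcM ta mulVf ?gt_eqF//.
rewrite mulrC ltr_pdivrMr// mul1r => /(_ (le_lt_trans qN Nt)).
by rewrite ltxx.
Qed.

(** Aimed at the Roumieu case: a test comes with a parameter of its own, and finiteness of the norm
    at [h] places it in the class [h0 = h]. *)
Lemma finite_ultranorm_cls U K h0 h phi : testfun s M U phi -> fsupp phi `<=` K -> 0 < h0 ->
  hset s h0 h -> (ultranorm M K h phi < +oo)%E -> cls s M h0 (rpart phi) /\ cls s M h0 (ipart phi).
Proof.
move=> /(testfunP s M_gt0) [_ _ [h1 [h10 [sr br] [si bi]]]] sK h00 hh fin.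
have [b1 b2] := ultranorm_bnd M_gt0 (hset_gt0 h00 hh) sK (N := fine (ultranorm M K h phi))
  ltac:(by rewrite fineK// ge0_fin_numE// ultranorm_ge0).
move: hh br bi; rewrite /cls /hset; case: s => /= hh br bi; first by [].
rewrite -hh.
by split; split; [exact: sr | move=> _ ->; exists (fine (ultranorm M K h phi))
  | exact: si | move=> _ ->; exists (fine (ultranorm M K h phi))].
Qed.

(** The modulus of [F] divided by [e] is itself a continuous seminorm. *)
Lemma dominated_ultradistribution F : clinear setT F -> cdominated setT F ->
  ultradistribution s M setT F.
Proof.
move=> lF dF; split => // phi0 tp0 e e0.
exists (fun phi => normc (F phi) / e); last first.
  move=> phi tp; rewrite ltr_pdivrMr// mul1r.
  have -> : (fun x => phi x - phi0 x) = (fun x => -1 * phi0 x + phi x).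
    by apply/funext => x; rewrite mulN1r addrC.
  by rewrite lF// mulN1r addrC.
split.
- move=> phi psi tp tq; have -> : (fun x => phi x + psi x) = (fun x => 1 * phi x + psi x).
    by apply/funext => x; rewrite mul1r.
  by rewrite lF// mul1r -mulrDl ler_pM2r ?invr_gt0// le_normcD.
- by move=> a phi tp; rewrite (clinearZ _ lF tp) normcM mulrA.
move=> K cK _ dominated; have [b Kb] := compact_hull cK.
have main h0 : 0 < h0 -> exists2 h, hset s h0 h & dominated h.
  move=> h00; have [h [C [hh C0 H]]] := dF (- b) b h0 (@subsetT _ _) h00.
  have c0 : 0 < (C + 1) / e by rewrite divr_gt0// ltr_wpDl.
  exists h => //; exists ((C + 1) / e) => // phi [tp sp].
  have u0 := ultranorm_ge0 M K h phi.
  (* In the Roumieu case the norm at [h] may be infinite; the bound is then trivial. *)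
  have [fin|] := ltP (ultranorm M K h phi) +oo%E; last first.
    by rewrite leye_eq => /eqP ->; rewrite gt0_muley ?lte_fin// leey.
  have [[sr br] [si bi]] := finite_ultranorm_cls tp sp h00 hh fin.
  have z x : ~~ (- b <= x <= b) -> phi x = 0.
    by move=> /negP nx; apply: fsupp_out (subset_trans sp Kb) _ => /=; rewrite in_itv.
  have r1 : rt h0 (- b) b (rpart phi).
    by split; [exact: sr| |exact: br] => x /z; rewrite /rpart => ->.
  have r2 : rt h0 (- b) b (ipart phi).
    by split; [exact: si| |exact: bi] => x /z; rewrite /ipart => ->.
  have fE : ultranorm M K h phi = (fine (ultranorm M K h phi))%:E.
    by rewrite fineK// ge0_fin_numE.
  have [b1 b2] := ultranorm_bnd M_gt0 (hset_gt0 h00 hh) sp (N := fine (ultranorm M K h phi)) ltac:(by rewrite -fE).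
  rewrite fE -EFinM lee_fin mulrAC ler_pM2r ?invr_gt0//.
  apply: le_trans (H phi _ r1 r2 b1 b2) _; apply: ler_wpM2r; last by rewrite lerDl.
  by rewrite -lee_fin -fE.
move: main; rewrite /hset; case: s => main.
  by have [h] := main 1 ltr01; exists h.
by move=> h h0; have [_ ->] := main h h0.
Qed.

End ComplexFunctionals.

Section Complexification.
Local Open Scope complex_scope.
Import ComplexField.Normc.
Context {R : realType} (s : ultraclass) (M : nat -> R).
Context (M_gt0 : forall p, 0 < M p).
Implicit Types (phi psi : R -> R[i]) (U K : set R) (F G : functional R) (u v : R -> R).
Local Notation Re := complex.Re.
Local Notation Im := complex.Im.
Local Notation wtest := (wtest s M).
Local Notation ptest := (ptest s M).
Local Notation rt := (rt s M).
Local Notation mu := (@lebesgue_measure R).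

Definition repart F u := Re (F (fun x => (u x)%:C)).
Definition impart F u := Im (F (fun x => (u x)%:C)).
(** The complex linear extension of [A + iB]. A functional takes complex values even on real tests,
    so two real functionals are needed. *)
Definition cpair (A B : (R -> R) -> R) : functional R := fun phi =>
  (A (rpart phi) - B (ipart phi)) +i* (B (rpart phi) + A (ipart phi)).

Lemma parts_lin F c u v : clinear s M `]0, +oo[ F -> ptest u -> ptest v ->
  repart F (fun x => c * u x + v x) = c * repart F u + repart F v /\
  impart F (fun x => c * u x + v x) = c * impart F u + impart F v.
Proof.
move=> lF pu pv; rewrite /repart /impart.
have -> : (fun x => (c * u x + v x)%:C) = (fun x => c%:C * (u x)%:C + (v x)%:C).
  by apply/funext => x; rewrite rmorphD rmorphM.
rewrite lF; [|exact: (ptest_testfun M_gt0)|exact: (ptest_testfun M_gt0)].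
by rewrite ReD ImD ReM ImM /= !mul0r subr0 addr0.
Qed.

Lemma parts_dominated F a b : cdominated s M `]0, +oo[ F -> 0 < a ->
  dominated_on s M (repart F) a b /\ dominated_on s M (impart F) a b.
Proof.
move=> dF a0; have abU := @itv_pos _ a b a0.
have main h0 : 0 < h0 -> exists h C, [/\ hset s h0 h, 0 <= C & forall u N,
    rt h0 a b u -> bnd M h N setT u -> normc (F (fun x => (u x)%:C)) <= C * N].
  move=> h00; have [h [C [hh C0 H]]] := dF a b h0 abU h00.
  exists h, C; split; [exact: hh | exact: C0 |] => u N ru bu.
  have N0 := bnd_ge0 M_gt0 (I : setT (0 : R)) bu.
  exact: (H (fun x => (u x)%:C) N ru (rt0 s M h0 a b) bu (bnd0 M_gt0 (hset_gt0 h00 hh) N0)).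
split=> h0 h00; have [h [C [hh C0 H]]] := main h0 h00; exists h, C.
  by split; [exact: hh | exact: C0 |] => u N ru bu; apply: le_trans (H u N ru bu); exact: abs_Re_le.
by split; [exact: hh | exact: C0 |] => u N ru bu; apply: le_trans (H u N ru bu); exact: abs_Im_le.
Qed.

Lemma parts_eq F phi : clinear s M `]0, +oo[ F -> testfun s M `]0, +oo[ phi ->
  F phi = cpair (repart F) (impart F) phi.
Proof.
move=> lF tp; have [pr pi] := testfun_ptest M_gt0 tp.
have -> : F phi = F (fun x => 'i * (ipart phi x)%:C + (rpart phi x)%:C).
  by congr F; apply/funext => x; apply: eqC; rewrite ?ReD ?ImD ?ReM ?ImM /rpart /ipart/=; ring.
rewrite lF; [|exact: (ptest_testfun M_gt0)|exact: (ptest_testfun M_gt0)].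
by apply: eqC; rewrite /cpair /repart /impart ?ReD ?ImD ?ReM ?ImM/=; ring.
Qed.

Lemma cpair_linear A B :
  (forall c u v, wtest u -> wtest v -> A (fun x => c * u x + v x) = c * A u + A v) ->
  (forall c u v, wtest u -> wtest v -> B (fun x => c * u x + v x) = c * B u + B v) ->
  clinear s M setT (cpair A B).
Proof.
move=> lA lB a phi psi tp tq.
have [pr pi] := testfun_wtest M_gt0 tp; have [qr qi] := testfun_wtest M_gt0 tq.
have er : rpart (fun x => a * phi x + psi x) =
    (fun x => Re a * rpart phi x + (- Im a * ipart phi x + rpart psi x)).
  by apply/funext => x; rewrite /rpart ReD ReM /ipart; ring.
have ei : ipart (fun x => a * phi x + psi x) =
    (fun x => Im a * rpart phi x + (Re a * ipart phi x + ipart psi x)).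
  by apply/funext => x; rewrite /ipart ImD ImM /rpart; ring.
have w1 : wtest (fun x => - Im a * ipart phi x + rpart psi x) by exact: wtest_lin.
have w2 : wtest (fun x => Re a * ipart phi x + ipart psi x) by exact: wtest_lin.
rewrite /cpair er ei !lA// !lB//.
by apply: eqC; rewrite ?ReD ?ImD ?ReM ?ImM/=; ring.
Qed.

Lemma cpair_dominated A B : (forall a b, dominated_on s M A a b) ->
  (forall a b, dominated_on s M B a b) -> cdominated s M setT (cpair A B).
Proof.
move=> dA dB a b h0 _ h00.
have [h [C [hh C0 HA]]] := dA a b h0 h00; have [h' [C' [hh' C0' HB]]] := dB a b h0 h00.
have hm := hset_min hh hh'; have m0 := hset_gt0 h00 hm.
exists (Num.min h h'), (2 * (C + C')); split; [exact: hm | by rewrite mulr_ge0// addr_ge0 |].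
move=> phi N r1 r2 b1 b2.
have [b1h b1h'] := bnd_min M_gt0 m0 b1; have [b2h b2h'] := bnd_min M_gt0 m0 b2.
have := HA _ _ r1 b1h; have := HA _ _ r2 b2h; have := HB _ _ r1 b1h'; have := HB _ _ r2 b2h'.
move=> H1 H2 H3 H4; apply: le_trans (normc_le _) _; rewrite /cpair/=.
apply: le_trans (lerD (ler_normB _ _) (ler_normD _ _)) _.
have -> : 2 * (C + C') * N = (C * N + C' * N) + (C' * N + C * N) by ring.
by apply: lerD; apply: lerD.
Qed.

Lemma dilate_cpair e A B phi : dilate e (cpair A B) phi =
  cpair (fdil A e) (fdil B e) phi.
Proof.
have er : rpart (fun x => phi (x / e)) = fun x => rpart phi (e^-1 * x).
  by apply/funext => x; rewrite /rpart mulrC.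
have ei : ipart (fun x => phi (x / e)) = fun x => ipart phi (e^-1 * x).
  by apply/funext => x; rewrite /ipart mulrC.
rewrite /dilate /cpair er ei /fdil.
by apply: eqC; rewrite ?ReM ?ImM/=; ring.
Qed.

Lemma Re_div z (r : R) : Re (z / r%:C) = Re z / r.
Proof. by rewrite -fmorphV ReM/= mulr0 subr0. Qed.

Lemma Im_div z (r : R) : Im (z / r%:C) = Im z / r.
Proof. by rewrite -fmorphV ImM/= mulr0 add0r. Qed.

Lemma Re_sum (I : Type) (r : seq I) (z : I -> R[i]) :
  Re (\sum_(i <- r) z i) = \sum_(i <- r) Re (z i).
Proof. exact: (big_morph _ ReD erefl). Qed.

Lemma Im_sum (I : Type) (r : seq I) (z : I -> R[i]) :
  Im (\sum_(i <- r) z i) = \sum_(i <- r) Im (z i).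
Proof. exact: (big_morph _ ImD erefl). Qed.

Lemma xpow_parts alpha phi :
  xpow alpha phi = pow_functional alpha (rpart phi) +i* pow_functional alpha (ipart phi).
Proof.
rewrite /xpow /cintegral /pow_functional; congr (_ +i* _); apply: eq_Rintegral => x _.
  by rewrite ReM/= mul0r subr0.
by rewrite ImM/= mul0r addr0.
Qed.

Lemma parts_quasi F (rho : R -> R) (alpha : R) c :
  quasiasymptotic s M `]0, +oo[ F rho (fun phi => c * xpow alpha phi) -> forall u, ptest u ->
  (fdil (repart F) e u / rho e @[e --> 0^'+] --> Re c * pow_functional alpha u) /\
  (fdil (impart F) e u / rho e @[e --> 0^'+] --> Im c * pow_functional alpha u).
Proof.
move=> qF u pu; have [] := cvg_complex_parts (qF _ (ptest_testfun M_gt0 pu)).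
rewrite xpow_parts ReM ImM.
have -> : pow_functional alpha (ipart (fun x => (u x)%:C)) = 0.
  rewrite /pow_functional (@eq_Rintegral _ _ _ _ _ (fun=> 0)); last by move=> x _; rewrite mulr0.
  by rewrite /Rintegral integral0.
rewrite !mulr0 subr0 add0r => Hr Hi.
split.
  apply: cvg_trans Hr; apply: near_eq_cvg; near=> e.
  rewrite Re_div /dilate ReM /= mul0r subr0 /fdil /repart; congr (_ * Re (F _) / _).
  by apply/funext => x; rewrite mulrC.
apply: cvg_trans Hi; apply: near_eq_cvg; near=> e.
rewrite Im_div /dilate ImM /= mul0r addr0 /fdil /impart; congr (_ * Im (F _) / _).
by apply/funext => x; rewrite mulrC.
Unshelve. all: by end_near. Qed.

Definition cfinite_part (alpha : R) m phi : R[i] :=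
  finite_part alpha m (rpart phi) +i* finite_part alpha m (ipart phi).

Lemma cfinite_part_xplus alpha phi : (forall i : nat, alpha + i.+1%:R != 0) -> testfun s M setT phi ->
  cfinite_part alpha (Num.truncn (- alpha)) phi = xplus alpha phi.
Proof.
move=> nz tp; have [wr wi] := testfun_wtest M_gt0 tp.
pose k := Num.truncn (- alpha).
have ak : 0 < alpha + k.+1%:R by have := truncnS_gt (- alpha); rewrite -/k; lra.
have br := wtest_bounded_test M_gt0 wr; have bi := wtest_bounded_test M_gt0 wi.
rewrite /cfinite_part !finite_part_xplus//.
rewrite /xplus -/k /uderivn xpow_parts.
have -> : (-1) ^+ k = ((-1) ^+ k)%:C :> R[i] by rewrite rmorphXn rmorphN1.
by apply: eqC; rewrite ?ReM ?ImM ?ReM ?ImM/= !mul0r ?subr0 ?addr0.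
Qed.

Lemma cfinite_part_Pf k phi : (0 < k)%N -> cfinite_part (- k%:R) k phi = Pf k phi.
Proof.
move=> k0; rewrite /cfinite_part !finite_part_Pf// /Pf /cintegral.
apply: eqC; rewrite ?ReB ?ImB ?ReD ?ImD/= ?Re_sum ?Im_sum.
  congr (_ + _ - _).
  - apply: eq_Rintegral => x _; rewrite -/(Re (_ / _)).
    rewrite Re_div ReB Re_sum; congr ((_ - _) / _).
    by apply: eq_bigr => j _; rewrite ReM/= mulr0 subr0.
  - by apply: eq_Rintegral => x _; rewrite Re_div.
  - by apply: eq_bigr => j _; rewrite Re_div.
congr (_ + _ - _).
- apply: eq_Rintegral => x _.
  rewrite Im_div ImB Im_sum; congr ((_ - _) / _).
  by apply: eq_bigr => j _; rewrite ImM/= mulr0 add0r.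
- by apply: eq_Rintegral => x _; rewrite Im_div.
- by apply: eq_bigr => j _; rewrite Im_div.
Qed.

End Complexification.

Section Assembly.
Local Open Scope complex_scope.
Import ComplexField.Normc.
Context {R : realType} (s : ultraclass) (M : nat -> R).
Context (M_gt0 : forall p, 0 < M p).
Context (M_logconvex : forall p, (1 <= p)%N -> M p ^+ 2 <= M p.-1 * M p.+1).
Context (theta : R -> R) (smooth_theta : smooth theta)
  (theta0 : forall x, x <= 1 -> theta x = 0) (theta1 : forall x, 2 <= x -> theta x = 1)
  (bnd_theta : forall h, 0 < h -> exists N, bnd M h N setT theta).
Context (L : R -> R) (alpha : R) (c : R[i]) (sL : slowly_varying_at_origin L).
Context (f0 : functional R) (uf0 : ultradistribution s M `]0, +oo[ f0).
Local Notation rho := (fun e => e `^ alpha * L e).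
Context (qf0 : quasiasymptotic s M `]0, +oo[ f0 rho (fun phi => c * xpow alpha phi)).
Local Notation Re := complex.Re.
Local Notation Im := complex.Im.
Local Notation wtest := (wtest s M).
Local Notation ptest := (ptest s M).
Local Notation A := (repart f0).
Local Notation B := (impart f0).
Implicit Types (phi psi : R -> R[i]).

Let lf0 : clinear s M `]0, +oo[ f0 := uf0.1.
Let A_lin c u v (pu : ptest u) (pv : ptest v) := (parts_lin M_gt0 c lf0 pu pv).1.
Let B_lin c u v (pu : ptest u) (pv : ptest v) := (parts_lin M_gt0 c lf0 pu pv).2.
Let A_dom a b (a0 : 0 < a) := (parts_dominated M_gt0 b (ultradistribution_dominated M_gt0 uf0) a0).1.
Let B_dom a b (a0 : 0 < a) := (parts_dominated M_gt0 b (ultradistribution_dominated M_gt0 uf0) a0).2.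
Let A_quasi u (pu : ptest u) := (parts_quasi M_gt0 qf0 pu).1.
Let B_quasi u (pu : ptest u) := (parts_quasi M_gt0 qf0 pu).2.
Let rho_pos := rv_positive alpha sL.
Let rho_ratio := rv_ratio (alpha := alpha) sL.

Definition cextension m : functional R := cpair (extension theta A m) (extension theta B m).

Definition ccorrection m e : functional R :=
  cpair (fun u => correction theta L alpha (Re c) A m u e)
        (fun u => correction theta L alpha (Im c) B m u e).

Lemma cextension_ultradistribution m : 0 < alpha + m.+1%:R ->
  ultradistribution s M setT (cextension m).
Proof.
move=> am; apply: (dominated_ultradistribution M_gt0).
  apply: (cpair_linear M_gt0) => x u v wu wv.
    exact: (extension_lin M_gt0 M_logconvex smooth_theta theta0 theta1 bnd_theta A_lin A_dom
      A_quasi rho_pos rho_ratio x am wu wv).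
  exact: (extension_lin M_gt0 M_logconvex smooth_theta theta0 theta1 bnd_theta B_lin B_dom
    B_quasi rho_pos rho_ratio x am wu wv).
apply: (cpair_dominated M_gt0) => a b.
  exact: (extension_dominated M_gt0 M_logconvex smooth_theta theta0 theta1 bnd_theta A_lin A_dom
    A_quasi rho_pos rho_ratio).
exact: (extension_dominated M_gt0 M_logconvex smooth_theta theta0 theta1 bnd_theta B_lin B_dom
  B_quasi rho_pos rho_ratio).
Qed.

Lemma cextension_extends m : extends s M `]0, +oo[ f0 (cextension m).
Proof.
move=> phi tp; rewrite (parts_eq M_gt0 lf0 tp) /cextension /cpair.
have [pr pi] := testfun_ptest M_gt0 tp.
have EA := extension_extends M_gt0 M_logconvex smooth_theta theta0 theta1 bnd_theta A_lin m.
have EB := extension_extends M_gt0 M_logconvex smooth_theta theta0 theta1 bnd_theta B_lin m.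
by rewrite !EA// !EB.
Qed.

Lemma cextension_negative m b phi : b < 0 -> testfun s M setT phi -> fsupp phi `<=` `]-oo, b] ->
  cextension m phi = 0.
Proof.
move=> b0 tp sb; have [_ cK _] := tp; have [d sd] := compact_hull cK.
have sdb : fsupp phi `<=` `[- d, b].
  by move=> x /[dup] /sd + /sb; rewrite /= !in_itv/= => /andP[-> _] ->.
have [h0 [h00 r1 r2]] := testfun_rt M_gt0 tp sdb.
have EA := extension_negative theta0 A_lin m b0.
have EB := extension_negative theta0 B_lin m b0.
by rewrite /cextension /cpair (EA _ _ _ r1) (EA _ _ _ r2) (EB _ _ _ r1) (EB _ _ _ r2) subr0 addr0.
Qed.

Lemma cextension_limit m phi : 0 < alpha + m.+1%:R ->
  (forall i, (i < m)%N -> alpha + i.+1%:R <= 0) -> testfun s M setT phi ->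
  ((dilate e (cextension m) phi + ccorrection m e phi) / (rho e)%:C : R[i]^o) @[e --> 0^'+] -->
  (c * cfinite_part alpha m phi : R[i]^o).
Proof.
move=> am ai tp; have [wr wi] := testfun_wtest M_gt0 tp.
have HA u := extension_limit M_gt0 M_logconvex smooth_theta theta0 theta1 bnd_theta sL A_lin A_dom
  A_quasi am ai (u := u).
have HB u := extension_limit M_gt0 M_logconvex smooth_theta theta0 theta1 bnd_theta sL B_lin B_dom
  B_quasi am ai (u := u).
pose X D c (G : (R -> R) -> R) u e : R := (fdil (extension theta G m) e u + correction theta L alpha c G m u e) / D e.
apply: cvg_complex.
  rewrite ReM/=; have H := cvgB (HA _ wr) (HB _ wi).
  have ev : \forall e \near 0^'+, X rho (Re c) A (rpart phi) e - X rho (Im c) B (ipart phi) e =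
      Re ((dilate e (cextension m) phi + ccorrection m e phi) / (rho e)%:C).
    near=> e; rewrite Re_div ReD dilate_cpair /ccorrection /cpair/= /X.
    by ring.
  by apply: cvg_trans (near_eq_cvg ev) _; exact: H.
rewrite ImM/=; have H := cvgD (HA _ wi) (HB _ wr).
have ev : \forall e \near 0^'+, X rho (Re c) A (ipart phi) e + X rho (Im c) B (rpart phi) e =
    Im ((dilate e (cextension m) phi + ccorrection m e phi) / (rho e)%:C).
  near=> e; rewrite Im_div ImD dilate_cpair /ccorrection /cpair/= /X.
  by ring.
by apply: cvg_trans (near_eq_cvg ev) _; exact: H.
Unshelve. all: by end_near. Qed.

(** At [x > 0] both functionals agree with [f0]; at [x < 0] each vanishes near [x]. *)
Lemma usupport_difference f m : 0 < alpha + m.+1%:R ->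
  ultradistribution s M setT f -> extends s M `]0, +oo[ f0 f -> usupport s M f `<=` `[0, +oo[ ->
  ultradistribution s M setT (fun phi => f phi - cextension m phi) /\
  usupport s M (fun phi => f phi - cextension m phi) `<=` [set 0].
Proof.
move=> am uf ef sf; have uF := cextension_ultradistribution am; split.
  have [lf _] := uf; have [lF _] := uF.
  apply: (dominated_ultradistribution M_gt0).
    by move=> a phi psi tp tq; rewrite lf// lF//; ring.
  move=> a b h0 ab h00.
  have [h [C [hh C0 H]]] := ultradistribution_dominated M_gt0 uf ab h00.
  have [h' [C' [hh' C0' H']]] := ultradistribution_dominated M_gt0 uF ab h00.
  have hm := hset_min hh hh'; have m0 := hset_gt0 h00 hm.
  exists (Num.min h h'), (C + C'); split; [exact: hm | exact: addr_ge0 |].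
  move=> phi N r1 r2 b1 b2.
  have [b1h b1h'] := bnd_min M_gt0 m0 b1; have [b2h b2h'] := bnd_min M_gt0 m0 b2.
  apply: le_trans (le_normcD _ _) _; rewrite normcN mulrDl.
  by apply: lerD; [exact: H | exact: H'].
move=> x nx; apply: contrapT => /= /eqP; rewrite neq_lt => /orP[x0|x0]; last first.
  apply: nx; exists (`]0, +oo[%classic : set R); split; [exact: interval_open | by rewrite /= in_itv/= x0 |].
  by move=> phi tp; rewrite (ef _ tp) (cextension_extends m tp) subrr.
have [V [oV Vx HV]] : exists U, [/\ open U, U x & forall phi, testfun s M U phi -> f phi = 0].
  apply: contrapT => nV; have := sf x nV.
  by rewrite /= in_itv/= andbT leNgt x0.
(* Cutting at [x / 2] keeps the supports below a negative number, as [cextension_negative]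
   requires. *)
apply: nx; exists (V `&` `]-oo, (x / 2)[%classic); split.
- by apply: openI => //; exact: interval_open.
- by split => //=; rewrite in_itv/=; lra.
move=> phi /(testfunP s M_gt0)[cK sK cls_phi].
rewrite HV; last first.
  by apply/(testfunP s M_gt0); split => //; apply: subset_trans sK _; exact: subIsetl.
rewrite (@cextension_negative m (x / 2)) ?subr0//; first by lra.
  by apply/(testfunP s M_gt0); split.
by move=> y /sK[_]; rewrite /= !in_itv/= => /ltW.
Qed.

Lemma ccorrection_trivial m e phi : (forall i : nat, alpha + i.+1%:R != 0) -> ccorrection m e phi = 0.
Proof.
move=> nz; rewrite /ccorrection /cpair /correction !big_pred0 ?subr0 ?addr0//.
all: by move=> i; apply/negbTE.
Qed.

(** The function [b] of the expansion. Its sign combines the one in [uderivn] with the fact that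
    moments are subtracted; the term with [L] absorbs the transition moment. *)
Definition critical_coefficient k (e : R) : R[i] :=
  - ((-1) ^+ k / k`!%:R)%:C *
  ((moment theta A k e +i* moment theta B k e) + c * (transition_moment theta alpha k * L e)%:C).

Lemma ccorrection_critical k e phi : alpha = - k.+1%:R ->
  ccorrection k.+1 e phi = - (critical_coefficient k e / (e ^+ k.+1)%:C * uderivn k delta0 phi).
Proof.
move=> ak.
have corrE d G (u : R -> R) : correction theta L alpha d G k.+1 u e =
    derive1n k u 0 / k`!%:R * (e^-1 ^+ k.+1 * (moment theta G k e + d * transition_moment theta alpha k * L e)).
  rewrite /correction (big_pred1 ord_max)// => i; rewrite ak addrC subr_eq0 eqr_nat.
  by rewrite eqSS.
have sg : (-1) ^+ k * (-1) ^+ k = 1 :> R by rewrite -exprD addnn -mul2n exprM sqrrN !expr1n.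
have esg : (-1) ^+ k = ((-1) ^+ k)%:C :> R[i] by rewrite rmorphXn rmorphN1.
rewrite /ccorrection /cpair !corrE.
rewrite /critical_coefficient /uderivn /delta0 esg -fmorphV exprVn.
move: (moment _ A k e) (moment _ B k e) (transition_moment _ _ k) => mA mB T.
rewrite /cderivn -/(rpart phi) -/(ipart phi).
move: (derive1n k (rpart phi) 0) (derive1n k (ipart phi) 0) (e ^- k.+1) (k`!%:R^-1) => p q r w.
move: ((-1) ^+ k) sg => sg sg1.
case: c => c1 c2; apply: eqC => /=.
  rewrite -[LHS]mul1r -sg1; ring.
rewrite -[LHS]mul1r -sg1; ring.
Qed.

(** The moments contribute the logarithm; the term with [L] contributes a multiple of
    [L (a * e) / L e - 1], negligible by slow variation. *)
Lemma critical_coefficient_increment k a : alpha = - k.+1%:R -> 0 < a ->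
  ((critical_coefficient k (a * e) - (critical_coefficient k e +
     c * ((-1) ^+ k / k`!%:R * L e * ln a)%:C)) / (L e)%:C : R[i]^o) @[e --> 0^'+] --> (0 : R[i]^o).
Proof.
move=> ak a0; have s0 : alpha + k.+1%:R = 0 by rewrite ak addNr.
pose w : R := (-1) ^+ k / k`!%:R; pose T := transition_moment theta alpha k.
have main d G : (moment theta G k (a * e) - moment theta G k e) / L e @[e --> 0^'+] --> - d * ln a ->
    - w * ((moment theta G k (a * e) - moment theta G k e) / L e + d * T * (L (a * e) / L e - 1) + d * ln a)
      @[e --> 0^'+] --> 0.
  move=> H; have H2 : d * T * (L (a * e) / L e - 1) @[e --> 0^'+] --> d * T * (1 - 1).
    by apply: cvgMr; apply: cvgB; [exact: sv_ratio | exact: cvg_cst].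
  have e0 : - w * (- d * ln a + d * T * (1 - 1) + d * ln a) = 0 by ring.
  rewrite -[X in _ --> X]e0; apply: cvgMr; apply: cvgD; last exact: cvg_cst.
  by apply: cvgD; [exact: H | exact: H2].
have HA := main _ _ (critical_moment_increment M_gt0 M_logconvex smooth_theta theta0 theta1 bnd_theta
  A_lin A_quasi s0 a0).
have HB := main _ _ (critical_moment_increment M_gt0 M_logconvex smooth_theta theta0 theta1 bnd_theta
  B_lin B_quasi s0 a0).
have /near0P[d d0 Ld] := sv_positive sL.
apply: cvg_complex; [apply: cvg_trans (near_eq_cvg _) HA|apply: cvg_trans (near_eq_cvg _) HB].
  apply/near0P; exists d => // e ed; have L0 : L e != 0 by rewrite gt_eqF// Ld.
  rewrite Re_div /critical_coefficient -/w -/T; case: c => c1 c2 /=.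
  by move: (moment _ A k e) (moment _ A k (a * e)) (L e) (L (a * e)) (ln a) L0 => x1 x2 x3 x4 x5 x30; field.
apply/near0P; exists d => // e ed; have L0 : L e != 0 by rewrite gt_eqF// Ld.
rewrite Im_div /critical_coefficient -/w -/T; case: c => c1 c2 /=.
by move: (moment _ B k e) (moment _ B k (a * e)) (L e) (L (a * e)) (ln a) L0 => x1 x2 x3 x4 x5 x30; field.
Qed.

End Assembly.

Local Open Scope complex_scope.

Theorem theorem4p4 (R : realType) (M : nat -> R) (s : ultraclass)
    (L : R -> R) (alpha : R) (c : R[i]) (f0 : functional R) :
  weight_sequence M ->
  slowly_varying_at_origin L ->
  ultradistribution s M `]0, +oo[ f0 ->
  quasiasymptotic s M `]0, +oo[ f0
    (fun eps => eps `^ alpha * L eps) (fun phi => c * xpow alpha phi) ->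
  (exists f : functional R,
     ultradistribution s M [set: R] f /\ extends s M `]0, +oo[ f0 f) /\
  (forall f : functional R,
     ultradistribution s M [set: R] f ->
     extends s M `]0, +oo[ f0 f ->
     usupport s M f `<=` `[0, +oo[ ->
     ((forall k : nat, (1 <= k)%N -> alpha != - k%:R) ->
        exists g : functional R,
          [/\ ultradistribution s M [set: R] g,
              usupport s M g `<=` [set 0] &
              quasiasymptotic s M [set: R] (fun phi => f phi - g phi)
                (fun eps => eps `^ alpha * L eps)
                (fun phi => c * xplus alpha phi)]) /\
     (forall k : nat, (1 <= k)%N -> alpha = - k%:R ->
        exists (b : R -> R[i]) (g : functional R),
          [/\ forall a : R, 0 < a ->
                ((b (a * x) -
                    (b x + c * ((-1) ^+ k.-1 / (k.-1)`!%:R * L x * ln a)%:C))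
                   / (L x)%:C : R[i]^o) @[x --> (0 : R)^'+] --> (0 : R[i]^o),
              ultradistribution s M [set: R] g,
              usupport s M g `<=` [set 0] &
              forall phi : R -> R[i], testfun s M [set: R] phi ->
                ((dilate eps f phi -
                    (c * (L eps / eps ^+ k)%:C * Pf k phi
                     + b eps / (eps ^+ k)%:C * uderivn k.-1 delta0 phi
                     + dilate eps g phi))
                   / (L eps / eps ^+ k)%:C : R[i]^o)
                  @[eps --> (0 : R)^'+] --> (0 : R[i]^o)])).
Proof.
move=> wM sL uf0 qf0; have [theta [smooth_theta theta0 theta1 bnd_theta]] := cutoff_exists wM.
have [M_gt0 M_logconvex _ _] := wM.
(* The least [m] with [alpha + m + 1 > 0], so that [alpha + i + 1 <= 0] for [i < m]; it is also the
   [k] of [xplus]. *)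
have [m am am'] : exists2 m, 0 < alpha + m.+1%:R & m = Num.truncn (- alpha).
  by exists (Num.truncn (- alpha)) => //; have := truncnS_gt (- alpha); lra.
have ultra n an := cextension_ultradistribution M_gt0 M_logconvex smooth_theta theta0 theta1 bnd_theta
  sL uf0 qf0 (m := n) an.
have ext n := cextension_extends M_gt0 M_logconvex smooth_theta theta0 theta1 bnd_theta uf0 n.
have diff n f an := usupport_difference M_gt0 M_logconvex smooth_theta theta0 theta1 bnd_theta sL uf0 qf0
  (f := f) (m := n) an.
have lim n phi an := cextension_limit M_gt0 M_logconvex smooth_theta theta0 theta1 bnd_theta sL uf0 qf0
  (m := n) (phi := phi) an.
split; first by exists (cextension theta f0 m); split; [exact: ultra | exact: ext].
move=> f uf ef sf; split.
  move=> nz0; have nz (i : nat) : alpha + i.+1%:R != 0 by rewrite addr_eq0 nz0.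
  (* With this [g], the difference [f - g] is the constructed extension itself. *)
  exists (fun phi => f phi - cextension theta f0 m phi).
  have [ug sg] := diff m f am uf ef sf; split=> // phi tp.
  have ai i : (i < m)%N -> alpha + i.+1%:R <= 0 by rewrite am' truncn_gt_nat; lra.
  have fp : cfinite_part alpha m phi = xplus alpha phi by rewrite am' (cfinite_part_xplus M_gt0 nz tp).
  have := lim m phi am ai tp; rewrite fp.
  apply: cvg_trans; apply: near_eq_cvg; near=> e.
  rewrite ccorrection_trivial// addr0; congr (_ / _).
  by rewrite /dilate opprB addrC subrK.
(* For [alpha = - k.+1] the order is [k.+1], and [k] is the only critical index below it. *)
case=> // k _ ak; have ak1 : 0 < alpha + k.+2%:R by rewrite ak -(natr1 k.+1); lra.
exists (critical_coefficient theta L alpha c f0 k), (fun phi => f phi - cextension theta f0 k.+1 phi).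
have [ug sg] := diff k.+1 f ak1 uf ef sf; split=> //.
  move=> a a0.
  exact: (critical_coefficient_increment M_gt0 M_logconvex smooth_theta theta0 theta1 bnd_theta sL uf0 qf0 ak a0).
move=> phi tp.
have ai i : (i < k.+1)%N -> alpha + i.+1%:R <= 0.
  by move=> ik; rewrite ak addrC subr_le0 ler_nat.
have fp : cfinite_part alpha k.+1 phi = Pf k.+1 phi by rewrite ak cfinite_part_Pf.
have H := lim k.+1 phi ak1 ai tp; rewrite fp in H.
have /near0P[d d0 Ld] := sv_positive sL.
have ev : \forall e \near 0^'+,
   (dilate e (cextension theta f0 k.+1) phi + ccorrection theta L alpha c f0 k.+1 e phi)
     / (e `^ alpha * L e)%:C - c * Pf k.+1 phi =
   (dilate e f phi - (c * (L e / e ^+ k.+1)%:C * Pf k.+1 phi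
      + critical_coefficient theta L alpha c f0 k e / (e ^+ k.+1)%:C * uderivn k delta0 phi
      + dilate e (fun phi => f phi - cextension theta f0 k.+1 phi) phi)) / (L e / e ^+ k.+1)%:C.
  apply/near0P; exists d => // e ed; have e0 : 0 < e by case/andP: ed.
  have -> : e `^ alpha * L e = L e / e ^+ k.+1.
    by rewrite ak powRN powR_mulrn ?(ltW e0)// mulrC.
  rewrite (ccorrection_critical _ _ _ _ _ _ ak).
  have r0 : (L e / e ^+ k.+1)%:C != 0.
    by rewrite fmorph_eq0 gt_eqF// divr_gt0 ?exprn_gt0// Ld.
  move: r0; move: ((L e / _)%:C) (_ / _ * uderivn _ _ _) (Pf _ _) => r x y r0.
  by rewrite /dilate; move: (e^-1)%:C => t; field.
have H0 := cvgB H (@cvg_cst _ (c * Pf k.+1 phi : R[i]^o) _ (0 : R)^'+ _).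
rewrite subrr in H0; apply: cvg_trans (near_eq_cvg ev) _; exact: H0.
Unshelve. all: by end_near. Qed.
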